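(* Let $X$ be a real separable Banach space, and assume: (1) $Q:X^*\to X$ is linear, bounded, symmetric ($\langle Qx^*,y^*\rangle=\langle Qy^*,x^*\rangle$) and nonnegative ($\langle Qx^*,x^*\rangle\ge 0$), and $A:D(A)\subseteq X\to X$ generates a strongly continuous contraction semigroup $(e^{tA})_{t\ge0}$ on $X$; (2) for every $t>0$ the operator $Q_t:=\int_0^t e^{sA}Qe^{sA^*}\,ds$ is the covariance operator of a centred Gaussian measure on $X$; for every $x^*\in X^*$ the weak limit $Q_\infty x^*:=\lim_{t\to+\infty}Q_tx^*$ exists, and $Q_\infty$ is the covariance operator of a centred nondegenerate Gaussian measure $\mu_\infty$ on $X$; (3) for every $x^*\in D(A^* )$ one has $Q_\infty A^*x^*\in H$, and there is $c>0$ with $|Q_\infty A^*x^*|_H\le c\,|i^*x^*|_H$ for all $x^*\in D(A^* )$; (4) $U$ is a proper, $\|\cdot\|_X$-lower semicontinuous convex function on $X$ belonging to $W^{1,p}_H(X,\mu_\infty)$ for every $p\in[1,+\infty)$; set $\nu_\infty:=e^{-U}\mu_\infty$. Let $(T_2(t))_{t\ge0}$ be the perturbed Ornstein–Uhlenbeck semigroup on $L^2(X,\nu_\infty)$. Then $(T_2(t))_{t\ge0}$ can be uniquely extended to a positive contraction semigroup $(T_p(t))_{t\ge0}$ on $L^p(X,\nu_\infty)$ for every $p\in[1,+\infty)$. These semigroups are strongly continuous and are consistent in the sense that if $q\ge p$ then $T_p(t)f=T_q(t)f$ for every $f\in L^q(X,\nu_\infty)$ (and every $t\ge 0$).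
   Context: $H$ is the Reproducing Kernel Hilbert Space of $Q$: the completion of $QX^*$ under $[Qx^*,Qy^*]_H:=\langle Qx^*,y^*\rangle_{X\times X^*}$, continuously embedded in $X$ by $i:H\to X$; $i^*:X^*\to H$ is the adjoint (with $H^*\cong H$), and $Q=i\circ i^*$. By (3) and the density of $i^*D(A^* )$ in $H$ there is a unique $B\in\mathcal L(H)$ with $Bi^*x^*=Q_\infty A^*x^*$ for all $x^*\in D(A^* )$; it is known that $B+B^*=-\mathrm{Id}_H$. $\mathscr{FC}_b^{k}(X)$ is the set of functions $f(x)=\varphi(\langle x,x_1^*\rangle,\dots,\langle x,x_n^*\rangle)$ with $n\in\mathbb N$, $\varphi\in C_b^k(\mathbb R^n)$ (bounded and continuous with bounded continuous derivatives up to order $k$), $x_j^*\in X^*$. For such $f$ with $k=1$, $D_Hf(x):=i^*Df(x)=\sum_{j}\frac{\partial\varphi}{\partial\xi_j}(\langle x,x_1^*\rangle,\dots,\langle x,x_n^*\rangle)\,i^*x_j^*$. Under (1)–(3), $D_H$ is known to be closable in $L^p(X,\mu_\infty)$; $W^{1,p}_H(X,\mu_\infty)$ is the domain of the closure (still denoted $D_H$). Under (1)–(4), $e^{-U}\in W^{1,p}_H(X,\mu_\infty)$ for all $p\in[1,+\infty)$, so $\nu_\infty$ is a finite measure, and $D_H:\mathscr{FC}_b^1(X)\to L^p(X,\nu_\infty;H)$ is closable in $L^p(X,\nu_\infty)$ for $p\in(1,+\infty)$; $W^{1,p}_H(X,\nu_\infty)$ is the domain of its closure (still denoted $D_H$).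 The form $\mathcal E(u,v):=-\int_X[BD_Hu,D_Hv]_H\,d\nu_\infty$ with domain $W^{1,2}_H(X,\nu_\infty)$ is a (nonsymmetric) coercive closed form on $L^2(X,\nu_\infty)$. The associated operator $L_2$ has domain the set of $u\in W^{1,2}_H(X,\nu_\infty)$ for which there is $g\in L^2(X,\nu_\infty)$ with $\mathcal E(u,v)=-\int_X g v\,d\nu_\infty$ for all $v\in\mathscr{FC}_b^1(X)$, and $L_2u:=g$. It generates a strongly continuous contraction semigroup on $L^2(X,\nu_\infty)$, denoted $(T_2(t))_{t\ge0}$ and called the perturbed Ornstein–Uhlenbeck semigroup in $L^2(X,\nu_\infty)$. A semigroup on $L^p$ is positive if it maps nonnegative functions to nonnegative functions. Since $\nu_\infty$ is finite, $L^p(X,\nu_\infty)\subset L^2(X,\nu_\infty)$ for $p>2$, and in that case ''extended'' means that $T_p(t)$ is the restriction of $T_2(t)$ to $L^p(X,\nu_\infty)$. *)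

(* Defs.v *)
From HB Require Import structures.
From mathcomp Require Import all_boot all_order all_algebra.
From mathcomp Require Import all_classical all_reals all_analysis.

Set Implicit Arguments.
Unset Strict Implicit.
Unset Printing Implicit Defensive.

Import Order.TTheory GRing.Theory Num.Theory.
Import numFieldNormedType.Exports.

Local Open Scope classical_set_scope.
Local Open Scope ring_scope.

Section bounded_operators.
Context {R : realType}.

Definition is_bop (U V : normedModType R) : {pred U -> V} :=
  mem [set f : U -> V | linear f /\ continuous f].

Lemma is_bop_submod_closed (U V : normedModType R) : submod_closed (@is_bop U V).
Proof.
split; first by rewrite inE; split=> [a x y|x]; [rewrite scaler0 addr0|exact: cvg_cst].
move=> a f g; rewrite !inE => -[lf cf] [lg cg]; split=> [b x y|x].
  rewrite /= !fctE lf lg !scalerDr !scalerA -!addrA; congr (_ + _).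
    by rewrite mulrC.
  by rewrite addrCA.
by apply: cvgD; [apply: cvgZr; exact: cf|exact: cg].
Qed.

HB.instance Definition _ (U V : normedModType R) :=
  GRing.isSubmodClosed.Build R (U -> V) (@is_bop U V)
    (is_bop_submod_closed U V).

(* Bounded linear operators, as an lmodType under pointwise operations. *)
Record bop (U V : normedModType R) := Bop {
  bop_fun :> U -> V;
  bop_prop : bop_fun \in @is_bop U V }.

HB.instance Definition _ (U V : normedModType R) :=
  [isSub of bop U V for @bop_fun U V].
HB.instance Definition _ (U V : normedModType R) :=
  [Choice of bop U V by <:].
HB.instance Definition _ (U V : normedModType R) :=
  [SubChoice_isSubLmodule of bop U V by <:].

Lemma bop_is_linear (U V : normedModType R) (f : bop U V) : linear f.
Proof. by case: f => f /= /[!inE] -[]. Qed.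

HB.instance Definition _ (U V : normedModType R) (f : bop U V) :=
  GRing.isLinear.Build R U V *:%R f (bop_is_linear f).

Lemma bop_continuous (U V : normedModType R) (f : bop U V) : continuous f.
Proof. by case: f => f /= /[!inE] -[]. Qed.

Lemma bcomp_proof (U V W : normedModType R) (f : bop V W) (g : bop U V) :
  f \o g \in @is_bop U W.
Proof.
rewrite inE; split=> [a x y|x]; first by rewrite /= !linearP.
by apply: continuous_comp; exact: bop_continuous.
Qed.

Definition bcomp (U V W : normedModType R) (f : bop V W) (g : bop U V) :
  bop U W := Bop (bcomp_proof f g).

Definition opnorm (U V : normedModType R) (f : bop U V) : R :=
  sup [set `|f x| | x in [set x : U | `|x| <= 1]].

Definition dual (X : normedModType R) := bop X R^o.

End bounded_operators.

Notation borel X := (g_sigma_algebraType (@open X)).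

Definition separable (T : topologicalType) :=
  exists2 D : set T, countable D & dense D.

Section semigroups_and_generators.
Context {R : realType} (X : normedModType R).

Record C0_contraction_semigroup (S : R -> bop X X) : Prop := {
  C0_semigroup0 : forall x, S 0 x = x;
  C0_semigroupD : forall s t x, 0 <= s -> 0 <= t -> S (s + t) x = S s (S t x);
  C0_semigroup_contr : forall t x, 0 <= t -> `|S t x| <= `|x|;
  C0_semigroup_cont : forall x, {within `[0, +oo[, continuous (S ^~ x)} }.

(* An unbounded operator is given by its domain [D] and a function [A] whose
   values outside [D] are irrelevant. *)
Definition generates (D : set X) (A : X -> X) (S : R -> bop X X) :=
  forall x y, (D x /\ A x = y) <->
    (t^-1 *: (S t x - x) @[t --> 0^'+] --> y).

(* [adjoint_graph D A xs ys] : xs belongs to D(A^* ) and A^* xs = ys. *)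
Definition adjoint_graph (D : set X) (A : X -> X) (xs ys : dual X) :=
  forall x, D x -> xs (A x) = ys x.

End semigroups_and_generators.

Section bochner.
Context {R : realType} d (T : measurableType d) (V : normedModType R).
Variables (mu : {measure set T -> \bar R}) (D : set T).

Definition vsimple (s : T -> V) :=
  [/\ finite_set (range s), (forall v, measurable (s @^-1` [set v])) &
      forall v, v != 0 -> (mu (D `&` s @^-1` [set v]) < +oo)%E].

Definition vsimple_integral (s : T -> V) : V :=
  \sum_(v \in range s) fine (mu (D `&` s @^-1` [set v])) *: v.

(* [f] is Bochner integrable over [D], with integral [v]. *)
Definition bochner_integral (f : T -> V) (v : V) :=
  exists s : nat -> T -> V,
    [/\ forall n, vsimple (s n),
        {ae mu, forall x, D x -> s n x @[n --> \oo] --> f x},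
        (\int[mu]_(x in D) `|f x - s n x|%:E)%E @[n --> \oo] --> 0%E &
        vsimple_integral (s n) @[n --> \oo] --> v].

End bochner.

Section gaussian.
Context {R : realType} (X : completeNormedModType R).
Variable mu : probability (borel X) R.

(* Dirac masses at 0 count as (degenerate) centred Gaussian laws on R; the
   case [s = 0] is separate since [normal_prob 0 0] is not a Dirac mass. *)
Definition centred_gaussian :=
  forall xs : dual X, exists2 s : R, 0 <= s &
    forall A : set R, measurable A ->
      mu (xs @^-1` A) = if s == 0 then \d_(0 : R) A else normal_prob 0 s A.

Definition covariance_operator (C : dual X -> X) :=
  forall xs ys : dual X, ys (C xs) = \int[mu]_x (xs x * ys x).

(* No nonzero functional has a degenerate law. *)
Definition nondegenerate_measure :=
  forall xs : dual X, xs != 0 -> (0 < \int[mu]_x (xs x ^+ 2)%:E)%E.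

End gaussian.

Section rkhs.
Context {R : realType}.

Record hilbert_inner_product (H : completeNormedModType R)
    (ip : H -> H -> R) : Prop := {
  ip_sym : forall h k, ip h k = ip k h;
  ip_linear : forall a h k l, ip (a *: h + k) l = a * ip h l + ip k l;
  ip_norm : forall h, `|h| ^+ 2 = ip h h }.

(* [H] is the completion of [Q X^*] for the inner product
   [Q xs, Q ys] := <Q xs, ys>, and [i] is its embedding in [X]: the copy of
   [Q xs] in [H] is [istar xs], and [istar] is the adjoint of [i]. *)
Record is_RKHS (X : completeNormedModType R) (Q : dual X -> X)
    (H : completeNormedModType R) (ip : H -> H -> R)
    (i : bop H X) (istar : dual X -> H) : Prop := {
  rkhs_hilbert : hilbert_inner_product ip;
  rkhs_isometry : forall xs ys, ip (istar xs) (istar ys) = ys (Q xs);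
  rkhs_dense : dense (range istar);
  rkhs_inj : injective i;
  rkhs_factor : forall xs, i (istar xs) = Q xs;
  rkhs_adjoint : forall xs h, ip (istar xs) h = xs (i h) }.

End rkhs.

Section sobolev.
Context {R : realType} (X H : completeNormedModType R).
Variable istar : dual X -> H.

Local Notation ebase j := (delta_mx ord0 j).

Definition Cb1 n (phi : 'rV[R]_n -> R^o) :=
  [/\ continuous phi,
      exists M : R, forall z, `|phi z| <= M &
      forall j : 'I_n,
        [/\ forall z, derivable phi z (ebase j),
            continuous (fun z => 'D_(ebase j) phi z) &
            exists M : R, forall z, `|'D_(ebase j) phi z| <= M]].

(* [FCb1_grad f g] : f belongs to FC_b^1(X) and g = D_H f. *)
Definition FCb1_grad (f : X -> R) (g : X -> H) :=
  exists n (phi : 'rV[R]_n -> R^o) (xs : 'I_n -> dual X),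
    [/\ Cb1 phi, forall x, f x = phi (\row_j xs j x) &
        forall x, g x =
          \sum_(j < n) ('D_(ebase j) phi (\row_k xs k x) : R) *: istar (xs j)].

Variable mu : {measure set (borel X) -> \bar R}.

Definition LpH (p : R) (g : X -> H) :=
  (forall W : set H, open W -> measurable (g @^-1` W : set (borel X))) /\
  ('N[mu]_p%:E[(fun x => `|g x|%:E)] < +oo)%E.

(* [W1H p u g] : (u, g) is in the closure in L^p(mu) x L^p(mu; H) of the graph
   of D_H on FC_b^1(X), that is, u is in W^{1,p}_H(X, mu) and D_H u = g. *)
Definition W1H (p : R) (u : X -> R) (g : X -> H) :=
  [/\ u \in Lfun mu p%:E, LpH p g &
      exists (f : nat -> X -> R) (df : nat -> X -> H),
        [/\ forall n, FCb1_grad (f n) (df n),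
            ('N[mu]_p%:E[(fun x => (f n x - u x)%:E)])%E @[n --> \oo] --> 0%E &
            ('N[mu]_p%:E[(fun x => `|df n x - g x|%:E)])%E @[n --> \oo] --> 0%E]].

End sobolev.

Section potential.
Context {R : realType} (X : normedModType R).
Local Open Scope ereal_scope.

Definition proper_fun (U : X -> \bar R) :=
  (forall x, U x != -oo) /\ exists x, U x != +oo.

Definition econvex (U : X -> \bar R) :=
  forall (t : R) x y, (0 <= t <= 1)%R ->
    U (t *: x + (1 - t) *: y)%R <= t%:E * U x + (1 - t)%:E * U y.

End potential.

(* Operators on L^p act on representatives: only their values on [Lfun mu p],
   up to equality almost everywhere, are meaningful. *)
Section Lp_semigroups.
Context {R : realType} d (T : measurableType d).
Variables (mu : {measure set T -> \bar R}) (p : R).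
Local Notation Lp := (Lfun mu p%:E).
Local Notation norm f := ('N[mu]_p%:E[EFin \o f%R])%E.
Implicit Types (S : R -> (T -> R) -> T -> R) (f g u : T -> R).

Record Lp_operator (F : (T -> R) -> T -> R) : Prop := {
  Lp_operator_mem : forall f, f \in Lp -> F f \in Lp;
  Lp_operator_ae : forall f g, f \in Lp -> g \in Lp ->
    f = g %[ae mu] -> F f = F g %[ae mu];
  Lp_operator_linear : forall (a : R) f g, f \in Lp -> g \in Lp ->
    F (fun x => a * f x + g x) = (fun x => a * F f x + F g x) %[ae mu] }.

Record Lp_contraction_semigroup S : Prop := {
  Lp_semigroup_op : forall t, 0 <= t -> Lp_operator (S t);
  Lp_semigroup0 : forall f, f \in Lp -> S 0 f = f %[ae mu];
  Lp_semigroupD : forall s t f, 0 <= s -> 0 <= t -> f \in Lp ->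
    S (s + t) f = S s (S t f) %[ae mu];
  Lp_semigroup_contr : forall t f, 0 <= t -> f \in Lp ->
    (norm (S t f) <= norm f)%E }.

Definition Lp_strongly_continuous S :=
  forall f (t0 : R), f \in Lp -> 0 <= t0 ->
    norm (S t f \- S t0 f) @[t --> within [set t | 0 <= t] (nbhs t0)] --> 0%E.

Definition Lp_positive S :=
  forall t f, 0 <= t -> f \in Lp ->
    {ae mu, forall x, 0 <= f x} -> {ae mu, forall x, 0 <= S t f x}.

(* [Lp_generator S u g] : u is in the domain of the generator of S, which maps
   u to g. *)
Definition Lp_generator S u g :=
  [/\ u \in Lp, g \in Lp &
      norm (fun x => t^-1 * (S t u x - u x) - g x) @[t --> 0^'+] --> 0%E].

End Lp_semigroups.

(* Agreement on the common domain: for p <= 2, S extends T2 from L^2 to L^p;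
   for p > 2, S is the restriction of T2 to L^p. *)
Definition Lp_extends {R : realType} d (T : measurableType d)
    (mu : {measure set T -> \bar R}) (p : R) (T2 S : R -> (T -> R) -> T -> R) :=
  forall t f, 0 <= t -> f \in Lfun mu 2%:E -> f \in Lfun mu p%:E ->
    S t f = T2 t f %[ae mu].

Section perturbed_OU.
Context {R : realType} (X H : completeNormedModType R).
Variables (ip : H -> H -> R) (istar : dual X -> H) (B : bop H H).
Variable nu : {measure set (borel X) -> \bar R}.

(* The form E, in terms of the gradients of its arguments. *)
Definition dirichlet_form (gu gv : X -> H) : R :=
  - \int[nu]_x ip (B (gu x)) (gv x).

(* [L2_graph u g] : u is in D(L_2) and L_2 u = g. *)
Definition L2_graph (u g : X -> R) :=
  g \in Lfun nu 2%:E /\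
  exists2 gu : X -> H, W1H istar nu 2 u gu &
    forall v gv, FCb1_grad istar v gv ->
      dirichlet_form gu gv = - \int[nu]_x (g x * v x).

Record perturbed_OU_semigroup (T2 : R -> (X -> R) -> X -> R) : Prop := {
  OU_contr : Lp_contraction_semigroup nu 2 T2;
  OU_cont : Lp_strongly_continuous nu 2 T2;
  OU_generator : forall u g, Lp_generator nu 2 T2 u g <-> L2_graph u g }.

End perturbed_OU.

(* Main.v *)
(* Testing the form against a smooth version of the sign of [u - c], and using
   [ip (B h) h <= 0], shows that the generator [L] of [T2] satisfies
   [int (L u) sgn (u - c) <= 0]; hence [int |T2 t f - c| <= int |f - c|] for all
   constants [c]. Here [B] is dissipative because [Qinf] dominates
   [e^{tA} Qinf e^{tA^*}]. The measure [nu_inf] is finite, as [U] has an affine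
   minorant and linear functionals have Gaussian exponential moments, so constants
   are integrable: comparing [c = 0] and [c = M] gives positivity, [c = 1] gives
   [T2 t 1 = 1], and [c = 0] is the contraction property in [L1], by which [T2]
   extends to [L1]. The contraction property in [Lp] is then Jensen's inequality
   for this extension. *)
Require Import Defs.
From HB Require Import structures.
From mathcomp Require Import all_boot all_order all_algebra.
From mathcomp Require Import finmap.
From mathcomp Require Import all_classical all_reals all_analysis.
From mathcomp Require Import measurable_realfun zify ring lra.
Set Implicit Arguments.
Unset Strict Implicit.
Unset Printing Implicit Defensive.
Import Order.TTheory GRing.Theory Num.Theory.
Import numFieldNormedType.Exports.
Local Open Scope classical_set_scope.
Local Open Scope ring_scope.

(** * Decreasing functionals of contraction semigroups *)

(** The estimate on the generator must be turned into one on the semigroup, although [|u - c|] is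
    not smooth and its sign is not a cylindrical test function. Hence the modulus becomes
    [sqrt ((u - c)^2 + e^2)], and [e] tends to 0 at the end. Dissipativity is used as a comparison
    of [F w] with [F x] for [x] close to [w - s L w]; two points of an orbit at times [t + s] and
    [t] are such a pair with error o(s), so [F] decreases by telescoping. Elements of L2 are
    functions here, not classes, so the abstract part works with a seminorm and with semigroup laws
    up to seminorm 0.

    For [B], the domination of covariances gives the sign of [ip (B h) h] only on the image under
    [istar] of the domain of the adjoint of [A]. The adjoint semigroup may fail to be strongly
    continuous; enough of that domain is found by composing functionals with time means of [S], and
    a projection argument makes the image dense in [H].

    In the passage to Lp, an element of L1 extending [T2 t f] is fixed by its distances to the
    values of [T2 t] on L2. One family then serves all [p], because [Lp] lies in L1 for a finite
    measure. *)

Lemma subr_addr0_eq0 (V : zmodType) (a b : V) : a - b + 0 = 0 -> a = b.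
Proof. by rewrite addr0 => /eqP; rewrite subr_eq0 => /eqP. Qed.

(* Decides identities of abelian groups by moving each pair of opposite terms
   to the front of the sum and cancelling it. *)
Ltac zmod :=
  apply: subr_addr0_eq0;
  rewrite ?(opprD, opprK, opprB, scalerBr, scalerDr, scalerN) -?addrA ?add0r;
  repeat match goal with |- context [GRing.opp ?a] =>
    do 20? rewrite (addrCA _ a); do 20? rewrite (addrCA _ (- a)); rewrite addKr
  end; reflexivity.

(** * Semigroups on complete seminormed spaces, used for the norm of [X] and for L2 *)

Section seminormed_semigroup.
Context {R : realType} (V : lmodType R) (N : V -> R).
Context (N_ge0 : forall x, 0 <= N x) (N_D : forall x y, N (x + y) <= N x + N y).
Context (N_Z : forall a x, N (a *: x) = `|a| * N x).
Context (N_complete : forall u : nat -> V,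
  (forall e, 0 < e -> exists n0, forall m n, (n0 <= m)%N -> (n0 <= n)%N ->
    N (u m - u n) <= e) ->
  exists l, forall e, 0 < e -> exists n0, forall n, (n0 <= n)%N ->
    N (u n - l) <= e).
Context (T : R -> V -> V).
Context (T_contr : forall t x y, 0 <= t -> N (T t x - T t y) <= N (x - y)).
Context (T_lin : forall t a x y, 0 <= t ->
  N (T t (a *: x + y) - (a *: T t x + T t y)) = 0).
Context (T_add : forall s t x, 0 <= s -> 0 <= t ->
  N (T (s + t) x - T s (T t x)) = 0).
Context (T_cont : forall x e, 0 < e ->
  exists2 d, 0 < d & forall t, 0 <= t < d -> N (T t x - x) <= e).

Lemma seminorm0 : N 0 = 0.
Proof. by rewrite -(scale0r 0) N_Z normr0 mul0r. Qed.

Lemma seminormN x : N (- x) = N x.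
Proof. by rewrite -scaleN1r N_Z normrN1 mul1r. Qed.

Lemma seminorm_distC x y : N (x - y) = N (y - x).
Proof. by rewrite -seminormN opprB. Qed.

Lemma seminorm_dist y x z : N (x - z) <= N (x - y) + N (y - z).
Proof. by apply: le_trans (N_D _ _); rewrite addrA subrK. Qed.

Lemma seminorm_sum n (u : nat -> V) c : (forall k, (k < n)%N -> N (u k) <= c) ->
  N (\sum_(k < n) u k) <= n%:R * c.
Proof.
elim: n => [|n IH] uc; first by rewrite big_ord0 seminorm0 mul0r.
rewrite big_ord_recr /= -natr1 mulrDl mul1r.
apply: le_trans (N_D _ _) _; apply: lerD; last exact: uc.
by apply: IH => k kn; apply: uc; rewrite ltnS ltnW.
Qed.

Lemma seminorm_eq0_sub x y z : N (x - y) = 0 -> N (x - z) = N (y - z).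
Proof.
move=> xy; apply/le_anti/andP; split.
  by rewrite (le_trans (seminorm_dist y _ _))// xy add0r.
by rewrite (le_trans (seminorm_dist x _ _))// seminorm_distC xy add0r.
Qed.

Lemma semigroup_opp t x y : 0 <= t -> N (T t (x - y) - (T t x - T t y)) = 0.
Proof.
move=> t0; have := T_lin (-1) y x t0.
by rewrite !scaleN1r [- y + _]addrC [- T t y + _]addrC.
Qed.

Lemma semigroup_sum t n (u : nat -> V) : 0 <= t ->
  N (T t (\sum_(k < n) u k) - \sum_(k < n) T t (u k)) = 0.
Proof.
move=> t0; elim: n => [|n IH].
  rewrite !big_ord0 subr0.
  by have := semigroup_opp 0 0 t0; rewrite !subrr subr0.
rewrite !big_ord_recr /= [X in T t X]addrC.
rewrite -[X in X + \sum_(i < n) _]scale1r.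
rewrite (seminorm_eq0_sub _ (T_lin _ _ _ t0)) !scale1r.
by rewrite [X in _ - X]addrC opprD addrACA subrr add0r IH.
Qed.

(** [y] is the right derivative at 0 of the orbit of [w]; the inequality is multiplied by [t], which
    suits telescoping over small steps. *)
Definition generator_at w y := forall e, 0 < e ->
  exists2 d, 0 < d & forall t, 0 < t < d -> N (T t w - w - t *: y) <= t * e.

Lemma semigroup_shift t s x : 0 <= t -> 0 <= s ->
  N (T (t + s) x - T t x) <= N (T s x - x).
Proof.
move=> t0 s0; rewrite (seminorm_eq0_sub _ (T_add _ t0 s0)).
exact: T_contr.
Qed.

(* The dyadic Riemann sums of [\int_0^1 T (h s) x ds]. *)
Definition orbit_mean h x n : V :=
  2^-1 ^+ n *: \sum_(k < 2 ^ n) T (h * (k%:R * 2^-1 ^+ n)) x.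

(** This writes a coarse dyadic sum on a finer grid, each term being repeated [b] times. *)
Lemma sum_divn a b (g : nat -> V) : (0 < b)%N ->
  \sum_(k < a * b) g (k %/ b)%N = b%:R *: \sum_(k < a) g k.
Proof.
move=> b0; elim: a => [|a IH]; first by rewrite mul0n !big_ord0 scaler0.
rewrite mulSn addnC big_split_ord IH big_ord_recr scalerDr; congr (_ + _).
rewrite (eq_bigr (fun=> g a)) ?sumr_const ?card_ord ?scaler_nat// => i _ /=.
by rewrite divnMDl// divn_small ?addn0.
Qed.

(** Each fine grid point is compared with the coarse one below it, at distance less than [h * 2^-n].
    Contractivity carries the modulus of continuity at time 0 along the whole orbit, so [d] serves
    for all grid points. *)
Lemma orbit_mean_dist h x e d : 0 < h -> (forall t, 0 <= t < d -> N (T t x - x) <= e) ->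
  forall n m, h * 2^-1 ^+ n < d -> (n <= m)%N ->
  N (orbit_mean h x m - orbit_mean h x n) <= e.
Proof.
move=> h0 Hd n m hn nm.
have -> : orbit_mean h x n = 2^-1 ^+ m *:
    \sum_(k < 2 ^ m) T (h * ((k %/ 2 ^ (m - n))%:R * 2^-1 ^+ n)) x.
  have -> : (2 ^ m = 2 ^ n * 2 ^ (m - n))%N by rewrite -expnD subnKC.
  rewrite (sum_divn _ (fun k => T (h * (k%:R * 2^-1 ^+ n)) x)) ?expn_gt0//.
  rewrite scalerA natrX; congr (_ *: _).
  have -> : 2^-1 ^+ m = 2^-1 ^+ n * 2^-1 ^+ (m - n) :> R by rewrite -exprD subnKC.
  by rewrite -mulrA -exprMn mulVf ?pnatr_eq0// expr1n mulr1.
rewrite /orbit_mean -scalerBr -sumrB N_Z ger0_norm ?exprn_ge0 ?invr_ge0//.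
set g := fun k : nat => T (h * (k%:R * 2^-1 ^+ m)) x -
  T (h * ((k %/ 2 ^ (m - n))%:R * 2^-1 ^+ n)) x.
rewrite (le_trans (ler_wpM2l _ (@seminorm_sum _ g e _)))// ?exprn_ge0 ?invr_ge0//; last first.
  by rewrite mulrA natrX -exprMn mulVf ?pnatr_eq0// expr1n mul1r.
move=> k km; rewrite /g.
set j := (k %/ _)%N; set r := (k %% 2 ^ (m - n))%N.
have -> : k%:R * 2^-1 ^+ m = j%:R * 2^-1 ^+ n + r%:R * 2^-1 ^+ m :> R.
  rewrite {1}(divn_eq k (2 ^ (m - n))) natrD mulrDl natrM natrX; congr (_ + _).
  have -> : 2^-1 ^+ m = 2^-1 ^+ (m - n) * 2^-1 ^+ n :> R by rewrite -exprD subnK.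
  by rewrite mulrA -(mulrA _ (2 ^+ _)) -exprMn divff ?pnatr_eq0// expr1n mulr1.
have p0 i : 0 <= 2^-1 ^+ i :> R by rewrite exprn_ge0 ?invr_ge0.
rewrite mulrDr (le_trans (semigroup_shift _ _ _))//.
- by rewrite !mulr_ge0// ltW.
- by rewrite !mulr_ge0// ltW.
apply: Hd; rewrite !mulr_ge0 ?(ltW h0)//=.
apply: le_lt_trans hn; rewrite ler_wpM2l ?(ltW h0)//.
rewrite -(subnK nm) exprD mulrA ler_piMl//.
have : (r <= 2 ^ (m - n))%N by rewrite ltnW// ltn_mod expn_gt0.
rewrite -(ler_nat R) natrX => /(ler_wpM2r (p0 (m - n)%N)) /le_trans; apply.
by rewrite -exprMn divff ?pnatr_eq0// expr1n.
Qed.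

Lemma sum_shift (a : nat -> V) M j :
  \sum_(k < M) a (j + k)%N - \sum_(k < M) a k =
  \sum_(i < j) (a (i + M)%N - a i).
Proof.
rewrite sumrB; apply/eqP; rewrite subr_eq addrAC eq_sym subr_eq; apply/eqP.
have E m n : \sum_(k < m) a (n + k)%N + \sum_(k < n) a k = \sum_(k < n + m) a k.
  by rewrite big_split_ord addrC.
by under eq_bigr do rewrite addnC; rewrite !E addnC.
Qed.

Lemma semigroup_contr0 t x : 0 <= t -> N (T t x) <= N x.
Proof.
move=> t0; have := T_contr x 0 t0.
rewrite subr0 => H2.
have := seminorm_eq0_sub 0 (semigroup_opp 0 0 t0).
rewrite !subrr !subr0 seminorm0 => H0.
apply: le_trans (le_trans (seminorm_dist (T t 0) _ 0) _).
  by rewrite subr0.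
by rewrite subr0 H0 addr0.
Qed.

Lemma semigroup_scale t a x : 0 <= t -> N (T t (a *: x) - a *: T t x) = 0.
Proof.
move=> t0; rewrite -[a *: x]addr0 (seminorm_eq0_sub _ (T_lin _ _ _ t0)).
rewrite addrAC subrr add0r; apply/le_anti; rewrite N_ge0 andbT.
by rewrite -seminorm0 semigroup_contr0.
Qed.

Lemma seminorm_scaler a x : N x = 0 -> N (a *: x) = 0.
Proof. by rewrite N_Z => ->; rewrite mulr0. Qed.

Lemma seminorm_sum_eq0 n (u v : nat -> V) : (forall k, N (u k - v k) = 0) ->
  N (\sum_(k < n) u k - \sum_(k < n) v k) = 0.
Proof.
move=> uv; apply/le_anti; rewrite N_ge0 andbT -sumrB.
rewrite (le_trans (@seminorm_sum _ (fun k => u k - v k) 0 _)) ?mulr0//.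
by move=> k _; rewrite uv.
Qed.

(** Discrete form of the fact that shifting the mean over [[0, h]] by a time [t] changes it by
    [h^-1] times the integral of [T s (T h x - x)] over [s] in [[0, t]]: a shift by [j] grid steps
    leaves only [j] terms, and index [i + 2 ^ n] is the time of index [i] increased by [h]. *)
Lemma orbit_mean_increment h x n j c : 0 < h ->
  (forall i, (i < j)%N ->
     N (T (h * (i%:R * 2^-1 ^+ n)) (T h x - x) - (T h x - x)) <= c) ->
  N (T (h * (j%:R * 2^-1 ^+ n)) (orbit_mean h x n) - orbit_mean h x n -
     (j%:R * 2^-1 ^+ n) *: (T h x - x)) <= j%:R * 2^-1 ^+ n * c.
Proof.
move=> h0 Hc; set g := T h x - x; set a := 2^-1 ^+ n.
have a0 : 0 <= a by rewrite exprn_ge0 ?invr_ge0.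
have ja i : 0 <= h * (i%:R * a) by rewrite !mulr_ge0// ltW.
rewrite -addrA -opprD (@seminorm_eq0_sub _ (a *: \sum_(k < 2 ^ n) T (h * ((j + k)%:R * a)) x)); last first.
  rewrite (seminorm_eq0_sub _ (semigroup_scale _ _ _))//.
  rewrite -scalerBr; apply: seminorm_scaler.
  rewrite (seminorm_eq0_sub _ (@semigroup_sum _ _ (fun k => T (h * (k%:R * 2^-1 ^+ n)) x) _))//.
  apply: (@seminorm_sum_eq0 _ (fun k => T (h * (j%:R * a)) (T (h * (k%:R * a)) x))
    (fun k => T (h * ((j + k)%:R * a)) x)) => k.
  by rewrite seminorm_distC natrD mulrDl mulrDr T_add.
rewrite opprD addrA -scalerBr (sum_shift (fun k => T (h * (k%:R * a)) x)).
have -> : (j%:R * a) *: g = a *: \sum_(i < j) g.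
  by rewrite sumr_const card_ord -[in RHS]scaler_nat scalerA mulrC.
rewrite -scalerBr -sumrB N_Z ger0_norm// -mulrA mulrCA ler_wpM2l//.
apply: (@seminorm_sum _
  (fun i => T (h * ((i + 2 ^ n)%:R * a)) x - T (h * (i%:R * a)) x - g)) => i ij.
apply: le_trans (Hc i ij); rewrite le_eqVlt; apply/orP; left; apply/eqP.
apply: seminorm_eq0_sub; rewrite seminorm_distC.
rewrite (seminorm_eq0_sub _ (semigroup_opp _ _ _))// opprB addrA subrK.
rewrite seminorm_distC -(T_add x (ja i) (ltW h0)); congr (N (T _ x - _)).
by rewrite natrD mulrDl mulrDr natrX /a -exprMn divff ?pnatr_eq0// expr1n mulr1.
Qed.

Lemma half_expn_lt (e : R) : 0 < e ->
  exists n0, forall n, (n0 <= n)%N -> 2^-1 ^+ n < e.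
Proof.
move=> e0; have [n0 _ H] := near_infty_natSinv_expn_lt (PosNum e0).
by exists n0 => n n0n; have := H n n0n; rewrite /= div1r exprVn.
Qed.

Lemma orbit_mean_generator h x : 0 < h -> forall w,
  (forall e : R, 0 < e -> exists n0, forall n, (n0 <= n)%N ->
     N (orbit_mean h x n - w) <= e) ->
  generator_at w (h^-1 *: (T h x - x)).
Proof.
move=> h0 w w_lim e e0; set g := T h x - x.
have eh0 : 0 < h * e by rewrite mulr_gt0.
have [d d0 Hd] := T_cont g eh0.
exists d => // t /andP[t0 td].
(* The bound [t * e] leaves no room for the discretization error, which vanishes as [n] grows with
   [t] fixed; [eta] absorbs it. *)
apply/ler_addgt0Pr => eta eta0.
have et4 : 0 < eta / 4 by rewrite divr_gt0.
have [d2 d20 Hd2] := T_cont w et4.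
have [n1 Hn1] := w_lim _ et4.
(* The first bound makes the grid finer than the modulus [d2] of the orbit of [w]; the second makes
   one grid step times [N g] negligible. The added 1 allows for [N g = 0]. *)
have [|n2 Hn2] := @half_expn_lt (Num.min (d2 / h) (eta / 4 / (N g + 1))).
  by rewrite lt_min !divr_gt0// ltr_wpDl.
pose n := maxn n1 n2; pose a : R := 2^-1 ^+ n.
have := Hn2 n (leq_maxr _ _); rewrite lt_min -/a => /andP[ad2 aeta].
have {}Hn1 := Hn1 n (leq_maxl _ _).
have a0 : 0 < a by rewrite exprn_gt0// invr_gt0.
(* [t' = h * (j * a)] is the last grid point not after [t]. *)
pose j := Num.truncn (t / (h * a)).
have ha0 : 0 < h * a by rewrite mulr_gt0.
have /Num.Theory.truncn_itv : 0 <= t / (h * a) by rewrite divr_ge0// ltW.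
rewrite -/j ler_pdivlMr// ltr_pdivrMr// => /andP[jt tj].
have {jt}jt : h * (j%:R * a) <= t by rewrite mulrCA mulrC mulrC.
have {tj}tj : t - h * (j%:R * a) < h * a.
  by move: tj; rewrite -natr1 mulrDl mul1r mulrCA -ltrBlDl.
set t' := h * (j%:R * a) in jt tj.
have t'0 : 0 <= t' by rewrite /t' !mulr_ge0// ltW.
have A1 : N (T t w - T t' w) <= eta / 4.
  rewrite -{1}(subrKC t' t) (le_trans (semigroup_shift _ _ _))// ?subr_ge0//.
  apply: Hd2; rewrite subr_ge0 jt /= (lt_trans tj)//.
  by move: ad2; rewrite ltr_pdivlMr// mulrC.
have A2 : N (T t' w - T t' (orbit_mean h x n)) <= eta / 4.
  by rewrite (le_trans (T_contr _ _ _))// seminorm_distC.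
have A3 : N (T t' (orbit_mean h x n) - orbit_mean h x n - (j%:R * a) *: g) <= t * e.
  apply: le_trans (@orbit_mean_increment h x n j (h * e) h0 _) _.
    move=> i ij; apply: Hd; rewrite !mulr_ge0 ?(ltW h0) ?(ltW a0)//=.
    apply: le_lt_trans td; apply: le_trans jt; rewrite ler_wpM2l ?(ltW h0)//.
    by rewrite ler_wpM2r ?(ltW a0)// ler_nat ltnW.
  by rewrite mulrA ler_wpM2r ?(ltW e0)// mulrC.
have A4 : N ((j%:R * a) *: g - (t / h) *: g) <= eta / 4.
  rewrite -scalerBl N_Z distrC ger0_norm; last first.
    by rewrite subr_ge0 ler_pdivlMr// mulrC.
  have : t / h - j%:R * a <= a.
    by rewrite lerBlDr ler_pdivrMr// mulrDl -lerBlDr mulrC (mulrC _ h) ltW.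
  move=> /(ler_wpM2r (N_ge0 g)) /le_trans; apply.
  move: aeta; rewrite ltr_pdivlMr ?ltr_wpDl// => /ltW /(le_trans _); apply.
  by rewrite ler_wpM2l ?(ltW a0)// lerDl.
rewrite scalerA.
have -> : T t w - w - (t / h) *: g = (T t w - T t' w) +
   (T t' w - T t' (orbit_mean h x n)) +
   (T t' (orbit_mean h x n) - orbit_mean h x n - (j%:R * a) *: g) +
   (orbit_mean h x n - w) + ((j%:R * a) *: g - (t / h) *: g).
  zmod.
have := N_D; move: A1 A2 A3 A4 Hn1.
move: (T t w - T t' w) (T t' w - _) (_ - (j%:R * a) *: g) (_ - (t / h) *: g) (_ - w).
move=> x1 x2 x3 x4 x5 A1 A2 A3 A4 A5 ND.
have := ND (x1 + x2 + x3 + x5) x4; have := ND (x1 + x2 + x3) x5.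
have := ND (x1 + x2) x3; have := ND x1 x2.
lra.
Qed.

(** The mean of the orbit of [x] over a short interval lies in the domain and is close to [x]. *)
Lemma generator_dense x e : 0 < e ->
  exists w y, N (w - x) <= e /\ generator_at w y.
Proof.
move=> e0; have [d d0 Hd] := T_cont x e0.
have e20 : 0 < e / 2 by rewrite divr_gt0.
have [d2 d20 Hd2] := T_cont x e20.
have h0 : 0 < d2 / 2 by rewrite divr_gt0.
have hd : d2 / 2 < d2 by rewrite ltr_pdivrMr// mulr_natr mulr2n ltrDl.
have cau : forall c : R, 0 < c -> exists n0, forall m n, (n0 <= m)%N -> (n0 <= n)%N ->
    N (orbit_mean (d2 / 2) x m - orbit_mean (d2 / 2) x n) <= c.
  move=> c c0; have c20 : 0 < c / 2 by rewrite divr_gt0.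
  have [dc dc0 Hdc] := T_cont x c20.
  have [|n0 Hn0] := @half_expn_lt (dc / (d2 / 2)); first by rewrite divr_gt0.
  have hn0 : d2 / 2 * 2^-1 ^+ n0 < dc.
    by have := Hn0 _ (leqnn n0); rewrite ltr_pdivlMr// mulrC.
  exists n0 => m n n0m n0n.
  rewrite [leRHS]splitr (le_trans (seminorm_dist (orbit_mean (d2 / 2) x n0) _ _))//.
  apply: lerD; first exact: (orbit_mean_dist h0 Hdc).
  by rewrite seminorm_distC; exact: (orbit_mean_dist h0 Hdc).
have [w Hw] := N_complete cau.
exists w, ((d2 / 2)^-1 *: (T (d2 / 2) x - x)); split; last exact: orbit_mean_generator.
have [n0 Hn0] := Hw _ e20.
rewrite [leRHS]splitr (le_trans (seminorm_dist (orbit_mean (d2 / 2) x n0) _ _))//.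
rewrite lerD//; first by rewrite seminorm_distC; exact: Hn0.
have T0 : N (T 0 x - x) = 0.
  apply/le_anti; rewrite N_ge0 andbT; apply/ler_addgt0Pr => c c0.
  by have [dc dc0 Hdc] := T_cont x c0; rewrite add0r; apply: Hdc; rewrite lexx.
(* The mean of level 0 has the single term [T 0 x], which is [x] up to seminorm 0. *)
have -> : N (orbit_mean (d2 / 2) x n0 - x) =
    N (orbit_mean (d2 / 2) x n0 - orbit_mean (d2 / 2) x 0).
  rewrite seminorm_distC [RHS]seminorm_distC; apply: seminorm_eq0_sub.
  rewrite /orbit_mean expr0 scale1r big_ord_recl big_ord0 addr0 mul0r mulr0.
  by rewrite seminorm_distC.
by apply: (orbit_mean_dist h0 Hd2); rewrite ?expr0 ?mulr1.
Qed.

Lemma generator_semigroup t w y : 0 <= t -> generator_at w y ->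
  generator_at (T t w) (T t y).
Proof.
move=> t0 wy e e0; have [d d0 Hd] := wy e e0; exists d => // s sd.
apply: le_trans (Hd s sd); case/andP: sd => s0 _.
apply: le_trans (semigroup_contr0 _ t0); rewrite le_eqVlt; apply/orP; left; apply/eqP.
rewrite -[LHS]addr0 -[RHS]addr0.
have E : N (T s (T t w) - T t w - s *: T t y - T t (T s w - w - s *: y)) = 0.
  rewrite seminorm_distC (seminorm_eq0_sub _ (semigroup_opp _ _ t0)).
  rewrite seminorm_distC.
  have -> : T s (T t w) - T t w - s *: T t y - (T t (T s w - w) - T t (s *: y)) =
    (T t (s *: y) - s *: T t y) + (T s (T t w) - T t w - T t (T s w - w)).
    by zmod.
  apply/le_anti; rewrite N_ge0 andbT (le_trans (N_D _ _))//.
  rewrite semigroup_scale// add0r.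
  have -> : T s (T t w) - T t w - T t (T s w - w) =
    (T s (T t w) - T t (T s w)) - (T t (T s w - w) - (T t (T s w) - T t w)) by zmod.
  rewrite (le_trans (N_D _ _))// seminormN semigroup_opp// addr0.
  by rewrite -(seminorm_eq0_sub _ (T_add _ (ltW s0) t0)) [s + t]addrC T_add// ltW.
by rewrite !addr0 -[X in N X]subr0 (seminorm_eq0_sub 0 E) subr0.
Qed.

(* A telescoping sum over [n] steps of length [t / n]. *)
Lemma semigroup_decreasing_on_domain (F : V -> R) (C : R) : 0 <= C ->
  (forall x y, F x - F y <= C * N (x - y)) ->
  (forall w y s x, generator_at w y -> 0 <= s ->
     F w - F x <= C * N (w - x - s *: y)) ->
  forall t w y, 0 <= t -> generator_at w y -> F (T t w) <= F w.
Proof.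
move=> C0 F_lip HF t w y; rewrite le_eqVlt => /predU1P[<-|t0] wy.
  rewrite -subr_le0 (le_trans (F_lip _ _))//.
  suff -> : N (T 0 w - w) = 0 by rewrite mulr0.
  apply/le_anti; rewrite N_ge0 andbT; apply/ler_addgt0Pr => c c0.
  by have [dc dc0 Hdc] := T_cont w c0; rewrite add0r; apply: Hdc; rewrite lexx.
rewrite -subr_le0; apply/ler_addgt0Pr => e0 e00; rewrite add0r.
(* The [n + 1] steps of length [s] cost [C * s * (2 * e)] each, in total
   [C * (2 * t * e) = e0 * C / (C + 1)]. *)
pose e := e0 / (2 * t * (C + 1)).
have e_gt0 : 0 < e by rewrite divr_gt0// !mulr_gt0// ltr_wpDl.
have [d d0 Hd] := wy e e_gt0; have [d2 d20 Hd2] := T_cont y e_gt0.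
pose n := Num.truncn (t / Num.min d d2); pose s := t / n.+1%:R.
have s0 : 0 < s by rewrite divr_gt0.
have [sd sd2] : s < d /\ s < d2.
  have : s < Num.min d d2.
    have m0 : 0 < Num.min d d2 by rewrite lt_min d0.
    rewrite /s ltr_pdivrMr// mulrC -ltr_pdivrMr//.
    by have := truncnS_gt (t / Num.min d d2).
  by rewrite lt_min => /andP[].
have T0 : N (T 0 w - w) = 0.
  apply/le_anti; rewrite N_ge0 andbT; apply/ler_addgt0Pr => c c0.
  by have [dc dc0 Hdc] := T_cont w c0; rewrite add0r; apply: Hdc; rewrite lexx.
have step k : F (T (s * k.+1%:R) w) - F (T (s * k%:R) w) <= C * (s * (2 * e)).
  have sk j : 0 <= s * j%:R by rewrite mulr_ge0// ltW.
  (* As in the implicit Euler scheme, [HF] is applied at the end of the step. Up to a contraction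
     the error is [T s w - w - s *: T s y]: one [s * e] comes from the derivative at [w], the other
     from the continuity of the orbit of [y]. *)
  apply: le_trans (HF _ _ s _ (generator_semigroup (sk _) wy) (ltW s0)) _.
  rewrite ler_wpM2l//.
  have -> : T (s * k.+1%:R) w - T (s * k%:R) w - s *: T (s * k.+1%:R) y =
     (T (s * k%:R) (T s w - w - s *: T s y)) +
     ((T (s * k.+1%:R) w - T (s * k%:R) (T s w)) -
      s *: (T (s * k.+1%:R) y - T (s * k%:R) (T s y)) -
      (T (s * k%:R) (T s w - w - s *: T s y) - (T (s * k%:R) (T s w - w) - T (s * k%:R) (s *: T s y))) -
      (T (s * k%:R) (T s w - w) - (T (s * k%:R) (T s w) - T (s * k%:R) w)) +
      (T (s * k%:R) (s *: T s y) - s *: T (s * k%:R) (T s y))) by zmod.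
  have z x1 x2 : N x2 = 0 -> N (x1 + x2) <= N x1.
    by move=> x20; rewrite (le_trans (N_D _ _))// x20 addr0.
  have z' x1 x2 : N x2 = 0 -> N (x1 - x2) <= N x1.
    by rewrite -(seminormN x2); exact: z.
  have T_addk x : N (T (s * k.+1%:R) x - T (s * k%:R) (T s x)) = 0.
    by rewrite -natr1 mulrDr mulr1 T_add// ltW.
  apply: le_trans (z _ _ _) _.
    apply/le_anti; rewrite N_ge0 andbT.
    apply: le_trans (z _ _ (semigroup_scale _ _ (sk _))) _.
    apply: le_trans (z' _ _ (semigroup_opp _ _ (sk _))) _.
    apply: le_trans (z' _ _ (semigroup_opp _ _ (sk _))) _.
    by rewrite (le_trans (z' _ _ _)) ?T_addk ?seminorm_scaler.
  apply: le_trans (semigroup_contr0 _ (sk _)) _.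
  have -> : T s w - w - s *: T s y = (T s w - w - s *: y) - s *: (T s y - y) by zmod.
  rewrite (le_trans (N_D _ _))// seminormN N_Z gtr0_norm// mulrDl mul1r mulrDr.
  by rewrite lerD ?Hd ?s0// ler_wpM2l ?(ltW s0)// Hd2// ltW.
have sum k : F (T (s * k%:R) w) - F w <= k%:R * (C * (s * (2 * e))).
  elim: k => [|k IH].
    by rewrite mulr0 mul0r (le_trans (F_lip _ _))// T0 mulr0.
  rewrite -[in leRHS]natr1 mulrDl mul1r; apply: le_trans (lerD IH (step k)).
  by lra.
have := sum n.+1; rewrite {1}/s divfK ?pnatr_eq0// => /le_trans; apply.
have -> : n.+1%:R * (C * (s * (2 * e))) = C * (e * (2 * t)).
  by rewrite -[in RHS](divfK (_ : n.+1%:R != 0 :> R) t) ?pnatr_eq0// -/s; ring.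
have -> : e * (2 * t) = e0 / (C + 1).
  have C1 : 0 < C + 1 by rewrite ltr_wpDl.
  by rewrite /e; field; rewrite gt_eqF// gt_eqF.
by rewrite mulrCA ger_pMr// ler_pdivrMr ?mul1r ?lerDl// ltr_wpDl.
Qed.

(** The last hypothesis is the dissipativity of the generator with respect to [F]: for
    [x = w - s *: y] it says that the resolvent does not increase [F]. Its error term admits points
    of an orbit, which satisfy this equation only approximately. Density of the domain and the
    Lipschitz bound extend the conclusion to all [x]. *)
Theorem semigroup_decreasing (F : V -> R) (C : R) : 0 <= C ->
  (forall x y, F x - F y <= C * N (x - y)) ->
  (forall w y s x, generator_at w y -> 0 <= s ->
     F w - F x <= C * N (w - x - s *: y)) ->
  forall t x, 0 <= t -> F (T t x) <= F x.
Proof.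
move=> C0 F_lip HF t x t0; apply/ler_addgt0Pr => e e0.
have e'0 : 0 < e / (2 * (C + 1)) by rewrite divr_gt0// mulr_gt0// ltr_wpDl.
have [w [y [wx wy]]] := generator_dense x e'0.
have H1 := semigroup_decreasing_on_domain C0 F_lip HF t0 wy.
have H2 := F_lip (T t x) (T t w); have H3 := F_lip w x.
have H4 := T_contr x w t0; rewrite (seminorm_distC x w) in H4.
have Ce : C * (e / (2 * (C + 1))) <= e / 2.
  have C1 : 0 < C + 1 by rewrite ltr_wpDl.
  have -> : C * (e / (2 * (C + 1))) = e / 2 * (C / (C + 1)) by field; rewrite gt_eqF.
  by rewrite ler_piMr ?divr_ge0 ?(ltW e0)// ler_pdivrMr// mul1r lerDl.
have H5 : C * N (T t x - T t w) <= e / 2.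
  by apply: le_trans Ce; rewrite ler_wpM2l// (le_trans H4).
have H6 : C * N (w - x) <= e / 2 by apply: le_trans Ce; rewrite ler_wpM2l.
lra.
Qed.
End seminormed_semigroup.

(** * Finiteness of the weighted Gaussian measure *)

Section hahn_banach.
Context {R : realType} (V : lmodType R).
Implicit Types p q : V -> R.

Definition sublinear p :=
  (forall x y, p (x + y) <= p x + p y) /\
  (forall (a : R) x, 0 < a -> p (a *: x) = a * p x).

Lemma sublinear0 p : sublinear p -> p 0 = 0.
Proof.
move=> [_ pZ]; have := pZ 2 0 (ltr0n R 2); rewrite scaler0 => /esym/eqP.
by rewrite mulrDl mul1r -subr_eq0 addrK => /eqP.
Qed.

(** [S x] collects candidate values at [x]. The lemma serves for infima of chains, for the
    perturbation that tests minimality and for the sublinear hull of a convex function. *)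
Lemma sublinear_inf (S : V -> set R) :
  (forall x, has_inf (S x)) ->
  (forall x y a b, S x a -> S y b -> exists2 c, S (x + y) c & c <= a + b) ->
  (forall (c : R) x a, 0 < c -> S x a -> S (c *: x) (c * a)) ->
  sublinear (fun x => inf (S x)).
Proof.
move=> S_inf S_D S_Z; split=> [x y|a x a0].
  rewrite -lerBlDr; apply: lb_le_inf => [|b Sb]; first by case: (S_inf x).
  rewrite lerBlDr -lerBlDl; apply: lb_le_inf => [|c Sc]; first by case: (S_inf y).
  rewrite lerBlDl; have [d Sd db] := S_D _ _ _ _ Sb Sc.
  by apply: le_trans db; apply: ge_inf => //; case: (S_inf (x + y)).
have Z (c : R) z : 0 < c -> inf (S (c *: z)) <= c * inf (S z).
  move=> c0; rewrite -ler_pdivrMl//; apply: lb_le_inf; first by case: (S_inf z).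
  move=> b Sb; rewrite ler_pdivrMl//; apply: ge_inf; last exact: S_Z.
  by case: (S_inf (c *: z)).
apply/le_anti; rewrite Z//= -ler_pdivlMl//.
by have := Z a^-1 (a *: x); rewrite scalerA mulVf ?gt_eqF// scale1r invr_gt0; exact.
Qed.

(** Zorn's lemma for the reversed pointwise order. Every sublinear [q <= p] satisfies
    [q x >= - q (- x) >= - p (- x)], which keeps the infimum of a chain finite. *)
Lemma sublinear_minimal p : sublinear p ->
  exists q, [/\ sublinear q, forall x, q x <= p x &
    forall r, sublinear r -> (forall x, r x <= q x) -> r = q].
Proof.
move=> sp; pose T := {q | sublinear q /\ forall x, q x <= p x}.
have lbN (q : T) x : - p (- x) <= sval q x.
  case: q => q [sq qp] /=; rewrite lerNl; apply: le_trans (qp (- x)).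
  by rewrite -subr_ge0 opprK addrC -(sublinear0 sq) -(subrr x); exact: sq.1.
pose le_T : rel T := fun q r : T => `[< forall x, sval r x <= sval q x >].
have [q||||q qmin] := @Zorn T le_T.
- by apply/asboolP.
- move=> r s t /asboolP rs /asboolP st; apply/asboolP => x.
  exact: le_trans (st x) (rs x).
- move=> s t /asboolP st /asboolP ts.
  have st' : sval s = sval t by apply/funext => x; apply/le_anti; rewrite st ts.
  by move: s t st' {st ts} => [s sP] [t tP] /= st; subst t; congr exist; exact: Prop_irrelevance.
- move=> A A_total; have [[a Aa]|A0] := pselect (exists a, A a); last first.
    (* The empty chain is bounded by [p] itself. *)
    exists (exist _ p (conj sp (fun x => lexx (p x)))) => s As.
    by exfalso; apply: A0; exists s.
  pose S x := [set sval b x | b in A].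
  have S_inf x : has_inf (S x).
    split; first by exists (sval a x), a.
    by exists (- p (- x)) => _ [b _ <-]; exact: lbN.
  have sS : sublinear (fun x => inf (S x)).
    apply: sublinear_inf => [//|x y _ _ [b Ab <-] [c Ac <-]|c x _ c0 [b Ab <-]].
      have [/asboolP bc|/asboolP cb] := A_total _ _ Ab Ac.
        exists (sval c (x + y)); first by exists c.
        by case: (svalP c) => -[cD _] _; rewrite (le_trans (cD _ _))// lerD.
      exists (sval b (x + y)); first by exists b.
      by case: (svalP b) => -[bD _] _; rewrite (le_trans (bD _ _))// lerD.
    by exists b => //; case: (svalP b) => -[_ bZ] _; rewrite bZ.
  have Sp x : inf (S x) <= p x.
    apply: (@le_trans _ _ (sval a x)); last by case: (svalP a).
    by apply: ge_inf; [case: (S_inf x)|exists a].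
  exists (exist _ (fun x => inf (S x)) (conj sS Sp)) => s As; apply/asboolP => x /=.
  by apply: ge_inf; [case: (S_inf x)|exists s].
exists (sval q); split; [by case: (svalP q)|by case: (svalP q)|].
move=> r sr rq.
have rp x : r x <= p x by rewrite (le_trans (rq x))//; case: (svalP q).
have := qmin (exist _ r (conj sr rp)).
by move=> <-//; apply/asboolP.
Qed.

(* Minimality against [x |-> inf_(t >= 0) (q (x + t y) - t q y)] makes [q]
   additive. *)
Lemma sublinear_minimal_linear q : sublinear q ->
  (forall r, sublinear r -> (forall x, r x <= q x) -> r = q) ->
  forall (a : R) x y, q (a *: x + y) = a * q x + q y.
Proof.
move=> sq qmin; have [qD qZ] := sq; have q0 := sublinear0 sq.
have qZ0 (t : R) x : 0 <= t -> q (t *: x) = t * q x.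
  by rewrite le_eqVlt => /predU1P[<-|/qZ//]; rewrite scale0r mul0r.
have qA x y : q x + q y <= q (x + y).
  pose S x := [set q (x + t *: y) - t * q y | t in [set t : R | 0 <= t]].
  have S_inf z : has_inf (S z).
    split; first by exists (q (z + 0 *: y) - 0 * q y), 0 => //=.
    exists (- q (- z)) => _ [t /= t0 <-].
    rewrite lerNl opprB lerBlDr -qZ0// -{1}(addKr z (t *: y)); exact: qD.
  have sS : sublinear (fun z => inf (S z)).
    apply: sublinear_inf => [//|x1 x2 _ _ [t /= t0 <-] [s /= s0 <-]|c x1 _ c0 [t /= t0 <-]].
      exists (q (x1 + x2 + (t + s) *: y) - (t + s) * q y).
        by exists (t + s) => //=; rewrite addr_ge0.
      rewrite scalerDl addrACA mulrDl opprD [leRHS]addrACA lerD2r; exact: qD.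
    exists (c * t); first by rewrite /= mulr_ge0// ltW.
    by rewrite mulrBr -(qZ c)// scalerDr scalerA mulrA.
  have Sq z : inf (S z) <= q z.
    apply: ge_inf; first by case: (S_inf z).
    by exists 0 => //=; rewrite scale0r addr0 mul0r subr0.
  have := congr1 (fun r => r x) (qmin _ sS Sq) => /= <-.
  rewrite -lerBrDr; apply: ge_inf; first by case: (S_inf x).
  by exists 1; rewrite /= ?ler01// scale1r mul1r.
have qE x y : q (x + y) = q x + q y by apply/le_anti; rewrite qD qA.
have qN x : q (- x) = - q x.
  by apply/eqP; rewrite -subr_eq0 opprK -qE addNr q0.
move=> a x y; rewrite qE; congr (_ + _).
have [a0|a0] := leP 0 a; first exact: qZ0.
by rewrite -[a]opprK scaleNr qN qZ0 ?mulNr// oppr_ge0 ltW.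
Qed.

Theorem hahn_banach p : sublinear p ->
  exists2 f : V -> R, (forall (a : R) x y, f (a *: x + y) = a * f x + f y) &
    forall x, f x <= p x.
Proof.
move=> /sublinear_minimal[q [sq qp qmin]]; exists q => //.
exact: sublinear_minimal_linear.
Qed.

End hahn_banach.

(** * Affine minorants of lower semicontinuous convex functions *)

Section affine_minorant.
Context {R : realType} (X : normedModType R) (U : X -> \bar R).
Context (U_proper : proper_fun U) (U_lsc : lower_semicontinuous U).
Context (U_convex : econvex U).

(** Lower semicontinuity gives [U > U x0 - 1] on a ball around [x0]. For [y] outside, the point of
    the segment from [x0] to [y] at distance [r'] lies in that ball, and convexity carries the bound
    to [y] with slope [- 1 / r']. *)
Lemma lsc_convex_cone_minorant : exists x0 (u0 a K : R),
  [/\ U x0 = u0%:E, 0 <= K & forall y, ((a - K * `|y - x0|)%:E <= U y)%E].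
Proof.
have [UNy [x0 Ux0]] := U_proper.
have Ux0fin : U x0 \is a fin_num by rewrite fin_numE UNy.
pose u0 := fine (U x0); have Eu0 : U x0 = u0%:E by rewrite fineK.
have u1 : ((u0 - 1)%:E < U x0)%E by rewrite Eu0 lte_fin ltrBlDr ltrDl.
have [W /nbhs_ballP[r /= r0 rW] HW] := U_lsc u1.
pose r' := r / 2; have r'0 : 0 < r' by rewrite divr_gt0.
have r'r : r' < r by rewrite ltr_pdivrMr// mulr_natr mulr2n ltrDl.
exists x0, u0, (u0 - 1), r'^-1; split => //; first by rewrite invr_ge0 ltW.
move=> y; case EUy : (U y) => [uy| |]; last 2 first.
  by rewrite leey.
  by move: (UNy y); rewrite EUy.
have [yr|yr] := leP `|y - x0| r'.
  have /HW : W y.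
    by apply: rW; rewrite -ball_normE /ball_ /= distrC (le_lt_trans yr).
  rewrite EUy !lte_fin lee_fin => /ltW; apply: le_trans.
  by rewrite gerBl mulr_ge0// invr_ge0 ltW.
have yx0 : 0 < `|y - x0| by rewrite (lt_trans r'0).
pose t := r' / `|y - x0|.
have t0 : 0 < t by rewrite divr_gt0.
have t1 : t <= 1 by rewrite ler_pdivrMr// mul1r ltW.
have /HW : W (t *: y + (1 - t) *: x0).
  apply: rW; rewrite -ball_normE /ball_ /= distrC scalerBl scale1r addrA addrAC addrK.
  by rewrite -scalerBr normrZ gtr0_norm// divfK// gt_eqF.
have : (0 <= t <= 1) by rewrite t1 ltW.
move=> /(U_convex y x0) /(lt_le_trans _) /[apply].
rewrite EUy Eu0 -!EFinM -EFinD lte_fin lee_fin => H.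
have -> : r'^-1 * `|y - x0| = t^-1 by rewrite [in RHS]/t [RHS]invf_div mulrC.
have : - 1 < t * (uy - u0) by lra.
rewrite -ltr_pdivrMl// mulrN1 => H'; lra.
Qed.

(* The linear functional is dominated by the sublinear hull of the
   inf-convolution of [U] and [K |.|]. *)
Theorem lsc_convex_affine_minorant :
  exists (f : dual X) (c : R), forall x, ((f x - c)%:E <= U x)%E.
Proof.
have [UNy _] := U_proper.
have [x0 [u0 [a [K [Ux0 K0 Ua]]]]] := lsc_convex_cone_minorant.
(* The factor [t] makes the infimum positively homogeneous. [t = 0] gives the bound [K * |z|], hence
   continuity of the functional; [t = 1] with [z = y - x0] gives the bound by [U y - a]. The cone
   minorant, with the same [a] and [K], keeps the infimum finite. *)
pose S z := [set b : R | exists t y uy, [/\ 0 <= t, U y = uy%:E &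
  b = t * (uy - a) + K * `|z - t *: (y - x0)|]].
have S_lb z b : S z b -> - (K * `|z|) <= b.
  move=> [t [y [uy [t0 Uy ->]]]].
  have := Ua y; rewrite Uy lee_fin => Hy.
  have H1 : t * (- (K * `|y - x0|)) <= t * (uy - a) by rewrite ler_wpM2l//; lra.
  have : K * (t * `|y - x0|) <= K * (`|z| + `|z - t *: (y - x0)|).
    rewrite ler_wpM2l// -(ger0_norm t0) -normrZ ger0_norm//.
    by rewrite -[X in `|X| <= _](subKr z) (le_trans (ler_normB _ _)).
  rewrite mulrDr; lra.
have S_inf z : has_inf (S z).
  split; last by exists (- (K * `|z|)) => b /S_lb.
  by eexists; exists 0, x0, u0; split; [|exact: Ux0|].
have sS : sublinear (fun z => inf (S z)).
  apply: sublinear_inf => // [z1 z2 a1 a2|c z b c0].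
    move=> [t1 [y1 [w1 [t10 E1 ->]]]] [t2 [y2 [w2 [t20 E2 ->]]]].
    have [t0|t0] := eqVneq (t1 + t2) 0.
      have [t10' t20'] : t1 = 0 /\ t2 = 0 by split; lra.
      exists (K * `|z1 + z2|).
        by exists 0, x0, u0; split => //; rewrite mul0r scale0r add0r subr0.
      rewrite t10' t20' !mul0r !scale0r !add0r !subr0 -mulrDr ler_wpM2l//.
      exact: ler_normD.
    have tp : 0 < t1 + t2 by rewrite lt_neqAle eq_sym t0 addr_ge0.
    pose l := t1 / (t1 + t2).
    have l01 : 0 <= l <= 1.
      by rewrite divr_ge0 ?(ltW tp)//= ler_pdivrMr// mul1r lerDl.
    pose y := l *: y1 + (1 - l) *: y2.
    have := U_convex y1 y2 l01; rewrite -/y E1 E2 -!EFinM -EFinD.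
    case EU : (U y) => [w| |]; last 2 first.
      by rewrite leye_eq.
      by move: (UNy y); rewrite EU.
    rewrite lee_fin => Hw.
    exists ((t1 + t2) * (w - a) + K * `|z1 + z2 - (t1 + t2) *: (y - x0)|).
      by exists (t1 + t2), y, w; split; rewrite ?ltW.
    have lt1 : (t1 + t2) * l = t1 by rewrite mulrC divfK.
    have lt2 : (t1 + t2) * (1 - l) = t2 by rewrite mulrBr lt1 mulr1; lra.
    rewrite [leRHS]addrACA; apply: lerD.
      have : (t1 + t2) * w <= t1 * w1 + t2 * w2.
        have /le_trans := ler_wpM2l (ltW tp) Hw; apply.
        by rewrite mulrDr mulrA lt1 mulrA lt2.
      lra.
    rewrite -mulrDr ler_wpM2l//.
    have -> : (t1 + t2) *: (y - x0) = t1 *: (y1 - x0) + t2 *: (y2 - x0).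
      rewrite !scalerBr /y scalerDr !scalerA lt1 lt2 scalerDl; zmod.
    rewrite opprD addrACA; exact: ler_normD.
  move=> [t [y [w [t0 E ->]]]]; exists (c * t), y, w; split => //.
    by rewrite mulr_ge0// ltW.
  rewrite mulrDr; congr (_ + _); first by rewrite mulrA.
  by rewrite -scalerA -scalerBr normrZ gtr0_norm// mulrCA.
have [f f_lin fS] := hahn_banach sS.
have fK z : f z <= K * `|z|.
  apply: le_trans (fS z) _; apply: ge_inf; first by case: (S_inf z).
  by exists 0, x0, u0; split; rewrite // mul0r scale0r add0r subr0.
have fN z : f (- z) = - f z.
  have f0 : f 0 = 0.
    by have /eqP := f_lin 1 0 0; rewrite scale1r addr0 mul1r -subr_eq0 opprD addNKr oppr_eq0 => /eqP.
  by have := f_lin (-1) z 0; rewrite addr0 scaleN1r f0 addr0 mulN1r.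
have f_bop : (f : X -> R^o) \in @is_bop R X R^o.
  rewrite inE; split; first by move=> c x y; exact: f_lin.
  have fL : linear (f : X -> R^o) by move=> c x y; exact: f_lin.
  pose fl : {linear X -> R^o} := HB.pack (f : X -> R^o) (GRing.isLinear.Build _ _ _ _ _ fL).
  apply: (@bounded_linear_continuous _ _ _ fl); apply/linear_boundedP.
  exists K; split; first exact: num_real.
  move=> M KM x; have : `|f x| <= K * `|x|.
    by rewrite ler_norml fK lerNl -fN -(normrN x) fK.
  by move=> /le_trans; apply; rewrite ler_wpM2r// ltW.
exists (Bop f_bop), (f x0 - a) => x /=.
case EU : (U x) => [w| |]; last 2 first.
- by rewrite leey.
- by move: (UNy x); rewrite EU.
have : f (x - x0) <= w - a.
  apply: le_trans (fS _) _; apply: ge_inf; first by case: (S_inf (x - x0)).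
  by exists 1, x, w; split; rewrite // scale1r subrr normr0 mulr0 addr0 mul1r.
have -> : f (x - x0) = f x - f x0.
  by have := f_lin 1 x (- x0); rewrite scale1r mul1r fN.
by rewrite lee_fin; lra.
Qed.
End affine_minorant.

Section density.
Context {R : realType} d (T : measurableType d).
Context (mu nu : {measure set T -> \bar R}) (h : T -> R).
Context (h0 : forall x, 0 <= h x) (mh : measurable_fun setT h).
Context (nuE : forall A, measurable A -> nu A = (\int[mu]_(x in A) (h x)%:E)%E).
Local Open Scope ereal_scope.
Import HBNNSimple.

Lemma ge0_integral_density (f : T -> \bar R) : measurable_fun setT f ->
  (forall x, 0 <= f x) -> \int[nu]_x f x = \int[mu]_x (f x * (h x)%:E).
Proof.
move=> mf f0; pose f_ := nnsfun_approx measurableT mf.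
have cvgf x : EFin \o f_^~x @ \oo --> f x.
  by apply: cvg_nnsfun_approx => // y _; exact: f0.
transitivity (limn (fun n => \int[nu]_x (f_ n x)%:E)).
  rewrite -monotone_convergence//.
  - by apply: eq_integral => x _; apply/esym/cvg_lim => //; exact: cvgf.
  - by move=> n; exact/measurable_EFinP/measurable_funP.
  - by move=> n y _; rewrite lee_fin.
  - by move=> y _ m n mn; rewrite lee_fin; exact/lefP/nd_nnsfun_approx.
rewrite (_ : (fun n => _) = (fun n => \int[mu]_x ((f_ n x)%:E * (h x)%:E))).
  rewrite -monotone_convergence//.
  - apply: eq_integral => x _; apply/cvg_lim => //.
    by apply: cvgeZr => //; exact: cvgf.
  - by move=> n; apply: emeasurable_funM; exact/measurable_EFinP.
  - by move=> n y _; rewrite mule_ge0// lee_fin.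
  - by move=> y _ m n mn; apply: lee_wpmul2r; rewrite lee_fin//; exact/lefP/nd_nnsfun_approx.
apply/funext => n.
rewrite integralT_nnsfun sintegralE.
transitivity (\sum_(k \in range (f_ n))
    \int[mu]_x ((k * \1_(f_ n @^-1` [set k]) x)%:E * (h x)%:E)).
  apply: eq_fsbigr => r /[!inE] -[y _ <-].
  under eq_integral do rewrite EFinM -muleA.
  rewrite ge0_integralZl//=; last 3 first.
  - by apply: emeasurable_funM; apply/measurable_EFinP.
  - by move=> x _; rewrite mule_ge0// lee_fin.
  - by rewrite lee_fin.
  rewrite nuE//; congr (_ * _); rewrite integral_mkcond; apply: eq_integral => x _.
  by rewrite patchE indicE; case: ifPn; rewrite ?mul1e ?mul0e.
rewrite -ge0_integral_fsum//.
- apply: eq_integral => x _; rewrite [in RHS](fimfunE (f_ n)) -fsumEFin//.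
  by rewrite ge0_mule_fsuml// => k; rewrite nnfun_muleindic_ge0.
- by move=> r; apply: emeasurable_funM; apply/measurable_EFinP => //; exact: measurable_funM.
- move=> r x _; apply: mule_ge0; last by rewrite lee_fin.
  by rewrite EFinM nnfun_muleindic_ge0.
Qed.
End density.

(** * Exponential moments of Gaussian measures *)

Section gaussian_exponential_moment.
Context {R : realType} (X : completeNormedModType R) (mu : probability (borel X) R).

(** Completing the square: [expR (- y)] times the density of mean 0 is [expR (s^2 / 2)] times the
    density of mean [- s^2]. *)
Lemma normal_prob_expR (s : R) : s != 0 ->
  (\int[normal_prob 0 s]_y (expR (- y))%:E < +oo)%E.
Proof.
move=> s0.
rewrite (@ge0_integral_density _ _ _ lebesgue_measure _ (normal_pdf 0 s))//; last 3 first.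
- by move=> y; exact: normal_pdf_ge0.
- exact: measurable_normal_pdf.
- by apply/measurable_EFinP; apply: measurableT_comp.
under eq_integral => y _.
  rewrite -EFinM normal_pdfE// mulrCA /normal_fun -expRD.
  rewrite (_ : - y + - (y - 0) ^+ 2 / (s ^+ 2 *+ 2) =
    s ^+ 2 / 2 + - (y - - s ^+ 2) ^+ 2 / (s ^+ 2 *+ 2)); last first.
    by rewrite subr0; field.
  rewrite expRD mulrCA -/(normal_fun (- s ^+ 2) s y).
  rewrite (_ : normal_peak s * normal_fun (- s ^+ 2) s y = normal_pdf (- s ^+ 2) s y).
    over.
  by rewrite normal_pdfE.
under eq_integral do rewrite EFinM.
rewrite ge0_integralZl//=.
- by rewrite integral_normal_pdf mule1 ltry.
- by apply/measurable_EFinP; exact: measurable_normal_pdf.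
- by move=> y _; rewrite lee_fin normal_pdf_ge0.
Qed.

Lemma open_measurable_borel (A : set X) : open A -> measurable (A : set (borel X)).
Proof. exact: sub_sigma_algebra. Qed.

Lemma continuous_measurable_borel (f : X -> R) : continuous f ->
  measurable_fun setT (f : borel X -> R).
Proof.
move=> cf; apply: (measurability _ (RGenOpens.measurableE R)).
move=> _ [_ [a [b ->] <-]]; rewrite setTI.
by apply: open_measurable_borel; exact: open_comp.
Qed.

Lemma lsc_measurable_borel (f : X -> \bar R) : lower_semicontinuous f ->
  measurable_fun setT (f : borel X -> \bar R).
Proof.
move=> scif; apply: (measurability _ (ErealGenOInfty.measurableE R)).
move=> /= _ [_ [a ->]] <-; rewrite setTI; apply: open_measurable_borel.
by rewrite preimage_itvoy; move/lower_semicontinuousP : scif; exact.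
Qed.

(** [- expeR (- f)] is an increasing function of [f], so its superlevel sets are superlevel sets of
    [f] or empty, and it is again lower semicontinuous. *)
Lemma lsc_measurable_expeRN (f : X -> \bar R) : lower_semicontinuous f ->
  measurable_fun setT (fun x : borel X => expeR (- f x)%E).
Proof.
move=> /lower_semicontinuousP f_lsc.
have -> : (fun x => expeR (- f x)%E) = (fun x => - - expeR (- f x))%E.
  by apply/funext => x; rewrite oppeK.
apply: measurableT_comp => //; apply: lsc_measurable_borel.
apply/lower_semicontinuousP => a.
have [a0|a0] := ltP a 0; last first.
  rewrite [X in open X](_ : _ = set0); first exact: open0.
  rewrite -subset0 => x /=; apply/negP; rewrite -leNgt.
  by rewrite leeNl -EFinN (le_trans _ (expeR_ge0 _))// lee_fin oppr_le0.
rewrite [X in open X](_ : _ = [set x | (- ln (- a))%:E < f x]%E); first exact: f_lsc.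
apply/funext => x /=; congr is_true.
rewrite [in RHS]EFinN [in RHS]lteNl -[in RHS]lte_expeR /=.
by rewrite lnK ?posrE ?oppr_gt0// lteNr -EFinN.
Qed.

Lemma gaussian_expR (f : dual X) : centred_gaussian mu ->
  (\int[mu]_x (expR (- f x))%:E < +oo)%E.
Proof.
move=> /(_ f)[s s0 H].
have mf : measurable_fun setT (f : borel X -> measurableTypeR R).
  exact: continuous_measurable_borel (@bop_continuous _ _ _ f).
have -> : (\int[mu]_x (expR (- f x))%:E =
    \int[pushforward mu (f : borel X -> measurableTypeR R)]_y (expR (- y))%:E)%E.
  rewrite ge0_integral_pushforward//.
  by apply/measurable_EFinP; apply: measurableT_comp.
have [s00|sN0] := eqVneq s 0.
  have -> : (\int[pushforward mu (f : borel X -> measurableTypeR R)]_y (expR (- y))%:E =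
      \int[\d_(0%R : measurableTypeR R)]_y (expR (- y))%:E)%E.
    by apply: eq_measure_integral => A mA _; have := H A mA; rewrite s00 eqxx; exact.
  rewrite integral_dirac// ?diracT ?mul1e ?ltry//.
  by apply/measurable_EFinP; apply: measurableT_comp.
have -> : (\int[pushforward mu (f : borel X -> measurableTypeR R)]_y (expR (- y))%:E =
    \int[normal_prob 0 s]_y (expR (- y))%:E)%E.
  by apply: eq_measure_integral => A mA _; have := H A mA; rewrite (negbTE sN0); exact.
exact: normal_prob_expR.
Qed.

Lemma gaussian_convex_finite (U : X -> \bar R) (nu : {measure set (borel X) -> \bar R}) :
  centred_gaussian mu ->
  proper_fun U -> lower_semicontinuous U -> econvex U ->
  (forall E : set (borel X), measurable E ->
     nu E = (\int[mu]_(x in E) expeR (- U x))%E) ->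
  (nu [set: borel X] < +oo)%E.
Proof.
move=> mu_gauss U_proper U_lsc U_convex nuE.
have [f [c Uf]] := lsc_convex_affine_minorant U_proper U_lsc U_convex.
rewrite nuE//.
apply: (@le_lt_trans _ _ (\int[mu]_x ((expR c)%:E * (expR (- f x))%:E))%E).
  apply: ge0_le_integral => //.
  - by move=> x _; exact: expeR_ge0.
  - exact: lsc_measurable_expeRN.
  - apply/measurable_EFinP/measurable_funM => //; apply: measurableT_comp => //.
    apply: measurableT_comp => //.
    exact: continuous_measurable_borel (@bop_continuous _ _ _ f).
  - move=> x _; rewrite -EFinM -expRD -[leRHS]/(expeR (c - f x)%:E) lee_expeR.
    by rewrite leeNl -EFinN opprB.
rewrite ge0_integralZl//.
- by rewrite lte_mul_pinfty ?lee_fin ?expR_ge0//; exact: gaussian_expR.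
- apply/measurable_EFinP; apply: measurableT_comp => //.
  apply: measurableT_comp => //.
  exact: continuous_measurable_borel (@bop_continuous _ _ _ f).
Qed.
End gaussian_exponential_moment.

(** * Dissipativity of the operator B *)

Section complete_hilbert.
Context {R : realType}.

Lemma cauchy_norm_cvg (V : completeNormedModType R) (u : nat -> V) :
  (forall e : R, 0 < e -> exists n0, forall m n, (n0 <= m)%N -> (n0 <= n)%N ->
    `|u m - u n| <= e) ->
  exists l : V, forall e : R, 0 < e -> exists n0, forall n, (n0 <= n)%N ->
    `|u n - l| <= e.
Proof.
move=> u_cau; have /cvg_ex[l /= ul] : cvg (u @ \oo).
  apply/cauchy_cvgP/cauchy_ballP => e e0.
  have e20 : 0 < e / 2 by rewrite divr_gt0.
  have [n0 Hn0] := u_cau _ e20.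
  exists (u @` [set n | (n0 <= n)%N], u @` [set n | (n0 <= n)%N]).
    by split; exists n0 => // n /= n0n; exists n.
  move=> [_ _] /= [[m n0m <-] [n n0n <-]]; rewrite -ball_normE /ball_ /=.
  by rewrite (le_lt_trans (Hn0 _ _ n0m n0n))// ltr_pdivrMr// mulr_natr mulr2n ltrDl.
exists l => e e0; have /cvgrPdist_le /(_ _ e0)[n0 _ H] := ul.
by exists n0 => n n0n; rewrite distrC; exact: H.
Qed.

Context (H : completeNormedModType R) (ip : H -> H -> R).
Context (ip_hilbert : hilbert_inner_product ip).

Lemma ipC h k : ip h k = ip k h. Proof. exact: ip_sym. Qed.

Lemma ipDl h k l : ip (h + k) l = ip h l + ip k l.
Proof. by rewrite -[h in LHS]scale1r ip_linear// mul1r. Qed.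

Lemma ip0l l : ip 0 l = 0.
Proof. by apply/eqP; rewrite -(subrr (ip 0 l)) -subr_eq0 opprB addrA -ipDl addr0 subrr. Qed.

Lemma ipZl a h l : ip (a *: h) l = a * ip h l.
Proof. by rewrite -[a *: h]addr0 ip_linear// ip0l addr0. Qed.

Lemma ipNl h l : ip (- h) l = - ip h l.
Proof. by rewrite -scaleN1r ipZl mulN1r. Qed.

Lemma ipBl h k l : ip (h - k) l = ip h l - ip k l.
Proof. by rewrite ipDl ipNl. Qed.

Lemma ipDr h k l : ip l (h + k) = ip l h + ip l k.
Proof. by rewrite !(ipC l) ipDl. Qed.

Lemma ipZr a h l : ip l (a *: h) = a * ip l h.
Proof. by rewrite !(ipC l) ipZl. Qed.

Lemma ipNr h l : ip l (- h) = - ip l h.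
Proof. by rewrite !(ipC l) ipNl. Qed.

Lemma ipBr h k l : ip l (h - k) = ip l h - ip l k.
Proof. by rewrite ipDr ipNr. Qed.

Lemma ip_sumr I (r : seq I) (F : I -> H) l :
  ip l (\sum_(i <- r) F i) = \sum_(i <- r) ip l (F i).
Proof.
elim/big_ind2: _ => [|a b c d <- <-|//]; last by rewrite ipDr.
by rewrite ipC ip0l.
Qed.

Lemma sqr_normB h k : `|h - k| ^+ 2 = `|h| ^+ 2 - 2 * ip h k + `|k| ^+ 2.
Proof. by rewrite !(ip_norm ip_hilbert) ipBl !ipBr (ipC k h); ring. Qed.

Lemma sqr_normD h k : `|h + k| ^+ 2 = `|h| ^+ 2 + 2 * ip h k + `|k| ^+ 2.
Proof. by rewrite -[k in LHS]opprK sqr_normB normrN ipNr; ring. Qed.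

Lemma cauchy_schwarz h k : `|ip h k| <= `|h| * `|k|.
Proof.
have [->|k0] := eqVneq k 0; first by rewrite ipC ip0l !normr0 mulr0.
have kp : 0 < `|k| by rewrite normr_gt0.
rewrite -(@ler_pXn2r _ 2)// ?nnegrE ?mulr_ge0// exprMn real_normK ?num_real//.
have : 0 <= `|(`|k| ^+ 2) *: h - ip h k *: k| ^+ 2 by rewrite sqr_ge0.
rewrite sqr_normB !normrZ !exprMn ipZl ipZr (real_normK (num_real (ip h k))).
rewrite ger0_norm ?sqr_ge0// => HH.
have : 0 <= `|k| ^+ 2 * (`|h| ^+ 2 * `|k| ^+ 2 - ip h k ^+ 2) by lra.
by rewrite pmulr_rge0 ?exprn_gt0// subr_ge0.
Qed.

(* The projection theorem: the infimum of the distance to [K] is attained in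
   the closure of [K], and the difference is orthogonal to [K]. *)
Lemma orthogonal_dense (K : set H) : K 0 ->
  (forall (a : R) h k, K h -> K k -> K (a *: h + k)) ->
  (forall h, (forall k, K k -> ip k h = 0) -> h = 0) ->
  forall h (e : R), 0 < e -> exists2 k, K k & `|h - k| <= e.
Proof.
move=> K0 K_lin K_orth h.
pose D := [set `|h - k| ^+ 2 | k in K].
have D_inf : has_inf D.
  split; first by exists (`|h - 0| ^+ 2), 0.
  by exists 0 => _ [k _ <-]; exact: sqr_ge0.
pose d := inf D.
have d_le k : K k -> d <= `|h - k| ^+ 2.
  by move=> Kk; apply: ge_inf; [case: D_inf|exists k].
have /choice[u Hu] n : exists k, K k /\ `|h - k| ^+ 2 < d + n.+1%:R^-1.
  have n0 : 0 < n.+1%:R^-1 :> R by rewrite invr_gt0.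
  have [_ [k Kk <-] kd] := inf_adherent n0 D_inf.
  by exists k.
have u_cau : forall e : R, 0 < e -> exists n0, forall m n, (n0 <= m)%N ->
    (n0 <= n)%N -> `|u m - u n| <= e.
  move=> e e0; have e4 : 0 < e ^+ 2 / 4 by rewrite divr_gt0 ?exprn_gt0.
  have [n0 Hn0] := ltr_add_invr e4; rewrite add0r in Hn0.
  exists n0 => m n n0m n0n.
  rewrite -(@ler_pXn2r _ 2)// ?nnegrE ?(ltW e0)//.
  have [[Km Hm] [Kn Hn]] := (Hu m, Hu n).
  (* The midpoint stays in [K], at squared distance at least [d] from [h]; the parallelogram law
     then bounds [|u m - u n|^2]. *)
  have Kmn : K (2^-1 *: (u m + u n)).
    rewrite -[X in K X]addr0; apply: (K_lin) => //.
    by rewrite -[u m]scale1r; exact: (K_lin).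
  have := d_le _ Kmn.
  have -> : h - 2^-1 *: (u m + u n) = 2^-1 *: ((h - u m) + (h - u n)).
    rewrite addrACA -mulr2n [RHS]scalerDr -[h *+ 2]scaler_nat scalerA mulVf ?pnatr_eq0//.
    by rewrite scale1r -opprD scalerN.
  rewrite normrZ exprMn sqr_normD ger0_norm ?invr_ge0// => Hd.
  have -> : u m - u n = (h - u n) - (h - u m) by zmod.
  rewrite sqr_normB (ipC (h - u n)).
  have inv_le k : (n0 <= k)%N -> k.+1%:R^-1 <= n0.+1%:R^-1 :> R.
    by move=> n0k; rewrite lef_pV2 ?posrE// ler_nat.
  have := inv_le _ n0m; have := inv_le _ n0n; move: Hm Hn Hn0 Hd.
  set x := _ ^+ 2; set y := _ ^+ 2; set z := ip _ _.
  move: (m.+1%:R^-1) (n.+1%:R^-1) (n0.+1%:R^-1) => a b c.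
  rewrite expr2; lra.
have [k uk] := cauchy_norm_cvg u_cau.
have ek_orth w : K w -> ip w (h - k) = 0.
  move=> Kw.
  have uk' : u @ \oo --> k.
    apply/cvgrPdist_le => e /uk[n0 Hn0]; exists n0 => // n n0n.
    by rewrite distrC; exact: Hn0.
  have lim_sqr y : `|h - u n - y| ^+ 2 @[n --> \oo] --> `|h - k - y| ^+ 2.
    apply: (cvg_comp _ (fun r : R => r ^+ 2)); last exact: sqr_continuous.
    apply: cvg_norm; apply: cvgB; last exact: cvg_cst.
    by apply: cvgB => //; exact: cvg_cst.
  have hk_le : `|h - k| ^+ 2 <= d.
    rewrite -[h - k]subr0 -[d]addr0.
    apply: (ler_cvg_to (lim_sqr 0) (cvgD (cvg_cst _) cvg_harmonic)).
    by apply: nearW => n; rewrite subr0 ltW//; case: (Hu n).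
  have hk_ge (t : R) : d <= `|h - k - t *: w| ^+ 2.
    apply: (ler_cvg_to (cvg_cst d) (lim_sqr _)); apply: nearW => n.
    have -> : h - u n - t *: w = h - (t *: w + u n) by zmod.
    by apply: d_le; apply: (K_lin) => //; case: (Hu n).
  set c := ip w (h - k).
  have m1 : 0 < `|w| ^+ 2 + 1 by rewrite ltr_wpDl ?sqr_ge0.
  (* The minimizing multiple of [w] has coefficient [c / |w|^2]; the added 1 avoids division by zero
     and still forces [c = 0]. *)
  have := le_trans hk_le (hk_ge (c / (`|w| ^+ 2 + 1))).
  rewrite [leRHS]sqr_normB ipZr normrZ exprMn (ipC (h - k)) -/c.
  rewrite real_normK ?num_real// => Ht.
  have : c ^+ 2 * (`|w| ^+ 2 + 2) <= 0.
    have -> : c ^+ 2 * (`|w| ^+ 2 + 2) = (2 * (c / (`|w| ^+ 2 + 1) * c) -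
      (c / (`|w| ^+ 2 + 1)) ^+ 2 * `|w| ^+ 2) * (`|w| ^+ 2 + 1) ^+ 2.
      by field; rewrite gt_eqF.
    rewrite pmulr_lle0 ?exprn_gt0//; lra.
  rewrite pmulr_lle0 ?ltr_wpDl ?sqr_ge0// => c0.
  by apply/eqP; rewrite -sqrf_eq0 eq_le c0 sqr_ge0.
have hk : h - k = 0 by apply: K_orth => w /ek_orth.
move=> e e0; have [n0 Hn0] := uk e e0.
exists (u n0); first by case: (Hu n0).
by move/eqP: hk; rewrite subr_eq0 => /eqP ->; rewrite distrC; exact: Hn0.
Qed.

End complete_hilbert.

(** * Functionals applied to Bochner integrals *)

Section bochner_functional.
Context {R : realType} d (T : measurableType d) (V : normedModType R).
Context (mu : {measure set T -> \bar R}) (D : set T) (mD : measurable D).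

(** The integral of a nonnegative function is a supremum over the simple functions below it, hence
    monotone without measurability. This is wanted for [|f t - s n t|] in the Bochner integral,
    which carries no such information. *)
Lemma ge0_le_integral_nomeas (f g : T -> \bar R) : (forall t, D t -> (0 <= f t)%E) ->
  (forall t, D t -> (f t <= g t)%E) ->
  (\int[mu]_(t in D) f t <= \int[mu]_(t in D) g t)%E.
Proof.
move=> f0 fg; rewrite ge0_integralE// ge0_integralE//; last first.
  by move=> t Dt; rewrite (le_trans (f0 _ Dt))// fg.
apply: le_ereal_sup => _ [h /= hf <-]; exists h => //= t.
apply: le_trans (hf t) _; rewrite !patchE; case: ifPn => //.
by rewrite inE; exact: fg.
Qed.

Lemma dual_bounded (x : dual V) : exists2 C : R, 0 < C & forall v, `|x v : R| <= C * `|v|.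
Proof.
have /linear_boundedP := @continuous_linear_bounded _ _ _ 0 x (@bop_continuous _ _ _ x 0).
move=> /pinfty_ex_gt0[C C0 H]; by exists C.
Qed.

Lemma vsimple_functional (s : T -> V) (x : dual V) : vsimple mu D s ->
  mu.-integrable D (EFin \o (x \o s)) /\
  (\int[mu]_(t in D) (x (s t) : R)%:E = (x (vsimple_integral mu D s) : R)%:E)%E.
Proof.
move=> [sfin sm smu].
pose r : seq V := fset_set (range s).
have sE t : (x (s t) : R)%:E = (\sum_(v <- r) (x v : R)%:E * (\1_(s @^-1` [set v]) t)%:E)%E.
  rewrite (bigD1_seq (s t)) ?fset_uniq//=; last first.
    by rewrite in_fset_set// inE; exists t.
  rewrite indicE mem_set// mule1 big1 ?adde0// => v vs.
  by rewrite indicE memNset ?mule0//= => /esym/eqP; rewrite (negbTE vs).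
have int v : mu.-integrable D (fun t => (x v : R)%:E * (\1_(s @^-1` [set v]) t)%:E)%E.
  have [->|v0] := eqVneq v 0.
    rewrite linear0; apply: (eq_integrable mD (cst 0%E)) => [t _|]; first by rewrite mul0e.
    exact: integrable0.
  apply: integrableZl => //; apply/integrableP; split.
    by apply/measurable_EFinP.
  under eq_integral do rewrite gee0_abs ?lee_fin//.
  by rewrite integral_indic// setIC; exact: smu.
split.
  rewrite (_ : EFin \o _ = fun t => \sum_(v <- r) (x v : R)%:E * (\1_(s @^-1` [set v]) t)%:E)%E.
    exact: integrable_sum.
  by apply/funext => t /=; exact: sE.
under eq_integral do rewrite sE.
rewrite integral_sum// /vsimple_integral fsbig_finite// -/r linear_sum -sumEFin.
apply: eq_bigr => v _; rewrite linearZ /=.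
have [->|v0] := eqVneq v 0.
  rewrite linear0 scaler0; under eq_integral do rewrite mul0e.
  exact: integral0.
rewrite integralZl//; last first.
  apply/integrableP; split; first by apply/measurable_EFinP.
  under eq_integral do rewrite gee0_abs ?lee_fin//.
  by rewrite integral_indic// setIC; exact: smu.
rewrite integral_indic// setIC EFinM muleC fineK// ge0_fin_numE//; exact: smu.
Qed.

(** Boundedness of [x] turns the convergence of [s n] into L1 convergence of [x \o s n] to [x \o f],
    while continuity of [x] gives the limit of the integrals of the simple functions. *)
Lemma bochner_functional (f : T -> V) v (x : dual V) :
  measurable_fun D (x \o f : T -> R) ->
  bochner_integral mu D f v ->
  (\int[mu]_(t in D) (x (f t) : R)%:E = (x v : R)%:E)%E.
Proof.
move=> mf [s [ss _ fs vs]].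
have [C C0 xC] := dual_bounded x.
pose a n := (\int[mu]_(t in D) `|f t - s n t|%:E)%E.
pose b n := (\int[mu]_(t in D) `|(x (f t) : R)%:E - (x (s n t) : R)%:E|)%E.
have ba n : (b n <= C%:E * a n)%E.
  have m1 : measurable_fun D (fun t => (x (f t) : R)%:E - (x (s n t) : R)%:E)%E.
    apply: emeasurable_funB; first exact/measurable_EFinP.
    by have [/integrableP[]] := vsimple_functional x (ss n).
  rewrite -lee_pdivrMl// -ge0_integralZl//; last 2 first.
    exact: measurableT_comp.
    by rewrite lee_fin invr_ge0 ltW.
  apply: ge0_le_integral_nomeas => t Dt.
    by rewrite mule_ge0// lee_fin invr_ge0 ltW.
  by rewrite -EFinB abse_EFin -EFinM lee_fin ler_pdivrMl// -raddfB xC.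
have /fine_cvgP[[n0 _ a_fin] a_cvg] := fs.
have b_fin n : (n0 <= n)%N -> (b n < +oo)%E.
  move=> /a_fin an; apply: le_lt_trans (ba n) _.
  by rewrite ltey_eq fin_numM.
have int_f : mu.-integrable D (EFin \o (x \o f)).
  have [int_s _] := vsimple_functional x (ss n0).
  have : mu.-integrable D (fun t => (x (f t) : R)%:E - (x (s n0 t) : R)%:E)%E.
    apply/integrableP; split; last exact/b_fin/leqnn.
    apply: emeasurable_funB; first exact/measurable_EFinP.
    by case/integrableP: int_s.
  move=> /(integrableD mD) /(_ int_s); apply: eq_integrable => // t _ /=.
  by rewrite -EFinB -EFinD subrK.
have int_fin := integrable_fin_num mD int_f.
rewrite -(fineK int_fin); congr EFin; apply/eqP; rewrite -subr_eq0 -normr_le0.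
apply/ler_addgt0Pr => e e0; rewrite add0r.
have eC0 : 0 < e / 2 / C by rewrite !divr_gt0.
have /cvgrPdist_le /(_ _ eC0)[n1 _ Hn1] := a_cvg.
have /cvgrPdist_le /(_ _ eC0)[n2 _ Hn2] := vs.
pose n := maxn n0 (maxn n1 n2).
have n0n : (n0 <= n)%N by rewrite leq_maxl.
have := Hn1 n; rewrite /= sub0r normrN -/(a n) => /(_ _)/le_trans.
have {}Hn1 : fine (a n) <= e / 2 / C.
  apply: le_trans (Hn1 n _); last by rewrite /= !leq_max leqnn orbT.
  by rewrite /= sub0r normrN ler_norm.
have {}Hn2 : `|v - vsimple_integral mu D (s n)| <= e / 2 / C.
  by apply: Hn2; rewrite /= !leq_max leqnn !orbT.
move=> _.
have [int_s sE] := vsimple_functional x (ss n).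
rewrite (splitr e) -(subrK (x (vsimple_integral mu D (s n)) : R) (fine _)) -addrA.
apply: le_trans (ler_normD _ _) _; apply: lerD.
  rewrite -lee_fin -abse_EFin EFinB fineK// -sE -integralB//.
  apply: le_trans (le_abse_integral _ _ _) _ => //.
    by apply: emeasurable_funB; [case/integrableP: int_f|case/integrableP: int_s].
  apply: le_trans (ba n) _.
  by rewrite -(fineK (a_fin n n0n : a n \is a fin_num)) -EFinM lee_fin mulrC -ler_pdivlMr.
rewrite -raddfB; apply: le_trans (xC _) _.
by rewrite mulrC -ler_pdivlMr// distrC.
Qed.
End bochner_functional.

(** * Time means of contraction semigroups *)

Section contraction_semigroup.
Context {R : realType} (X : completeNormedModType R) (S : R -> bop X X).
Context (S_semigroup : C0_contraction_semigroup S).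

Lemma semigroup_norm_contr t x y : 0 <= t -> `|S t x - S t y| <= `|x - y|.
Proof. by move=> t0; rewrite -raddfB (C0_semigroup_contr S_semigroup). Qed.

Lemma semigroup_cont0 x (e : R) : 0 < e ->
  exists2 d, 0 < d & forall t, 0 <= t < d -> `|S t x - x| <= e.
Proof.
move=> e0; have /subspace_continuousP := @C0_semigroup_cont _ _ _ S_semigroup x.
move=> /(_ 0); rewrite /= in_itv/= lexx => /(_ isT).
move=> /cvgrPdist_le /(_ _ e0) /nbhs_ballP[d /= d0 H].
exists d => // t /andP[t0 td]; have := H t.
rewrite -ball_normE /ball_ /= sub0r normrN ger0_norm// in_itv/= t0 => /(_ td isT).
by rewrite /from_subspace (C0_semigroup0 S_semigroup) distrC.
Qed.

(** The laws of [S] concern nonnegative times only; truncating time at 0 gives a function continuous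
    on the whole line, to which measurability results on the line apply. *)
Lemma max0_continuous (v : X) : continuous (fun s : R => S (Num.max s 0) v).
Proof.
move=> s0; apply/cvgrPdist_le => e e0; have [d d0 Hd] := semigroup_cont0 v e0.
have key a b : 0 <= a <= b -> b - a < d -> `|S b v - S a v| <= e.
  move=> /andP[a0 ab] bad.
  rewrite -[b](subrKC a) (C0_semigroupD S_semigroup) ?subr_ge0//.
  by rewrite (le_trans (semigroup_norm_contr _ _ a0))// Hd// subr_ge0 ab.
apply/nbhs_ballP; exists d => // s s0_s.
have sd : `|s0 - s| < d by [].
have [s0s|ss0] := leP s0 s.
  rewrite distrC; apply: key.
    by rewrite le_max lexx orbT /= ge_max le_max s0s /= le_max lexx orbT.
  move: sd; rewrite distrC ger0_norm ?subr_ge0//; rewrite /Num.max; case: ifP; case: ifP; lra.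
apply: key.
  by rewrite le_max lexx orbT /= ge_max le_max (ltW ss0) /= le_max lexx orbT.
move: sd; rewrite gtr0_norm ?subr_gt0//; rewrite /Num.max; case: ifP; case: ifP; lra.
Qed.

(* [W z] is the mean of [S s z] over [0, h]; composing a functional with [W]
   puts it in the domain of the adjoint of the generator. *)
Lemma semigroup_mean (h : R) : 0 < h -> exists W : bop X X,
  [/\ forall z e, 0 < e -> exists2 d, 0 < d & forall t, 0 < t < d ->
        `|t^-1 *: (S t (W z) - W z) - h^-1 *: (S h z - z)| <= e,
      forall t z, 0 <= t -> W (S t z) = S t (W z) &
      forall z e, (forall t, 0 <= t <= h -> `|S t z - z| <= e) -> `|W z - z| <= e].
Proof.
move=> h0.
pose om := @orbit_mean R X S h.
have om_lin n : linear (om ^~ n).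
  move=> a x y; rewrite /om /orbit_mean.
  under eq_bigr do rewrite linearP.
  by rewrite big_split/= -scaler_sumr scalerDr !scalerA mulrC.
have ia0 (k n : nat) : 0 <= h * (k%:R * 2^-1 ^+ n) :> R.
  by rewrite mulr_ge0 ?(ltW h0)// mulr_ge0// exprn_ge0 ?invr_ge0.
have mean_le n (g : nat -> X) c : (forall k, (k < 2 ^ n)%N -> `|g k| <= c) ->
    `|2^-1 ^+ n *: \sum_(k < 2 ^ n) g k| <= c.
  move=> gc; rewrite normrZ ger0_norm ?exprn_ge0 ?invr_ge0//.
  apply: le_trans (ler_wpM2l _ (@seminorm_sum _ _ (fun x : X => `|x|) (@ler_normD _ _)
    (fun a x => normrZ a x) _ g c gc)) _.
    by rewrite exprn_ge0 ?invr_ge0.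
  by rewrite mulrA natrX -exprMn mulVf ?pnatr_eq0// expr1n mul1r.
have om_contr x n : `|om x n| <= `|x|.
  by apply: (mean_le n (fun k => S (h * (k%:R * 2^-1 ^+ n)) x)) => k _; exact: (C0_semigroup_contr S_semigroup).
have N_Z (a : R) (x : X) : `|a *: x| = `|a| * `|x| by exact: normrZ.
have T_lin t a x y : 0 <= t -> `|S t (a *: x + y) - (a *: S t x + S t y)| = 0.
  by move=> _; rewrite linearP subrr normr0.
have T_add s t x : 0 <= s -> 0 <= t -> `|S (s + t) x - S s (S t x)| = 0.
  by move=> s0 t0; rewrite (C0_semigroupD S_semigroup)// subrr normr0.
have om_cau z : forall e : R, 0 < e -> exists n0, forall m n, (n0 <= m)%N -> (n0 <= n)%N ->
    `|om z m - om z n| <= e.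
  move=> e e0; have e20 : 0 < e / 2 by rewrite divr_gt0.
  have [d d0 Hd] := semigroup_cont0 z e20.
  have [|n0 Hn0] := @half_expn_lt R (d / h); first by rewrite divr_gt0.
  have hn0 : h * 2^-1 ^+ n0 < d.
    by have := Hn0 _ (leqnn n0); rewrite ltr_pdivlMr// mulrC.
  have dist := @orbit_mean_dist R X (fun x => `|x|) (@ler_normD _ _)
     N_Z S semigroup_norm_contr T_add h z (e / 2) d h0 Hd.
  exists n0 => m n n0m n0n.
  rewrite [leRHS]splitr (le_trans (ler_distD (om z n0) _ _))//.
  apply: lerD; first exact: dist.
  by rewrite distrC; exact: dist.
have /choice[W WP] z := cauchy_norm_cvg (om_cau z).
have W_cvg z : om z @ \oo --> W z.
  apply/cvgrPdist_le => e e0; have [n0 Hn0] := WP z e e0; exists n0 => // n n0n.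
  by rewrite distrC; exact: Hn0.
have W_lin : linear W.
  move=> a x y; apply: (cvg_unique _ (W_cvg _)) => //.
  have -> : om (a *: x + y) = fun n => a *: om x n + om y n.
    by apply/funext => n; exact: om_lin.
  by apply: cvgD => //; apply: cvgZr.
have W_contr z : `|W z| <= `|z|.
  apply: (ler_cvg_to (cvg_norm (W_cvg z)) (cvg_cst `|z|)).
  by apply: nearW => n; exact: om_contr.
have W_bop : W \in @is_bop R X X.
  rewrite inE; split => //.
  pose Wl : {linear X -> X} := HB.pack W (GRing.isLinear.Build _ _ _ _ _ W_lin).
  apply: (@bounded_linear_continuous _ _ _ Wl); apply/linear_boundedP.
  exists 1; split; first exact: num_real.
  move=> M M1 x; apply: le_trans (W_contr x) _.
  by rewrite ler_peMl// ltW.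
exists (Bop W_bop); split => /=.
- move=> z e e0.
  have [d d0 Hd] := @orbit_mean_generator R X (fun x => `|x|) (fun x => normr_ge0 x) (@ler_normD _ _)
     N_Z S semigroup_norm_contr T_lin T_add semigroup_cont0 h z h0 (W z) (WP z) e e0.
  exists d => // t td; have := Hd t td; case/andP: td => t0 _.
  have -> : S t (W z) - W z - t *: (h^-1 *: (S h z - z)) =
     t *: (t^-1 *: (S t (W z) - W z) - h^-1 *: (S h z - z)).
    by rewrite [RHS]scalerBr [t *: (t^-1 *: _)]scalerA divff ?gt_eqF// scale1r.
  by rewrite normrZ gtr0_norm// ler_pM2l.
- move=> t z t0; apply: (cvg_unique _ (W_cvg _)) => //.
  have -> : om (S t z) = S t \o om z.
    apply/funext => n /=; rewrite /om /orbit_mean [RHS]linearZ/= (linear_sum (S t)).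
    apply: (congr1 (fun v => 2^-1 ^+ n *: v)).
    apply: eq_bigr => k _.
    rewrite -(@C0_semigroupD _ _ _ S_semigroup _ t z (ia0 k n) t0) addrC.
    by rewrite (@C0_semigroupD _ _ _ S_semigroup t _ z t0 (ia0 k n)).
  by apply: continuous_cvg => //; exact: bop_continuous.
- move=> z e He.
  have lim : `|om z n - z| @[n --> \oo] --> `|W z - z|.
    by apply: cvg_norm; apply: cvgB => //; exact: cvg_cst.
  apply: (ler_cvg_to lim (cvg_cst e)); apply: nearW => n.
  have -> : om z n - z = 2^-1 ^+ n *: \sum_(k < 2 ^ n) (S (h * (k%:R * 2^-1 ^+ n)) z - z).
    rewrite sumrB scalerBr sumr_const card_ord -[z *+ _]scaler_nat scalerA natrX.
    by rewrite -exprMn mulVf ?pnatr_eq0// expr1n scale1r.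
  apply: (mean_le n (fun k => S (h * (k%:R * 2^-1 ^+ n)) z - z)) => k kn.
  apply: He; rewrite ia0 /= ger_pMr//.
  apply: (@le_trans _ _ ((2 ^ n)%:R * 2^-1 ^+ n)).
    by rewrite ler_wpM2r ?exprn_ge0 ?invr_ge0// ler_nat ltnW.
  by rewrite natrX -exprMn divff ?pnatr_eq0// expr1n.
Qed.
End contraction_semigroup.

Section lebesgue_translation.
Context {R : realType}.
Local Notation leb := (@lebesgue_measure R).

Lemma lebesgue_measure_shift (a : R) (A : set R) : measurable A ->
  pushforward leb ((fun x => a + x) : _ -> measurableTypeR R) A = leb A.
Proof.
move=> mA.
have mshift : measurable_fun setT ((fun x => a + x) : measurableTypeR R -> measurableTypeR R).
  exact: measurable_funD.
pose shift : {mfun measurableTypeR R >-> measurableTypeR R} :=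
  HB.pack (fun x : R => a + x) (isMeasurableFun.Build _ _ _ _ _ mshift).
apply/esym; apply: (@lebesgue_measure_unique R (pushforward leb shift)) => // _ [[x y] _ <-].
transitivity (leb `]x - a, y - a]%classic); last first.
  rewrite -[RHS]/(leb ((fun z => a + z) @^-1` `]x, y]%classic)); congr (leb _).
  by apply/seteqP; split=> z /=; rewrite !in_itv/= ltrBlDl lerBrDl.
by rewrite !lebesgue_measure_itv/= !lte_fin ltrD2r -!EFinB opprB addrA subrK.
Qed.

Lemma le_integral_shift (G : R -> R) (a t : R) : measurable_fun setT G ->
  (forall s, 0 <= G s) -> 0 <= a ->
  (\int[leb]_(s in `[0%R, t]) (G (a + s)%R)%:E <=
   \int[leb]_(s in `[0%R, (a + t)%R]) (G s)%:E)%E.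
Proof.
move=> mG G0 a0.
have mshift : measurable_fun setT ((fun x => a + x) : measurableTypeR R -> measurableTypeR R).
  exact: measurable_funD.
have -> : (`[0, t]%classic : set R) = (fun x => a + x) @^-1` `[a, a + t]%classic.
  by apply/seteqP; split=> z /=; rewrite !in_itv/= lerDl lerD2l.
have := @ge0_integral_pushforward _ _ _ _ R _ mshift leb `[a, a + t]%classic (EFin \o G).
move=> <-//; last 2 first.
- by apply/measurable_EFinP; exact: measurable_funTS.
- by move=> y _; rewrite lee_fin.
rewrite (@eq_measure_integral _ _ _ _ leb); last first.
  by move=> A mA _; exact: lebesgue_measure_shift.
apply: ge0_subset_integral => //.
- by apply/measurable_EFinP; exact: measurable_funTS.
- by move=> y _; rewrite lee_fin.
- by move=> z /=; rewrite !in_itv/= => /andP[az ->]; rewrite (le_trans a0).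
Qed.
End lebesgue_translation.

(** * Covariance operators and the sign of [ip (B h) h] *)

Section dissipativity.
Context {R : realType} (X : completeNormedModType R).
Context (Q : {linear dual X -> X}).
Context (Q_sym : forall xs ys : dual X, ys (Q xs) = xs (Q ys)).
Context (Q_ge0 : forall xs : dual X, 0 <= (xs (Q xs) : R)).
Context (DA : set X) (A : X -> X) (S : R -> bop X X).
Context (S_semigroup : C0_contraction_semigroup S) (A_generates : generates DA A S).
Context (Qt : R -> dual X -> X).
Context (Qt_def : forall (t : R) (xs : dual X), 0 < t ->
     bochner_integral (@lebesgue_measure R) `[0, t]
       (fun s => S s (Q (bcomp xs (S s)))) (Qt t xs)).
Context (Qinf : dual X -> X).
Context (Qinf_def : forall xs ys : dual X,
     (ys (Qt t xs) : R) @[t --> +oo] --> (ys (Qinf xs) : R)).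

Lemma bopD (f g : dual X) x : (f + g) x = f x + g x. Proof. by []. Qed.
Lemma bopN (f : dual X) x : (- f) x = - f x. Proof. by []. Qed.
Lemma bopZ a (f : dual X) x : (a *: f) x = a * f x. Proof. by []. Qed.

Lemma bop_ext (U V : normedModType R) (f g : bop U V) : f =1 g -> f = g.
Proof. by move=> fg; apply/val_inj/funext. Qed.

Lemma bopB (f : dual X) x y : f (x - y) = f x - f y. Proof. exact: raddfB. Qed.

Lemma covariance_sub (ys zs : dual X) : ((ys - zs) (Q (ys - zs)) : R) =
  ys (Q ys) - 2 * (ys (Q zs) : R) + zs (Q zs).
Proof. rewrite bopD bopN linearB !bopB (Q_sym ys zs); ring. Qed.

Definition covariance_orbit (xs : dual X) (s : R) : R :=
  bcomp xs (S (Num.max s 0)) (Q (bcomp xs (S (Num.max s 0)))).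

(* [<Q S_s^* xs, S_s^* xs>] is the supremum over [zs] of the continuous functions
   [2 <Q zs, S_s^* xs> - <Q zs, zs>] of [s]. *)
Lemma measurable_covariance_orbit (xs : dual X) :
  measurable_fun [set: R] (covariance_orbit xs).
Proof.
apply/measurable_EFinP; apply: lower_semicontinuous_measurable.
move=> s a; rewrite lte_fin => aGs.
pose zs := bcomp xs (S (Num.max s 0)).
pose phi (r : R) : R := 2 * (xs (S (Num.max r 0) (Q zs)) : R) - (zs (Q zs) : R).
have phi_cont : {for s, continuous phi}.
  apply: cvgB; last exact: cvg_cst.
  apply: cvgMr; apply: (cvg_comp (fun r => S (Num.max r 0) (Q zs)) xs).
    exact: (@max0_continuous _ _ _ S_semigroup (Q zs) s).
  exact: bop_continuous.
exists [set r | a < phi r].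
  apply: (cvgr_gt _ phi_cont).
  by rewrite /phi; move: aGs; rewrite /covariance_orbit -/zs /=; lra.
move=> r /= ar; rewrite lte_fin (lt_le_trans ar)// /covariance_orbit /phi.
set ys := bcomp xs (S (Num.max r 0)).
have := Q_ge0 (ys - zs).
rewrite covariance_sub.
have -> : xs (S (Num.max r 0) (Q zs)) = ys (Q zs) by [].
move: (ys (Q ys) : R) (ys (Q zs) : R) (zs (Q zs) : R) => u v w; lra.
Qed.

Lemma Qt_integral (t : R) (xs : dual X) : 0 < t ->
  (\int[@lebesgue_measure R]_(s in `[0%R, t]) (covariance_orbit xs s)%:E =
   (xs (Qt t xs) : R)%:E)%E.
Proof.
move=> t0.
rewrite -(@bochner_functional _ _ _ _ _ _ _ _ (Qt t xs) xs _ (Qt_def xs t0))//.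
  apply: eq_integral => s; rewrite inE /= in_itv/= => /andP[s0 _].
  by rewrite /covariance_orbit (max_idPl s0).
apply: (eq_measurable_fun (covariance_orbit xs)).
  by move=> s; rewrite inE /= in_itv/= => /andP[s0 _]; rewrite /covariance_orbit (max_idPl s0).
by apply: measurable_funTS; exact: measurable_covariance_orbit.
Qed.

(** By the semigroup law, the integrand of [Qt] at [bcomp xs (S r)] is that at [xs] shifted by [r].
    It is nonnegative, so its integral over [[r, r + t]] is at most that over [[0, r + t]]; then [t]
    tends to infinity. *)
Lemma Qinf_semigroup_le (r : R) (xs : dual X) : 0 <= r ->
  (bcomp xs (S r) (Qinf (bcomp xs (S r))) : R) <= xs (Qinf xs).
Proof.
move=> r0.
have Qt_le t : 0 < t ->
    (bcomp xs (S r) (Qt t (bcomp xs (S r))) : R) <= xs (Qt (r + t) xs).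
  move=> t0; rewrite -lee_fin -Qt_integral// -Qt_integral ?ltr_wpDl//.
  apply: le_trans (le_integral_shift _ (measurable_covariance_orbit xs) _ r0); last first.
    by move=> s; exact: Q_ge0.
  rewrite le_eqVlt; apply/orP; left; apply/eqP; apply: eq_integral => s.
  rewrite inE /= in_itv/= => /andP[s0 _].
  rewrite /covariance_orbit (max_idPl s0) (max_idPl (addr_ge0 r0 s0)).
  have -> // : bcomp (bcomp xs (S r)) (S s) = bcomp xs (S (r + s)).
  by apply: bop_ext => z /=; rewrite (C0_semigroupD S_semigroup).
have l1 : (bcomp xs (S r) (Qt t (bcomp xs (S r))) : R) @[t --> +oo] -->
  (bcomp xs (S r) (Qinf (bcomp xs (S r))) : R) by exact: Qinf_def.
have l2 : (xs (Qt (r + t) xs) : R) @[t --> +oo] --> (xs (Qinf xs) : R).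
  apply: (cvg_comp (fun t => r + t) (fun t => xs (Qt t xs) : R)); last exact: Qinf_def.
  exact: cvg_addrl.
apply: (ler_cvg_to l1 l2).
by near=> t; apply: Qt_le; near: t; exact: nbhs_pinfty_gt.
Unshelve. all: by end_near. Qed.

Context (mu_inf : probability (borel X) R) (mu_inf_cov : covariance_operator mu_inf Qinf).

Lemma Qinf_sym (xs ys : dual X) : ys (Qinf xs) = xs (Qinf ys).
Proof. by rewrite !mu_inf_cov; apply: eq_Rintegral => x _; rewrite mulrC. Qed.

Lemma Qinf_ge0 (xs : dual X) : 0 <= (xs (Qinf xs) : R).
Proof. by rewrite mu_inf_cov; apply: Rintegral_ge0 => x _; rewrite -expr2 sqr_ge0. Qed.

(** The generator of the adjoint semigroup in the weak-star sense, since orbits of the adjoint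
    semigroup may fail to be norm continuous. *)
Definition weak_generator (xs ys : dual X) := forall z (e : R), 0 < e ->
  exists2 d, 0 < d & forall t, 0 < t < d ->
    `|t^-1 * (xs (S t z) - xs z) - ys z| <= e.

Lemma weak_generator_adjoint (xs ys : dual X) : weak_generator xs ys ->
  adjoint_graph DA A xs ys.
Proof.
move=> w z Dz.
have /A_generates/= zA : DA z /\ A z = A z by [].
have l1 : (xs (t^-1 *: (S t z - z)) : R) @[t --> 0^'+] --> (xs (A z) : R).
  by apply: continuous_cvg => //; exact: bop_continuous.
apply: (cvg_unique _ l1); first exact: norm_hausdorff.
apply/cvgrPdist_le => e /(w z)[d d0 H]; near=> t.
rewrite distrC linearZ raddfB; apply: H; apply/andP; split.
  by near: t; exact: nbhs_right_gt.
by near: t; exact: nbhs_right_lt.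
Unshelve. all: by end_near. Qed.

(** Write [q] for the form of [Qinf] and [xt] for [bcomp xs (S t)]. Then [2 q(xt, xs) <= q(xt, xt) +
    q(xs, xs) <= 2 q(xs, xs)], so the difference quotients of [xs] at the point [Qinf xs] are
    nonpositive. *)
Lemma weak_generator_dissipative (xs ys : dual X) : weak_generator xs ys ->
  (ys (Qinf xs) : R) <= 0.
Proof.
move=> w; apply/ler_addgt0Pr => e e0; rewrite add0r.
have [d d0 Hd] := w (Qinf xs) e e0.
have t0 : 0 < d / 2 by rewrite divr_gt0.
have td : d / 2 < d by rewrite ltr_pdivrMr// mulr_natr mulr2n ltrDl.
have := Hd (d / 2); rewrite t0 td => /(_ isT); set t := d / 2.
have H : (xs (S t (Qinf xs)) - xs (Qinf xs) : R) <= 0.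
  set xt := bcomp xs (S t).
  have := Qinf_semigroup_le xs (ltW t0); rewrite -/t -/xt.
  have := Qinf_ge0 (xt - xs).
  have -> : ((xt - xs) (Qinf (xt - xs)) : R) =
      xt (Qinf xt) - 2 * (xt (Qinf xs) : R) + xs (Qinf xs).
    rewrite bopD bopN (Qinf_sym (xt - xs) xt) (Qinf_sym (xt - xs) xs).
    rewrite !bopD !bopN (Qinf_sym xt xs); ring.
  have -> : xs (S t (Qinf xs)) = xt (Qinf xs) by [].
  move: (xt (Qinf xt) : R) (xt (Qinf xs) : R) (xs (Qinf xs) : R) => u v z; lra.
have : t^-1 * (xs (S t (Qinf xs)) - xs (Qinf xs)) <= 0.
  by rewrite pmulr_rle0 ?invr_gt0.
rewrite ler_norml; lra.
Qed.

Context (H : completeNormedModType R) (ip : H -> H -> R).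
Context (i : bop H X) (istar : dual X -> H) (H_RKHS : is_RKHS Q ip i istar).
Context (B : bop H H).
Context (B_def : forall xs ys : dual X, adjoint_graph DA A xs ys ->
     i (B (istar xs)) = Qinf ys).

Let ip_hilbert := rkhs_hilbert H_RKHS.

Lemma eq_ip h k : (forall xs, ip (istar xs) h = ip (istar xs) k) -> h = k.
Proof.
move=> hk; set w := h - k.
have ip_w xs : ip (istar xs) w = 0 by rewrite /w (ipBr ip_hilbert) hk subrr.
apply/eqP; rewrite -subr_eq0 -/w -normr_le0; apply/ler_addgt0Pr => e e0; rewrite add0r.
have [|y [wy [xs _ xsy]]] := rkhs_dense H_RKHS _ (ball_open w e).
  by exists w; exact: ballxx.
have we : `|w - istar xs| < e by move: wy; rewrite -ball_normE xsy.
have [->|w0] := eqVneq w 0; first by rewrite normr0 ltW.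
have wp : 0 < `|w| by rewrite normr_gt0.
rewrite -(ler_pM2r wp) -expr2 (ip_norm ip_hilbert).
rewrite -[X in ip X _](subrK (istar xs)) (ipDl ip_hilbert) ip_w addr0.
apply: le_trans (ler_norm _) _; apply: le_trans (cauchy_schwarz ip_hilbert _ _) _.
by rewrite ler_wpM2r// ltW.
Qed.

(** By [rkhs_isometry], both sides have the same inner product with each element of the dense range
    of [istar]. *)
Lemma istar_lin a xs ys : istar (a *: xs + ys) = a *: istar xs + istar ys.
Proof.
apply: eq_ip => zs; rewrite (ipDr ip_hilbert) (ipZr ip_hilbert).
rewrite !(rkhs_isometry H_RKHS).
by rewrite bopD bopZ.
Qed.

Lemma weak_generator_lin a xs ys xs' ys' : weak_generator xs ys ->
  weak_generator xs' ys' -> weak_generator (a *: xs + xs') (a *: ys + ys').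
Proof.
move=> w w' z e e0.
have a0 : 0 < 2 * (`|a| + 1) by rewrite mulr_gt0// ltr_wpDl.
have [d d0 Hd] := w z _ (divr_gt0 e0 a0).
have e20 : 0 < e / 2 by rewrite divr_gt0.
have [d' d'0 Hd'] := w' z _ e20.
exists (Num.min d d'); first by rewrite lt_min d0.
move=> t /andP[t0]; rewrite lt_min => /andP[td td'].
have /Hd H1 : 0 < t < d by rewrite t0.
have /Hd' H2 : 0 < t < d' by rewrite t0.
rewrite !bopD !bopZ.
have -> : t^-1 * (a * (xs (S t z) : R) + xs' (S t z) - (a * (xs z : R) + xs' z)) -
     (a * (ys z : R) + ys' z) =
   a * (t^-1 * (xs (S t z) - xs z) - ys z) + (t^-1 * (xs' (S t z) - xs' z) - ys' z).
  move: (xs (S t z) : R) (xs' (S t z) : R) (xs z : R) (xs' z : R) (ys z : R) (ys' z : R).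
  move=> *; ring.
apply: le_trans (ler_normD _ _) _; rewrite (splitr e) lerD// normrM.
apply: le_trans (ler_wpM2l (normr_ge0 a) H1) _.
have -> : `|a| * (e / (2 * (`|a| + 1))) = e / 2 * (`|a| / (`|a| + 1)).
  by field; rewrite gt_eqF// ltr_wpDl.
by rewrite ler_piMr ?(ltW e20)// ler_pdivrMr ?mul1r ?lerDl// ltr_wpDl.
Qed.

(** For a time mean [W] of [S], the functional [bcomp xs W] is in the domain, with derivative the
    difference quotient of [xs] over the interval of the mean. Orthogonality gives
    [xs (W (i h)) = 0], and [W (i h)] tends to [i h] as the interval shrinks. *)
Lemma weak_generator_orthogonal h :
  (forall xs ys, weak_generator xs ys -> ip (istar xs) h = 0) -> h = 0.
Proof.
move=> h_orth; apply: eq_ip => xs; rewrite [RHS](ipC ip_hilbert) (ip0l ip_hilbert).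
rewrite (rkhs_adjoint H_RKHS).
apply/eqP; rewrite -normr_le0; apply/ler_addgt0Pr => e e0; rewrite add0r.
have [C C0 xC] := dual_bounded xs.
have [d d0 Hd] := semigroup_cont0 S_semigroup (i h) (divr_gt0 e0 C0).
have d20 : 0 < d / 2 by rewrite divr_gt0.
have dd : d / 2 < d by rewrite ltr_pdivrMr// mulr_natr mulr2n ltrDl.
have [W [W1 W2 W3]] := semigroup_mean S_semigroup d20.
have w : weak_generator (bcomp xs W) ((d / 2)^-1 *: (bcomp xs (S (d / 2)) - xs)).
  move=> z c c0; have [d' d'0 Hd'] := W1 z _ (divr_gt0 c0 C0).
  exists d' => // t td'; have /andP[t0 _] := td'.
  rewrite bopZ bopD bopN /= W2 ?(ltW t0)// -!raddfB.
  have -> : t^-1 * (xs (S t (W z) - W z) : R) = xs (t^-1 *: (S t (W z) - W z)).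
    by rewrite linearZ.
  have -> : (d / 2)^-1 * (xs (S (d / 2) z - z) : R) = xs ((d / 2)^-1 *: (S (d / 2) z - z)).
    by rewrite linearZ.
  rewrite -raddfB (le_trans (xC _))// mulrC -ler_pdivlMr//; exact: Hd'.
have := h_orth _ _ w; rewrite (rkhs_adjoint H_RKHS) /= => W0.
rewrite -[X in `|X|]subr0 -W0 -raddfB (le_trans (xC _))// mulrC -ler_pdivlMr// distrC.
apply: W3 => t /andP[t0 td]; apply: Hd; rewrite t0 /=.
exact: le_lt_trans dd.
Qed.

Lemma bop_bounded (U V : normedModType R) (f : bop U V) :
  exists2 C : R, 0 < C & forall v, `|f v| <= C * `|v|.
Proof.
have /linear_boundedP := @continuous_linear_bounded _ _ _ 0 f (@bop_continuous _ _ _ f 0).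
by move=> /pinfty_ex_gt0[C C0 HC]; exists C.
Qed.

Lemma RKHS_operator_dissipative h : ip (B h) h <= 0.
Proof.
pose K := [set k | exists xs ys, weak_generator xs ys /\ k = istar xs].
have w0 : weak_generator 0 0.
  move=> z e e0; exists 1 => // t _.
  by rewrite -[X in `|X|]/(t^-1 * (0 - 0) - 0 : R) !subr0 mulr0 normr0 ltW.
have K0 : K 0.
  exists 0, 0; split => //; apply: eq_ip => xs.
  rewrite [LHS](ipC ip_hilbert) (ip0l ip_hilbert) (rkhs_isometry H_RKHS).
  by [].
have K_lin (a : R) k k' : K k -> K k' -> K (a *: k + k').
  move=> [xs [ys [w ->]]] [xs' [ys' [w' ->]]].
  by exists (a *: xs + xs'), (a *: ys + ys'); rewrite istar_lin; split => //;
    exact: weak_generator_lin.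
have K_orth k : (forall k', K k' -> ip k' k = 0) -> k = 0.
  by move=> Kk; apply: weak_generator_orthogonal => xs ys w; apply: Kk; exists xs, ys.
have K_diss k : K k -> ip (B k) k <= 0.
  move=> [xs [ys [w ->]]]; rewrite (ipC ip_hilbert) (rkhs_adjoint H_RKHS).
  rewrite (B_def (weak_generator_adjoint w)) Qinf_sym.
  exact: weak_generator_dissipative w.
have [C C0 BC] := bop_bounded B.
apply/ler_addgt0Pr => e e0; rewrite add0r.
(* By the Cauchy-Schwarz inequality, and since [|k| <= |h| + 1], replacing [h] by [k] changes the
   form by at most [C * (2 * |h| + 1) * |h - k|]. *)
have M0 : 0 < C * (2 * `|h| + 1) by rewrite mulr_gt0// ltr_wpDl// mulr_ge0.
have eM : 0 < Num.min 1 (e / (C * (2 * `|h| + 1))) by rewrite lt_min ltr01 divr_gt0.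
have [k Kk] := orthogonal_dense ip_hilbert K0 K_lin K_orth h eM.
rewrite le_min => /andP[hk1 hk].
have -> : ip (B h) h = ip (B k) k + (ip (B (h - k)) h + ip (B k) (h - k)).
  by rewrite raddfB (ipBl ip_hilbert) (ipBr ip_hilbert); lra.
have H1 : ip (B (h - k)) h <= C * `|h - k| * `|h|.
  apply: le_trans (ler_norm _) _; apply: le_trans (cauchy_schwarz ip_hilbert _ _) _.
  by rewrite ler_wpM2r.
have H2 : ip (B k) (h - k) <= C * `|k| * `|h - k|.
  apply: le_trans (ler_norm _) _; apply: le_trans (cauchy_schwarz ip_hilbert _ _) _.
  by rewrite ler_wpM2r.
have kh : `|k| <= `|h| + 1.
  by rewrite -[k](subKr h) (le_trans (ler_normB _ _))// lerD2l.
have H3 : C * `|k| * `|h - k| <= C * (`|h| + 1) * `|h - k|.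
  by rewrite ler_wpM2r// ler_wpM2l// ltW.
have H4 : C * (2 * `|h| + 1) * `|h - k| <= e by rewrite mulrC -ler_pdivlMr.
have := K_diss k Kk; lra.
Qed.
End dissipativity.

(** * Lp norms *)

Section Lp_norm.
Context {R : realType} d (T : measurableType d).
Variable mu : {measure set T -> \bar R}.

(** [fine] sends an infinite norm to 0, so the value is a norm of [f] only for [f] in [Lp]. *)
Definition Lpnorm (p : R) (f : T -> R) : R := fine 'N[mu]_p%:E[EFin \o f]%E.

Variable p : R.
Hypothesis p1 : 1 <= p.
Implicit Types f g h : T -> R.

Local Notation Lp := (Lfun mu p%:E).
Local Notation nrm := (Lpnorm p).

Let p0 : 0 < p. Proof. exact: lt_le_trans p1. Qed.
Let pn0 : p != 0. Proof. by rewrite gt_eqF. Qed.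
Let p1e : (1 <= p%:E)%E. Proof. by rewrite lee_fin. Qed.

Lemma Lfun_measurable f : f \in Lp -> measurable_fun setT f.
Proof. by rewrite inE => /andP[] /[!inE]. Qed.

Lemma measurable_abs_powR f : measurable_fun setT f ->
  measurable_fun setT (fun x => (`|f x| `^ p)%:E).
Proof.
move=> mf; apply/measurable_EFinP.
by apply: (measurableT_comp (measurable_powR _)); exact: measurableT_comp.
Qed.

Lemma Lfun_powRP f : f \in Lp <->
  measurable_fun setT f /\ (\int[mu]_x (`|f x| `^ p)%:E < +oo)%E.
Proof.
split=> [pf|[mf If]].
  split; first exact: Lfun_measurable.
  have := Lfun_integrable p1 pf => /integrableP[_].
  by under eq_integral do rewrite gee0_abs ?lee_fin ?powR_ge0//.
rewrite inE; apply/andP; split; rewrite inE//= /finite_norm unlock.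
by rewrite poweR_lty.
Qed.

Lemma Lpnorm_EFin f : f \in Lp -> 'N[mu]_p%:E[EFin \o f]%E = (nrm f)%:E.
Proof.
by move=> pf; rewrite -(Lfun_valP p1e pf) /Lpnorm finite_norm_fine.
Qed.

Lemma Lpnorm_ge0 f : 0 <= nrm f.
Proof. exact/fine_ge0/Lnorm_ge0. Qed.

Lemma Lpnorm_powR f : f \in Lp ->
  ((nrm f) `^ p)%:E = (\int[mu]_x (`|f x| `^ p)%:E)%E.
Proof. by move=> pf; rewrite -poweR_EFin -Lpnorm_EFin// poweR_Lnorm. Qed.

Lemma LfunD f g : f \in Lp -> g \in Lp -> f \+ g \in Lp.
Proof. by move=> pf pg; have [_] := Lfun_addr_closed mu p1e; exact. Qed.

Lemma LfunZ (a : R) f : f \in Lp -> (fun x => a * f x) \in Lp.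
Proof.
move=> pf; have [p_0 pP] := Lfun_submod_closed mu p1e.
by have := pP a f 0 pf p_0; rewrite addr0.
Qed.

Lemma LfunB f g : f \in Lp -> g \in Lp -> f \- g \in Lp.
Proof.
by move=> pf pg; apply: LfunD => //; have := Lfun_oppr_closed pg.
Qed.

Lemma LpnormD f g : f \in Lp -> g \in Lp -> nrm (f \+ g) <= nrm f + nrm g.
Proof.
move=> pf pg.
exact: (ler_LnormD (Lfun_Sub p1e pf) (Lfun_Sub p1e pg)).
Qed.

Lemma LpnormZ (a : R) f : f \in Lp -> nrm (fun x => a * f x) = `|a| * nrm f.
Proof.
move=> pf; apply: EFin_inj; rewrite EFinM -!Lpnorm_EFin ?LfunZ//.
exact: (LnormZ (Lfun_Sub p1e pf) a).
Qed.

Lemma LpnormBC f g : nrm (f \- g) = nrm (g \- f).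
Proof.
rewrite /Lpnorm; congr fine; rewrite -[RHS]oppe_Lnorm; congr Lnorm.
by apply/funext => x /=; rewrite -opprB.
Qed.

Lemma Lpnorm_dist g f h : f \in Lp -> g \in Lp -> h \in Lp ->
  nrm (f \- h) <= nrm (f \- g) + nrm (g \- h).
Proof.
move=> pf pg ph; apply: le_trans (LpnormD (LfunB pf pg) (LfunB pg ph)).
by rewrite le_eqVlt; apply/orP/or_introl/eqP; congr nrm; apply/funext => x /=; ring.
Qed.

Lemma Lpnorm_le f g : f \in Lp -> g \in Lp ->
  (\int[mu]_x (`|f x| `^ p)%:E <= \int[mu]_x (`|g x| `^ p)%:E)%E ->
  nrm f <= nrm g.
Proof.
move=> pf pg; rewrite -!Lpnorm_powR// lee_fin.
apply: contraTT; rewrite -!ltNge => /gt0_ltr_powR-> //;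
  by rewrite nnegrE Lpnorm_ge0.
Qed.

Lemma ae_eq_Lpnorm f g : measurable_fun setT f -> measurable_fun setT g ->
  f = g %[ae mu] -> 'N[mu]_p%:E[EFin \o f]%E = 'N[mu]_p%:E[EFin \o g]%E.
Proof.
move=> mf mg fg.
have LE h : ('N[mu]_p%:E[EFin \o h] = (\int[mu]_x (`|h x| `^ p)%:E) `^ p^-1)%E.
  by rewrite unlock.
rewrite !LE; apply: (congr1 (fun I : \bar R => I `^ p^-1)%E).
apply: ae_eq_integral => //; [exact: measurable_abs_powR..|].
by apply: filterS fg => x /= fg xT; rewrite fg.
Qed.

Lemma Lpnorm_eq0 f : f \in Lp -> nrm f = 0 -> f = cst 0 %[ae mu].
Proof. by move=> pf; exact: (@fine_Lnormr_eq0 _ _ _ mu _ p1e (Lfun_Sub p1e pf)). Qed.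

Lemma Lpnorm_eq0_dist f g : f \in Lp -> g \in Lp ->
  nrm (f \- g) = 0 -> f = g %[ae mu].
Proof.
move=> pf pg /(Lpnorm_eq0 (LfunB pf pg)); apply: filterS => x /= /[apply].
by move/eqP; rewrite subr_eq0 => /eqP.
Qed.

Lemma ae_eq_Lpnorm_dist f g : f \in Lp -> g \in Lp ->
  f = g %[ae mu] -> nrm (f \- g) = 0.
Proof.
move=> pf pg fg; rewrite /Lpnorm (@ae_eq_Lpnorm _ (cst 0)) //=.
- by rewrite -[_ \o _]/(cst 0%E) Lnorm0.
- exact: Lfun_measurable (LfunB pf pg).
- by apply: filterS fg => x /= /[apply] ->; rewrite subrr.
Qed.

Lemma Lfun_ae_dominated f g : measurable_fun setT f -> g \in Lp ->
  {ae mu, forall x, `|f x| <= `|g x|} -> f \in Lp /\ nrm f <= nrm g.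
Proof.
move=> mf /[dup] pg /Lfun_powRP[mg Ig] fg.
have Ifg : (\int[mu]_x (`|f x| `^ p)%:E <= \int[mu]_x (`|g x| `^ p)%:E)%E.
  apply: ae_ge0_le_integral => //; [exact: measurable_abs_powR..|].
  by apply: filterS fg => x fg _; rewrite lee_fin ge0_ler_powR ?nnegrE// ltW.
have pf : f \in Lp.
  by apply/Lfun_powRP; split; [exact: mf|exact: (le_lt_trans Ifg Ig)].
by split => //; exact: Lpnorm_le.
Qed.

Lemma Lfun_dominated f g : measurable_fun setT f -> g \in Lp ->
  (forall x, `|f x| <= `|g x|) -> f \in Lp /\ nrm f <= nrm g.
Proof. by move=> mf pg fg; apply: Lfun_ae_dominated => //; exact: aeW. Qed.

Lemma Lfun_abs f : f \in Lp -> (fun x => `|f x|) \in Lp.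
Proof.
move=> pf; have mf := Lfun_measurable pf.
have mf' : measurable_fun setT (fun x => `|f x|) by exact: measurableT_comp.
have fle x : `| `|f x| | <= `|f x| by rewrite normr_id.
exact: (Lfun_dominated mf' pf fle).1.
Qed.

Lemma Lpnorm_abs f : nrm (fun x => `|f x|) = nrm f.
Proof. by rewrite /Lpnorm -[in RHS]Lnorm_abse. Qed.

Lemma Lpnorm_cvg0P {I : Type} (F : set_system I) {FF : Filter F}
    (f : I -> T -> R) : (\forall i \near F, f i \in Lp) ->
  'N[mu]_p%:E[EFin \o f i]%E @[i --> F] --> 0%E <->
  forall e, 0 < e -> \forall i \near F, nrm (f i) <= e.
Proof.
move=> pf; split=> [/fine_cvgP[_ /cvgr0Pnorm_le f0] e e0|f0].
  by apply: filterS (f0 e e0) => i /=; rewrite ger0_norm// fine_ge0// Lnorm_ge0.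
apply/fine_cvgP; split.
  by apply: filterS pf => i pfi; rewrite Lpnorm_EFin.
apply/cvgr0Pnorm_le => e e0; apply: filterS (f0 e e0) => i.
by rewrite ger0_norm// fine_ge0// Lnorm_ge0.
Qed.

End Lp_norm.

Lemma cvg_powR {R : realType} (p : R) (f : nat -> R) (a : R) :
  0 < p -> (forall n, 0 <= f n) -> f @ \oo --> a ->
  f n `^ p @[n --> \oo] --> a `^ p.
Proof.
move=> p0 f0 fa; have a0 : 0 <= a by apply: (ler_cvg_to (cvg_cst 0) fa); exact: nearW.
have [a_eq0|a_neq0] := eqVneq a 0.
  rewrite a_eq0 in fa *; rewrite powR0 ?gt_eqF//; apply/cvgr0Pnorm_le => e e0.
  have e'0 : 0 < e `^ p^-1 by exact: powR_gt0.
  have /cvgr0Pnorm_le/(_ _ e'0) := fa; apply: filterS => x.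
  rewrite !ger0_norm ?powR_ge0// => fe.
  rewrite (le_trans (ge0_ler_powR (ltW p0) _ _ fe)) ?nnegrE ?powR_ge0//.
  by rewrite -powRrM mulVf ?gt_eqF// powRr1// ltW.
have {}a0 : 0 < a by rewrite lt_neqAle eq_sym a_neq0.
apply: (@cvg_trans _ (expR (p * ln (f x)) @[x --> \oo])).
  apply: near_eq_cvg; near=> x; rewrite /powR gt_eqF//.
  by near: x; exact: cvgr_gt fa _ a0.
rewrite /powR gt_eqF//; apply: continuous_cvg; first exact: continuous_expR.
by apply: cvgMr; apply: continuous_cvg fa; exact: continuous_ln.
Unshelve. all: by end_near. Qed.

Section L1_norm.
Context {R : realType} d (T : measurableType d).
Variable mu : {measure set T -> \bar R}.
Implicit Types f g : T -> R.
Local Notation L1 := (Lfun mu 1%:E).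
Local Notation nrm1 := (Lpnorm mu 1).

Lemma Lpnorm1_EFin f : f \in L1 -> (nrm1 f)%:E = (\int[mu]_x `|f x|%:E)%E.
Proof. by move=> f1; rewrite -(Lpnorm_EFin (lexx 1) f1) Lnorm1. Qed.

Lemma Lpnorm1D f g : f \in L1 -> g \in L1 -> (forall x, 0 <= f x) ->
  (forall x, 0 <= g x) -> nrm1 (f \+ g) = nrm1 f + nrm1 g.
Proof.
move=> f1 g1 f0 g0; apply: EFin_inj; rewrite EFinD !Lpnorm1_EFin ?LfunD//.
rewrite -ge0_integralD//=; last 2 first.
- by apply/measurable_EFinP/measurableT_comp => //; exact: Lfun_measurable f1.
- by apply/measurable_EFinP/measurableT_comp => //; exact: Lfun_measurable g1.
by apply: eq_integral => x _; rewrite -EFinD !ger0_norm// addr_ge0.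
Qed.

Lemma Lfun1_powR (p : R) f : 1 <= p -> f \in Lfun mu p%:E ->
  (fun x => `|f x| `^ p) \in L1.
Proof. by move=> p1 pf; apply/Lfun1_integrable; exact: Lfun_integrable. Qed.

End L1_norm.

(** * Lp spaces of a finite measure *)

Section Lp_finite_measure.
Context {R : realType} d (T : measurableType d).
Variable mu : {measure set T -> \bar R}.
Hypothesis mu_fin : (mu setT < +oo)%E.
Implicit Types (p q : R) (f g : T -> R).

Let mu_fin_num : mu setT \is a fin_num.
Proof. by rewrite ge0_fin_numE. Qed.

Lemma Lfun_bounded p f M : 1 <= p -> measurable_fun setT f ->
  (forall x, `|f x| <= M) -> f \in Lfun mu p%:E.
Proof.
move=> p1 mf fM; apply/(Lfun_powRP _ p1); split=> //.
have p0 : 0 <= p by exact: le_trans p1.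
apply: (@le_lt_trans _ _ (\int[mu]_x (cst (M `^ p)%:E x))%E).
  apply: ge0_le_integral => //; first exact: measurable_abs_powR.
  move=> x _; rewrite lee_fin ge0_ler_powR// ?nnegrE//.
  exact: le_trans (fM x).
by rewrite integral_cst//= lte_mul_pinfty// lee_fin powR_ge0.
Qed.

Lemma Lfun_cst_fin p (c : R) : 1 <= p -> cst c \in Lfun mu p%:E.
Proof. by move=> p1; apply: (@Lfun_bounded _ _ `|c|). Qed.

Lemma Lfun_le p q f : 1 <= p -> p <= q -> f \in Lfun mu q%:E -> f \in Lfun mu p%:E.
Proof.
move=> p1 pq; have q1 := le_trans p1 pq.
by apply: Lfun_subset; rewrite ?lee_fin.
Qed.

(** Hölder's inequality against the constant 1. The case [p = 1], with infinite conjugate exponent,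
    is separate; 1 is added to the constant to make it positive. *)
Lemma Lpnorm1_le p : 1 <= p -> exists2 C : R, 0 < C &
  forall f, f \in Lfun mu p%:E -> Lpnorm mu 1 f <= C * Lpnorm mu p f.
Proof.
rewrite le_eqVlt => /predU1P[<-|p1]; first by exists 1 => // f _; rewrite mul1r.
have p0 : 0 < p by exact: lt_trans p1.
pose q := (1 - p^-1)^-1.
have q0 : 0 < q by rewrite invr_gt0 subr_gt0 invf_lt1.
have pq : p^-1 + q^-1 = 1 by rewrite invrK addrC subrK.
pose C := fine (mu setT `^ q^-1)%E.
have CE : (mu setT `^ q^-1)%E = C%:E.
  by rewrite /C fineK// -(fineK mu_fin_num) poweR_EFin.
have C0 : 0 <= C by rewrite -lee_fin -CE poweR_ge0.
exists (C + 1); first by rewrite ltr_wpDl.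
move=> f pf; apply: (@le_trans _ _ (C * Lpnorm mu p f)); last first.
  by rewrite ler_wpM2r ?Lpnorm_ge0// lerDl.
rewrite -lee_fin EFinM -CE -(Lpnorm_EFin (ltW p1))//.
have f1 : f \in Lfun mu 1%:E by exact: Lfun_le (lexx 1) (ltW p1) pf.
rewrite -(Lpnorm_EFin (lexx 1) f1).
have := @hoelder _ _ _ mu f (cst 1) _ _ (Lfun_measurable pf) (measurable_cst _) p0 q0 pq.
rewrite -[(EFin \o cst 1)]/(cst 1%E) Lnorm_cst1 muleC.
by have -> : (f \* cst 1)%R = f by apply/funext => x /=; rewrite mulr1.
Qed.

Lemma Lpnorm_le_cst p f e : 1 <= p -> 0 <= e -> f \in Lfun mu p%:E ->
  (\int[mu]_x (`|f x| `^ p)%:E <= (e `^ p)%:E)%E -> Lpnorm mu p f <= e.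
Proof.
move=> p1 e0 pf; rewrite -(Lpnorm_powR p1 pf) lee_fin.
have p0 : 0 < p by exact: lt_le_trans p1.
by apply: contraTT; rewrite -!ltNge => /gt0_ltr_powR-> //; rewrite nnegrE ?Lpnorm_ge0.
Qed.

(** The Riesz-Fischer argument: the increments of a fast subsequence are summable in L1, hence
    almost everywhere; Fatou's lemma then bounds the distance from [u n] to the limit. *)
Lemma Lp_complete p (u : nat -> T -> R) : 1 <= p ->
  (forall n, u n \in Lfun mu p%:E) ->
  (forall e, 0 < e -> exists n0, forall m n, (n0 <= m)%N -> (n0 <= n)%N ->
    Lpnorm mu p (u m \- u n) <= e) ->
  exists2 l, l \in Lfun mu p%:E & forall e, 0 < e -> exists n0, forall n,
    (n0 <= n)%N -> Lpnorm mu p (u n \- l) <= e.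
Proof.
move=> p1 pu u_cauchy.
have p0 : 0 < p by exact: lt_le_trans p1.
have [C C0 C_le] := Lpnorm1_le p1.
have /choice[N NP] : forall k : nat, exists n0, forall m n,
    (n0 <= m)%N -> (n0 <= n)%N -> Lpnorm mu p (u m \- u n) <= (2 ^ k.+1)%:R^-1.
  by move=> k; apply: u_cauchy; rewrite invr_gt0 ltr0n expn_gt0.
(* Partial sums of [N i + 1] are strictly increasing indices, and the [k]-th exceeds [N k]. *)
pose v k := u (\sum_(i < k.+1) (N i).+1)%N.
have mv k : measurable_fun setT (v k) by exact: Lfun_measurable (pu _).
have v_le k : Lpnorm mu p (v k.+1 \- v k) <= (2 ^ k.+1)%:R^-1.
  by apply: NP; rewrite !big_ord_recr/=; lia.
pose g k x := `|v k.+1 x - v k x|%:E.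
have mg k : measurable_fun setT (g k).
  by apply/measurable_EFinP/measurableT_comp => //; exact: measurable_funB.
have g_le k : (\int[mu]_x g k x <= (C / (2 ^ k.+1)%:R)%:E)%E.
  have pvk : v k.+1 \- v k \in Lfun mu p%:E by apply: LfunB => //; exact: pu.
  have -> : (\int[mu]_x g k x = (Lpnorm mu 1 (v k.+1 \- v k))%:E)%E.
    by rewrite -(Lpnorm_EFin (lexx 1)) ?Lnorm1// (Lfun_le (lexx 1) p1 pvk).
  rewrite lee_fin; apply: le_trans (C_le _ pvk) _.
  by rewrite ler_pM2l.
have sum_g : (\int[mu]_x (\sum_(k <oo) g k x) < +oo)%E.
  rewrite integral_nneseries//; last by move=> k x _; rewrite lee_fin.
  apply: (@le_lt_trans _ _ C%:E); last exact: ltry.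
  apply: le_trans (epsilon_trick0 xpredT (ltW C0)).
  apply: lee_nneseries => k *; last exact: g_le.
  by apply: integral_ge0 => x _; rewrite lee_fin.
have v_cvg : {ae mu, forall x, cvgn (v ^~ x)}.
  have /integrable_ae : mu.-integrable setT (fun x => \sum_(k <oo) g k x)%E.
    apply/integrableP; split.
      by apply: ge0_emeasurable_sum => // k x _ _; rewrite lee_fin.
    under eq_integral => x _.
      rewrite gee0_abs; first over.
      by apply: nneseries_ge0 => k _ _; rewrite lee_fin.
    exact: sum_g.
  move=> /(_ measurableT); apply: filterS => x /(_ I) gx.
  suff : cvgn (series (telescope (v ^~ x))).
    rewrite telescopeK => vx.
    rewrite (_ : v ^~ x = (fun n => (v n x - v 0 x) + v 0 x)); last first.
      by apply/funext => n; rewrite subrK.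
    by apply: is_cvgD => //; exact: is_cvg_cst.
  apply: normed_cvg; apply: nondecreasing_is_cvgn.
    by apply: nondecreasing_series => n *; exact: normr_ge0.
  exists (fine (\sum_(k <oo) g k x)%E) => _ [n _ <-].
  rewrite -lee_fin fineK//= /series/= -sumEFin.
  by apply: nneseries_lim_ge.
(* The upper limit is measurable on the whole space and agrees with the limit wherever that
   exists. *)
pose l x := fine (limn_esup (fun k => (v k x)%:E)).
have ml : measurable_fun setT l.
  apply: measurableT_comp => //; apply: measurable_fun_limn_esup => k.
  exact/measurable_EFinP.
have v_l : {ae mu, forall x, v ^~ x @ \oo --> l x}.
  apply: filterS v_cvg => x vx.
  suff <- : limn (v ^~ x) = l x by [].
  have vxE : (v k x)%:E @[k --> \oo] --> (limn (v ^~ x))%:E.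
    by apply: cvg_EFin => //; exact: nearW.
  by rewrite /l (cvg_limn_einf_sup vxE).2.
have u_l e : 0 < e -> exists n0, forall n, (n0 <= n)%N ->
    (\int[mu]_x (`|u n x - l x| `^ p)%:E <= (e `^ p)%:E)%E.
  move=> e0; have [n0 n0P] := u_cauchy e e0.
  exists n0 => n n0n.
  have [K n0K] : exists K, forall k, (n0 <= \sum_(i < (k + K).+1) (N i).+1)%N.
    exists n0 => k; apply: (@leq_trans (\sum_(i < (k + n0).+1) 1)%N).
      by rewrite sum1_card card_ord; lia.
    exact: leq_sum.
  pose h k x := (`|u n x - v (k + K)%N x| `^ p)%:E.
  have mh k : measurable_fun setT (h k).
    by apply: measurable_abs_powR; apply: measurable_funB => //; exact: Lfun_measurable (pu _).
  have := @fatou _ _ _ mu _ measurableT h mh.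
  have h0 k x : setT x -> (0 <= h k x)%E by move=> _; rewrite lee_fin powR_ge0.
  move=> /(_ h0) h_fatou.
  have h_le k : (\int[mu]_x h k x <= (e `^ p)%:E)%E.
    have pk : u n \- v (k + K)%N \in Lfun mu p%:E by apply: LfunB => //; exact: pu.
    rewrite -[X in (X <= _)%E](Lpnorm_powR p1 pk) lee_fin.
    by rewrite ge0_ler_powR ?nnegrE ?Lpnorm_ge0// ?n0P// ltW.
  apply: (@le_trans _ _ (limn_einf (fun k => \int[mu]_x h k x))%E); last first.
    rewrite limn_einf_lim; apply: lime_le; first exact: is_cvg_einfs.
    apply: nearW => k; apply: le_trans (h_le k).
    by apply: ereal_inf_lbound; exists k => /=.
  apply: le_trans h_fatou.
  apply: ae_ge0_le_integral => //.
  - by apply: measurable_abs_powR; apply: measurable_funB => //; exact: Lfun_measurable (pu _).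
  - move=> x _; rewrite limn_einf_lim; apply: lime_ge; first exact: is_cvg_einfs.
    by apply: nearW => k; apply: le_ereal_inf_tmp => _ [m _ <-]; exact: h0.
  - have -> : (fun x => limn_einf (h ^~ x)) = (fun x => - limn_esup (fun k => - h k x))%E.
      by apply/funext => x; rewrite (limn_esupN (h ^~ x)) oppeK.
    apply: measurableT_comp => //; apply: measurable_fun_limn_esup => k.
    exact: measurableT_comp.
  - apply: filterS v_l => x vx _.
    have hx : h k x @[k --> \oo] --> (`|u n x - l x| `^ p)%:E.
      apply: cvg_EFin; first exact: nearW.
      apply: cvg_powR => //; apply: cvg_norm; apply: cvgB; first exact: cvg_cst.
      by rewrite (cvg_shiftn K (v ^~ x)).
    by rewrite (cvg_limn_einf_sup hx).1.
have pl : l \in Lfun mu p%:E.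
  have [n0 /(_ n0 (leqnn _)) h] := u_l 1 ltr01.
  rewrite (_ : l = u n0 \- (u n0 \- l)); last by apply/funext => x /=; ring.
  apply: LfunB => //; apply/(Lfun_powRP _ p1); split.
    by apply: measurable_funB => //; exact: Lfun_measurable (pu _).
  by apply: le_lt_trans h _; exact: ltry.
exists l => // e e0; have [n0 n0P] := u_l e e0.
exists n0 => n /n0P; apply: Lpnorm_le_cst => //; first exact: ltW.
exact: LfunB.
Qed.

(** Dominated convergence for [f] cut to 0 where it is large. The last clause provides nonnegative
    approximations for the proof of positivity. *)
Lemma Lp_bounded_dense p f e : 1 <= p -> 0 < e -> f \in Lfun mu p%:E ->
  exists g M, [/\ measurable_fun setT g, forall x, `|g x| <= M,
    Lpnorm mu p (f \- g) <= e & forall x, 0 <= f x -> 0 <= g x].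
Proof.
move=> p1 e0 pf; have mf := Lfun_measurable pf.
have p0 : 0 < p by exact: lt_le_trans p1.
pose g (n : nat) x := if `|f x| <= n%:R then f x else 0.
have mg n : measurable_fun setT (g n).
  apply: measurable_fun_ifT => //.
  by apply: measurable_fun_ler => //; exact: measurableT_comp.
have fg_le n x : `|f x - g n x| <= `|f x|.
  by rewrite /g; case: ifP => _; rewrite ?subr0// subrr normr0.
pose h n x := (`|f x - g n x| `^ p)%:E.
have h0 : {ae mu, forall x, setT x -> h ^~ x @ \oo --> cst 0%E x}.
  apply: aeW => x _; apply: cvg_near_cst.
  near=> n; rewrite /h /g ifT; last by near: n; exact: nbhs_infty_ger.
  by rewrite subrr normr0 powR0// gt_eqF.
have h_le : {ae mu, forall x n, setT x -> (`|h n x| <= (`|f x| `^ p)%:E)%E}.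
  apply: aeW => x n _; rewrite gee0_abs ?lee_fin ?powR_ge0//.
  by rewrite ge0_ler_powR ?nnegrE// ltW.
have mh n := measurable_abs_powR p (measurable_funB mf (mg n)).
have [_ _] := dominated_convergence measurableT mh (measurable_cst _) h0
  (Lfun_integrable p1 pf) h_le.
rewrite integral0 => /fine_cvgP[/= fin_int].
move=> /cvgr0Pnorm_le/(_ _ (powR_gt0 p e0)) int_le.
near \oo => n; exists (g n), n%:R; split => //.
- by move=> x; rewrite /g; case: ifP => //; rewrite normr0.
- have [pfg _] := Lfun_dominated p1 (measurable_funB mf (mg n)) pf (fg_le n).
  apply: Lpnorm_le_cst => //; first exact: ltW.
  have fn : (\int[mu]_x (`|f x - g n x| `^ p)%:E)%E \is a fin_num by near: n.
  rewrite -(fineK fn) lee_fin.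
  by apply: le_trans (ler_norm _) _; near: n.
- by move=> x fx; rewrite /g; case: ifP.
Unshelve. all: by end_near. Qed.


End Lp_finite_measure.

(** * Extension of semigroups from L2 to Lp *)

Lemma Lp_semigroup_dist {R : realType} d (T : measurableType d)
    (mu : {measure set T -> \bar R}) (p t : R) S (f g : T -> R) : 1 <= p ->
  Lp_contraction_semigroup mu p S -> 0 <= t ->
  f \in Lfun mu p%:E -> g \in Lfun mu p%:E ->
  Lpnorm mu p (S t f \- S t g) <= Lpnorm mu p (f \- g).
Proof.
move=> p1 S_semi t0 pf pg; have S_op := Lp_semigroup_op S_semi t0.
have pS h : h \in Lfun mu p%:E -> S t h \in Lfun mu p%:E.
  exact: (Lp_operator_mem S_op).
have ph : (fun x => -1 * g x + f x) \in Lfun mu p%:E.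
  exact: LfunD (LfunZ p1 (-1) pg) pf.
have -> : f \- g = fun x => -1 * g x + f x by apply/funext => x /=; ring.
have := Lp_semigroup_contr S_semi t0 ph; rewrite !Lpnorm_EFin ?pS// lee_fin.
apply: le_trans; have pd := LfunB p1 (pS _ pf) (pS _ pg).
apply: (Lfun_ae_dominated p1 (Lfun_measurable pd) (pS _ ph) _).2.
apply: filterS (Lp_operator_linear S_op (-1) pg pf) => x /(_ I) /= ->.
by rewrite mulN1r addrC.
Qed.

Section semigroup_extension.
Context {R : realType} d (T : measurableType d).
Variable mu : {measure set T -> \bar R}.
Hypothesis mu_fin : (mu setT < +oo)%E.
Variable T2 : R -> (T -> R) -> T -> R.
Hypothesis T2_semi : Lp_contraction_semigroup mu 2 T2.
Hypothesis T2_cont : Lp_strongly_continuous mu 2 T2.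
Hypothesis T2_L1_contr : forall f (t c : R), f \in Lfun mu 2%:E -> 0 <= t ->
  Lpnorm mu 1 (fun x => T2 t f x - c) <= Lpnorm mu 1 (fun x => f x - c).
Implicit Types (f g l : T -> R) (t s p : R).

Local Notation L1 := (Lfun mu 1%:E).
Local Notation L2 := (Lfun mu 2%:E).
Local Notation dist1 f g := (Lpnorm mu 1 (f \- g)).

Let le11 : 1 <= 1 :> R. Proof. exact: lexx. Qed.
Let le12 : 1 <= 2 :> R. Proof. by rewrite ler1n. Qed.

Let L21 f : f \in L2 -> f \in L1.
Proof. exact: Lfun_le. Qed.

Let T2_mem t f : 0 <= t -> f \in L2 -> T2 t f \in L2.
Proof. by move=> t0; exact: (Lp_operator_mem (Lp_semigroup_op T2_semi t0)). Qed.

Let cst2 (c : R) : cst c \in L2. Proof. exact: Lfun_cst_fin. Qed.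

Let cst1 (c : R) : cst c \in L1. Proof. exact: Lfun_cst_fin. Qed.

Lemma le_addgt0_mul (a b C : R) : (forall e, 0 < e -> a <= b + C * e) -> a <= b.
Proof.
move=> h; apply/ler_addgt0Pr => e e0.
have C0 : 0 < `|C| + 1 by rewrite ltr_wpDl.
apply: le_trans (h (e / (`|C| + 1)) _) _; first exact: divr_gt0.
rewrite lerD2l mulrA ler_pdivrMr// mulrC ler_pM2l//.
by rewrite (le_trans (ler_norm _))// lerDl.
Qed.

Lemma T2_dist1 t f g : 0 <= t -> f \in L2 -> g \in L2 ->
  dist1 (T2 t f) (T2 t g) <= dist1 f g.
Proof.
move=> t0 f2 g2; have T2op := Lp_semigroup_op T2_semi t0.
pose h x := -1 * g x + f x.
have h2 : h \in L2 by exact: LfunD (LfunZ _ _ g2) f2.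
have hE : f \- g = (fun x => h x - 0) by apply/funext => x; rewrite /h /=; ring.
rewrite hE; apply: le_trans (T2_L1_contr 0 h2 t0).
have Th2 := T2_mem t0 h2.
apply: (Lfun_ae_dominated le11 _ (LfunB le11 (L21 Th2) (cst1 0)) _).2.
  by apply: measurable_funB; apply: Lfun_measurable (T2_mem t0 _).
apply: filterS (Lp_operator_linear T2op (-1) g2 f2) => x /(_ I) /= ->.
by rewrite subr0 mulN1r addrC.
Qed.

Let boundedL p f M : 1 <= p -> measurable_fun setT f ->
  (forall x, `|f x| <= M) -> f \in Lfun mu p%:E.
Proof. exact: Lfun_bounded. Qed.

(** [l] is the L1 limit of [T2 t (g n)] for bounded [g n] tending to [f]; the sequence is Cauchy
    because [T2 t] is nonexpansive in L1. The conclusion does not mention the approximating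
    sequence, so a later choice of [l] for every [f] is coherent. *)
Lemma L1_extension_exists t f : 0 <= t -> f \in L1 ->
  exists l, l \in L1 /\ forall g, g \in L2 -> dist1 l (T2 t g) <= dist1 f g.
Proof.
move=> t0 f1.
have /choice[g gP] : forall n : nat, exists g, g \in L2 /\ dist1 f g <= n.+1%:R^-1.
  move=> n; have n0 : 0 < n.+1%:R^-1 :> R by rewrite invr_gt0.
  have [g [M [mg gM fg _]]] := Lp_bounded_dense le11 n0 f1.
  by exists g; split => //; exact: boundedL gM.
have g2 n := (gP n).1; have gf n := (gP n).2.
have Tg1 n : T2 t (g n) \in L1 by exact/L21/T2_mem.
have f_g n h : h \in L2 -> dist1 (T2 t (g n)) (T2 t h) <= n.+1%:R^-1 + dist1 f h.
  move=> h2; apply: le_trans (T2_dist1 t0 (g2 n) h2) _.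
  apply: le_trans (Lpnorm_dist le11 (L21 (g2 n)) f1 (L21 h2)) _.
  by rewrite lerD2r LpnormBC.
have inv_small e : 0 < e -> exists n0, forall n, (n0 <= n)%N -> n.+1%:R^-1 <= e :> R.
  move=> e0; have [n0 _ n0P] := near_infty_natSinv_lt (PosNum e0).
  by exists n0 => n /n0P /ltW.
have [e e0|l l1 lP] := Lp_complete mu_fin le11 Tg1.
  have [n0 n0P] := inv_small (e / 2) (divr_gt0 e0 (ltr0n _ 2)).
  exists n0 => m n m0 n0'; apply: le_trans (f_g _ _ (g2 n)) _.
  by rewrite [leRHS]splitr lerD// ?n0P// (le_trans (gf n))// n0P.
exists l; split=> // h h2; apply: (@le_addgt0_mul _ _ 2) => e e0.
have [n0 n0P] := lP e e0; have [n1 n1P] := inv_small e e0.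
pose n := (n0 + n1)%N.
have := n0P n (leq_addr _ _).
have : dist1 (T2 t (g n)) (T2 t h) <= e + dist1 f h.
  by apply: le_trans (f_g n h h2) _; rewrite lerD2r n1P// leq_addl.
have := Lpnorm_dist le11 l1 (Tg1 n) (L21 (T2_mem t0 h2)).
by rewrite (LpnormBC mu 1 l (T2 t (g n))); lra.
Qed.

(* The estimate in [T1_T2_dist] determines [T1] on [L1] up to equality almost
   everywhere, [L2] being dense in [L1]. *)
Variable T1 : R -> (T -> R) -> T -> R.
Hypothesis T1_mem : forall t f, 0 <= t -> f \in L1 -> T1 t f \in L1.
Hypothesis T1_T2_dist : forall t f g, 0 <= t -> f \in L1 -> g \in L2 ->
  dist1 (T1 t f) (T2 t g) <= dist1 f g.

Let dist1_0 f : dist1 f f = 0.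
Proof.
have -> : f \- f = cst 0 by apply/funext => x /=; rewrite subrr.
by rewrite /Lpnorm -[_ \o _]/(cst 0%E) Lnorm0.
Qed.

Let dist1_ae f g : f \in L1 -> g \in L1 -> dist1 f g <= 0 -> f = g %[ae mu].
Proof.
move=> f1 g1 fg; apply: (Lpnorm_eq0_dist le11) => //.
by apply/eqP; rewrite eq_le fg Lpnorm_ge0.
Qed.

Let dist1_dist g f h : f \in L1 -> g \in L1 -> h \in L1 ->
  dist1 f h <= dist1 f g + dist1 g h.
Proof. exact: Lpnorm_dist. Qed.

Lemma T1_T2 t f : 0 <= t -> f \in L2 -> T1 t f = T2 t f %[ae mu].
Proof.
move=> t0 f2; apply: dist1_ae; [exact/T1_mem/L21|exact/L21/T2_mem|].
by apply: le_trans (T1_T2_dist t0 (L21 f2) f2) _; rewrite dist1_0.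
Qed.

Let approx1 f e : 0 < e -> f \in L1 -> exists2 g, g \in L2 & dist1 f g <= e.
Proof.
move=> e0 f1; have [g [M [mg gM fg _]]] := Lp_bounded_dense le11 e0 f1.
by exists g => //; exact: boundedL gM.
Qed.

Lemma T1_dist t f g : 0 <= t -> f \in L1 -> g \in L1 ->
  dist1 (T1 t f) (T1 t g) <= dist1 f g.
Proof.
move=> t0 f1 g1; apply: (@le_addgt0_mul _ _ 2) => e e0.
have [h h2 gh] := approx1 e0 g1.
have := T1_T2_dist t0 f1 h2; have := T1_T2_dist t0 g1 h2.
have := dist1_dist (T1_mem t0 f1) (L21 (T2_mem t0 h2)) (T1_mem t0 g1).
have := dist1_dist f1 g1 (L21 h2).
by rewrite (LpnormBC mu 1 (T1 t g)); lra.
Qed.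

Lemma T1_ae t f g : 0 <= t -> f \in L1 -> g \in L1 ->
  f = g %[ae mu] -> T1 t f = T1 t g %[ae mu].
Proof.
move=> t0 f1 g1 fg; apply: dist1_ae; [exact: T1_mem..|].
by rewrite (le_trans (T1_dist _ _ _))// (ae_eq_Lpnorm_dist le11).
Qed.

Lemma T1_linear t (a : R) f g : 0 <= t -> f \in L1 -> g \in L1 ->
  T1 t (fun x => a * f x + g x) = (fun x => a * T1 t f x + T1 t g x) %[ae mu].
Proof.
move=> t0 f1 g1.
have lin1 u v : u \in L1 -> v \in L1 -> (fun x => a * u x + v x) \in L1.
  by move=> u1 v1; apply: (LfunD le11) => //; exact: LfunZ.
have lin_dist u v u' v' : u \in L1 -> v \in L1 -> u' \in L1 -> v' \in L1 ->
    dist1 (fun x => a * u x + v x) (fun x => a * u' x + v' x) <=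
    `|a| * dist1 u u' + dist1 v v'.
  move=> u1 v1 u1' v1'; have uu := LfunB le11 u1 u1'; have vv := LfunB le11 v1 v1'.
  rewrite -LpnormZ//; apply: le_trans (LpnormD le11 (LfunZ le11 a uu) vv).
  rewrite le_eqVlt; apply/orP; left; apply/eqP; congr (Lpnorm mu 1).
  by apply/funext => x /=; ring.
apply: dist1_ae; [exact/T1_mem/lin1|exact: lin1 (T1_mem t0 f1) (T1_mem t0 g1)|].
apply: (@le_addgt0_mul _ _ (2 * (`|a| + 1))) => e e0; rewrite add0r.
have [u u2 fu] := approx1 e0 f1; have [v v2 gv] := approx1 e0 g1.
have auv2 : (fun x => a * u x + v x) \in L2.
  by apply: (LfunD le12) => //; exact: LfunZ.
have d1 := lin_dist _ _ _ _ f1 g1 (L21 u2) (L21 v2).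
have d2 := lin_dist _ _ _ _ (T1_mem t0 f1) (T1_mem t0 g1)
  (L21 (T2_mem t0 u2)) (L21 (T2_mem t0 v2)).
have d3 := T1_T2_dist t0 (lin1 _ _ f1 g1) auv2.
have d4 := T1_T2_dist t0 f1 u2; have d5 := T1_T2_dist t0 g1 v2.
have Tauv1 := L21 (T2_mem t0 auv2).
have aTuv1 := lin1 _ _ (L21 (T2_mem t0 u2)) (L21 (T2_mem t0 v2)).
have d6 : dist1 (T2 t (fun x => a * u x + v x)) (fun x => a * T2 t u x + T2 t v x) = 0.
  apply: (ae_eq_Lpnorm_dist le11) => //.
  exact: (Lp_operator_linear (Lp_semigroup_op T2_semi t0)).
have := dist1_dist (T1_mem t0 (lin1 _ _ f1 g1)) Tauv1
  (lin1 _ _ (T1_mem t0 f1) (T1_mem t0 g1)).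
have := dist1_dist Tauv1 aTuv1 (lin1 _ _ (T1_mem t0 f1) (T1_mem t0 g1)).
rewrite (LpnormBC mu 1 (fun x => a * T2 t u x + _)) d6.
have aa : `|a| * dist1 f u <= `|a| * e by rewrite ler_wpM2l.
have aT : `|a| * dist1 (T1 t f) (T2 t u) <= `|a| * e.
  by rewrite ler_wpM2l// (le_trans d4).
by lra.
Qed.

Lemma T1_0 f : f \in L1 -> T1 0 f = f %[ae mu].
Proof.
move=> f1; apply: dist1_ae => //; first exact: T1_mem.
apply: (@le_addgt0_mul _ _ 2) => e e0; have [g g2 fg] := approx1 e0 f1.
have T0g : dist1 (T2 0 g) g = 0.
  apply: (ae_eq_Lpnorm_dist le11); [exact/L21/T2_mem|exact: L21|].
  exact: (Lp_semigroup0 T2_semi).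
have := T1_T2_dist (lexx 0) f1 g2.
have := dist1_dist (T1_mem (lexx 0) f1) (L21 (T2_mem (lexx 0) g2)) f1.
have := dist1_dist (L21 (T2_mem (lexx 0) g2)) (L21 g2) f1.
by rewrite (LpnormBC mu 1 g) T0g; lra.
Qed.

Lemma T1_D s t f : 0 <= s -> 0 <= t -> f \in L1 ->
  T1 (s + t) f = T1 s (T1 t f) %[ae mu].
Proof.
move=> s0 t0 f1; have st0 := addr_ge0 s0 t0.
apply: dist1_ae; [exact: T1_mem|exact/T1_mem/T1_mem|].
apply: (@le_addgt0_mul _ _ 2) => e e0; have [g g2 fg] := approx1 e0 f1.
have Tg : dist1 (T2 (s + t) g) (T2 s (T2 t g)) = 0.
  apply: (ae_eq_Lpnorm_dist le11); [exact/L21/T2_mem|exact/L21/T2_mem/T2_mem|].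
  exact: (Lp_semigroupD T2_semi).
have T1f := T1_mem t0 f1; have T2g := T2_mem t0 g2.
have := T1_T2_dist st0 f1 g2; have := T1_T2_dist t0 f1 g2.
have := T1_T2_dist s0 T1f T2g.
have := dist1_dist (T1_mem st0 f1) (L21 (T2_mem st0 g2)) (T1_mem s0 T1f).
have := dist1_dist (L21 (T2_mem st0 g2)) (L21 (T2_mem s0 T2g)) (T1_mem s0 T1f).
by rewrite (LpnormBC mu 1 (T2 s _)) Tg; lra.
Qed.

Lemma T1_cst t (c : R) : 0 <= t -> T1 t (cst c) = cst c %[ae mu].
Proof.
move=> t0; have := T2_L1_contr c (cst2 c) t0.
have -> : (fun x : T => cst c x - c) = cst c \- cst c by [].
rewrite dist1_0 => /(dist1_ae (L21 (T2_mem t0 (cst2 c))) (cst1 c)) Tc.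
by apply: filterS2 Tc (T1_T2 t0 (cst2 c)) => x h1 h2 xT; rewrite h2// h1.
Qed.

(* The integral of [|T2 f| + |T2 f - M|] is at most that of [f + (M - f) = M],
   which forces equality in the triangle inequality. *)
Lemma T2_bounded_ge0 t f M : 0 <= t -> measurable_fun setT f ->
  (forall x, 0 <= f x <= M) -> {ae mu, forall x, 0 <= T2 t f x}.
Proof.
move=> t0 mf fM.
have f2 : f \in L2.
  by apply: (@boundedL _ _ M) => // x; have /andP[f0] := fM x; rewrite ger0_norm.
have Tf1 := L21 (T2_mem t0 f2); have f1 := L21 f2.
pose h x := `|T2 t f x| + `|T2 t f x - M| - `|M|.
have aTf1 := Lfun_abs le11 Tf1.
have aTfM1 := Lfun_abs le11 (LfunB le11 Tf1 (cst1 M)).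
have h1 : h \in L1 by exact: LfunB (LfunD le11 aTf1 aTfM1) (cst1 _).
have h0 x : 0 <= h x.
  rewrite /h subr_ge0 (_ : M = T2 t f x - (T2 t f x - M)); last by ring.
  by rewrite [in X in _ <= X](_ : T2 t f x - (T2 t f x - M) = M) ?ler_normB//; ring.
have hE : h \+ cst `|M| = (fun x => `|T2 t f x|) \+ (fun x => `|T2 t f x - M|).
  by apply/funext => x; rewrite /h /=; ring.
have := Lpnorm1D h1 (cst1 `|M|) h0 (fun=> normr_ge0 M).
rewrite hE Lpnorm1D// Lpnorm_abs (Lpnorm_abs mu 1 (fun x => T2 t f x - M)).
have := T2_L1_contr 0 f2 t0; have := T2_L1_contr M f2 t0.
have -> : (fun x => T2 t f x - 0) = T2 t f by apply/funext => x; rewrite subr0.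
have -> : (fun x => f x - 0) = f by apply/funext => x; rewrite subr0.
have fM1 : (fun x => M - f x) \in L1 by exact: LfunB (cst1 M) f1.
have f0 x : 0 <= f x by have /andP[] := fM x.
have fM0 x : 0 <= M - f x by rewrite subr_ge0; have /andP[] := fM x.
have := Lpnorm1D f1 fM1 f0 fM0.
have -> : f \+ (fun x => M - f x) = cst M by apply/funext => x /=; ring.
rewrite -(Lpnorm_abs mu 1 (cst M)) (LpnormBC mu 1 (cst M)) => e1 e2 e3 e4.
have {e1 e2 e3 e4} : Lpnorm mu 1 h <= 0 by move: e1 e2 e3 e4 => /=; lra.
have -> : Lpnorm mu 1 h = dist1 h (cst 0).
  by congr Lpnorm; apply/funext => x /=; rewrite subr0.
move=> /(dist1_ae h1 (cst1 0)); apply: filterS => x /(_ I).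
have := fM0 x; have := f0 x; rewrite /h /= => fx0 fxM.
rewrite (@ger0_norm _ M); last lra.
have [//|Tf_lt0] := leP 0 (T2 t f x).
by rewrite !ltr0_norm//; lra.
Qed.

Lemma T1_ge0 t f : 0 <= t -> f \in L1 ->
  {ae mu, forall x, 0 <= f x} -> {ae mu, forall x, 0 <= T1 t f x}.
Proof.
move=> t0 f1 f0; have af1 := Lfun_abs le11 f1.
have f_af : f = (fun x => `|f x|) %[ae mu].
  by apply: filterS f0 => x fx0 _; rewrite ger0_norm.
(* [h] is twice the negative part of [T1 t |f|], hence at most twice the distance to any nonnegative
   function such as [T2 t g]. *)
pose h x := `|T1 t (fun y => `|f y|) x| - T1 t (fun y => `|f y|) x.
have Taf1 := T1_mem t0 af1.
have h1 : h \in L1 by exact: LfunB (Lfun_abs le11 Taf1) Taf1.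
have : dist1 h (cst 0) <= 0.
  apply: (@le_addgt0_mul _ _ 2) => e e0; rewrite add0r.
  have [g [M [mg gM fg g0]]] := Lp_bounded_dense le11 e0 af1.
  have g2 : g \in L2 by exact: boundedL gM.
  have Tg0 : {ae mu, forall x, 0 <= T2 t g x}.
    apply: (@T2_bounded_ge0 _ _ M) => // x.
    by rewrite g0//= (le_trans (ler_norm _)).
  have d1 := LfunB le11 Taf1 (L21 (T2_mem t0 g2)).
  have d2 := LfunZ le11 2 d1.
  have mh : measurable_fun setT (h \- cst 0).
    exact: Lfun_measurable (LfunB le11 h1 (cst1 0)).
  apply: le_trans (Lfun_ae_dominated le11 mh d2 _).2 _; last first.
    rewrite (LpnormZ le11 2 d1) ger0_norm// ler_pM2l//.
    by apply: le_trans (T1_T2_dist t0 af1 g2) _.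
  apply: filterS Tg0 => x /=; rewrite /h subr0; set u := T1 t _ x; set v := T2 t g x => v0.
  have au : 0 <= `|u| - u by rewrite subr_ge0 ler_norm.
  rewrite [leRHS]normrM (@ger0_norm _ 2)// (ger0_norm au).
  have := ler_norm (v - u); rewrite distrC.
  have uv0 := normr_ge0 (u - v).
  have [u0|u0] := leP 0 u; first by rewrite (ger0_norm u0); lra.
  by rewrite (ltr0_norm u0); lra.
move=> /(dist1_ae h1 (cst1 0)) hE.
apply: filterS2 hE (T1_ae t0 f1 af1 f_af) => x /(_ I) hx /(_ I) ->.
by move: hx => /eqP; rewrite subr_eq0 => /eqP <-.
Qed.

Lemma T1_le_abs t f : 0 <= t -> f \in L1 ->
  {ae mu, forall x, `|T1 t f x| <= T1 t (fun y => `|f y|) x}.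
Proof.
move=> t0 f1; have af1 := Lfun_abs le11 f1.
have pos (a : R) : `|a| = 1 -> {ae mu, forall x, 0 <= a * T1 t f x + T1 t (fun y => `|f y|) x}.
  move=> a1; have h1 : (fun x => a * f x + `|f x|) \in L1.
    exact: LfunD (LfunZ le11 a f1) af1.
  have h0 : {ae mu, forall x, 0 <= a * f x + `|f x|}.
    apply: aeW => x; have := ler_norm (- (a * f x)).
    by rewrite normrN normrM a1 mul1r; lra.
  by apply: filterS2 (T1_ge0 t0 h1 h0) (T1_linear a t0 f1 af1) => x /[swap] /(_ I) /= ->.
have := pos _ (normr1 R); have := pos (-1) (etrans (normrN 1) (normr1 R)).
by apply: filterS2 => x h1 h2; rewrite ler_norml; apply/andP; split; lra.
Qed.

(** Young's inequality for [a] and [r^(p - 1)] with exponents [p] and [p / (p - 1)]: the graph of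
    [a^p] lies above its tangent at [r]. *)
Lemma young_tangent p (r a : R) : 1 <= p -> 0 <= r -> 0 <= a ->
  p * r `^ (p - 1) * a <= a `^ p + (p - 1) * r `^ p.
Proof.
rewrite le_eqVlt => /predU1P[<- r0 a0|p1 r0 a0].
  by rewrite subrr powRr0 powRr1// mul0r addr0 !mul1r.
have p0 : 0 < p by exact: lt_trans p1.
have q0 : 0 < p / (p - 1) by rewrite divr_gt0// subr_gt0.
have pq : p^-1 + (p / (p - 1))^-1 = 1.
  by field; rewrite !gt_eqF ?subr_gt0.
have := conjugate_powR a0 (powR_ge0 r (p - 1)) p0 q0 pq.
rewrite -powRrM mulrCA divff ?mulr1; last by rewrite gt_eqF ?subr_gt0.
rewrite -(ler_pM2l p0); move=> /le_trans; rewrite mulrAC -mulrA; apply.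
rewrite le_eqVlt; apply/orP; left; apply/eqP; field.
by rewrite !gt_eqF ?subr_gt0.
Qed.

(* Jensen's inequality [(T1 |f|)^p <= T1 (|f|^p)], obtained from the tangents to
   [s |-> s^p] at the nonnegative rationals. *)
Lemma T1_Lp_contr t f p : 0 <= t -> 1 <= p -> f \in Lfun mu p%:E ->
  T1 t f \in Lfun mu p%:E /\ Lpnorm mu p (T1 t f) <= Lpnorm mu p f.
Proof.
move=> t0 p1 pf; have p0 : 0 < p by exact: lt_le_trans p1.
have f1 : f \in L1 by exact: Lfun_le pf.
pose a x := `|f x|; pose b x := `|f x| `^ p.
have a1 : a \in L1 by exact: Lfun_abs.
have b1 : b \in L1 by exact: Lfun1_powR.
have tangent (r : R) : 0 <= r -> {ae mu, forall x,
    p * r `^ (p - 1) * T1 t a x <= T1 t b x + (p - 1) * r `^ p}.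
  move=> r0; set k := p * _; set m := _ * r `^ p.
  have bm1 : (fun x => 1 * b x + cst m x) \in L1.
    exact: LfunD (LfunZ le11 1 b1) (cst1 m).
  have w1 : (fun x => - k * a x + (1 * b x + cst m x)) \in L1.
    exact: LfunD (LfunZ le11 (- k) a1) bm1.
  have w0 : {ae mu, forall x, 0 <= - k * a x + (1 * b x + cst m x)}.
    apply: aeW => x; rewrite mul1r mulNr addrC subr_ge0.
    exact: (young_tangent p1 r0 (normr_ge0 (f x))).
  have := T1_linear (- k) t0 a1 bm1; have := T1_linear 1 t0 b1 (cst1 m).
  apply: filterS3 (filterI (T1_ge0 t0 w1 w0) (T1_cst m t0)) => x [+ h1] h2 h3.
  by rewrite h3// h2// h1// mul1r mulNr addrC subr_ge0.
(* Only countably many tangents are used, so that one null set serves all; [odflt 0] covers the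
   numbers that code no rational. *)
have {}tangent : {ae mu, forall x (n : nat), 0 <= (odflt 0 (choice.unpickle n) : rat) ->
    p * (ratr (odflt 0 (choice.unpickle n)) : R) `^ (p - 1) * T1 t a x <=
    T1 t b x + (p - 1) * (ratr (odflt 0 (choice.unpickle n)) : R) `^ p}.
  apply: ae_foralln => n.
  have [q0|q0] := boolP (0 <= (odflt 0 (choice.unpickle n) : rat)); last exact: aeW.
  by apply: filterS (tangent (ratr (odflt 0 (choice.unpickle n))) _) => //; rewrite ler0q.
have T_le : {ae mu, forall x, `|T1 t f x| `^ p <= `|T1 t b x|}.
  have b0 : {ae mu, forall x, 0 <= b x} by apply: aeW => x; exact: powR_ge0.
  apply: filterS3 tangent (T1_le_abs t0 f1) (T1_ge0 t0 b1 b0) => x tan Tfa Tb0.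
  rewrite -/a in Tfa; rewrite (ger0_norm Tb0).
  have Ta0 := le_trans (normr_ge0 _) Tfa.
  apply: (@le_trans _ _ (T1 t a x `^ p)); first by rewrite ge0_ler_powR ?nnegrE// ltW.
  (* Otherwise a rational [q] lies strictly between [(T1 b)^(1/p)] and [T1 a], and the tangent at
     [q] gives [p q^p < p q^(p-1) T1 a <= T1 b + (p - 1) q^p < p q^p]. *)
  rewrite leNgt; apply/negP => lt_b.
  have : T1 t b x `^ p^-1 < T1 t a x.
    rewrite -[ltRHS](powRr1 Ta0) -(@mulfV _ p) ?gt_eqF// powRrM.
    by rewrite gt0_ltr_powR ?nnegrE ?powR_ge0// invr_gt0.
  move=> /rat_in_itvoo[q]; rewrite in_itv/= => /andP[bq qa].
  have q0 : 0 < ratr q :> R by exact: le_lt_trans (powR_ge0 _ _) bq.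
  have q_ge0 : 0 <= q by rewrite -(ler0q R) ltW.
  have := tan (choice.pickle q); rewrite choice.pickleK/= => /(_ q_ge0); apply/negP.
  rewrite -ltNge.
  have bq' : T1 t b x < ratr q `^ p.
    rewrite -[ltLHS](powRr1 Tb0) -(@mulVf _ p) ?gt_eqF// powRrM.
    by rewrite gt0_ltr_powR ?nnegrE ?powR_ge0// ltW.
  have qq : p * ratr q `^ p <= p * ratr q `^ (p - 1) * T1 t a x.
    have -> : ratr q `^ p = ratr q `^ (p - 1) * ratr q :> R.
      rewrite -[X in _ * X](powRr1 (ltW q0)) -powRD ?subrK//.
      by apply/implyP => _; rewrite gt_eqF.
    by rewrite mulrA ler_pM2l ?(ltW qa)// mulr_gt0// powR_gt0.
  by lra.
have Tf1 := T1_mem t0 f1; have Tb1 := T1_mem t0 b1.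
have le_int : (\int[mu]_x (`|T1 t f x| `^ p)%:E <= \int[mu]_x (`|f x| `^ p)%:E)%E.
  apply: (@le_trans _ _ (\int[mu]_x `|T1 t b x|%:E)%E).
    apply: ae_ge0_le_integral => //.
    - exact/measurable_abs_powR/(Lfun_measurable Tf1).
    - by apply/measurable_EFinP/measurableT_comp => //; exact: Lfun_measurable Tb1.
    - by apply: filterS T_le => x h _; rewrite lee_fin.
  rewrite -Lpnorm1_EFin//.
  have -> : (\int[mu]_x (`|f x| `^ p)%:E = (Lpnorm mu 1 b)%:E)%E.
    by rewrite Lpnorm1_EFin//; apply: eq_integral => x _; rewrite (ger0_norm (powR_ge0 _ _)).
  have := T1_dist t0 b1 (cst1 0); rewrite lee_fin.
  have -> : b \- cst 0 = b by apply/funext => x /=; rewrite subr0.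
  apply: le_trans; rewrite le_eqVlt; apply/orP; left; apply/eqP.
  rewrite /Lpnorm; congr fine; apply: ae_eq_Lpnorm => //.
  - exact: Lfun_measurable Tb1.
  - exact: Lfun_measurable (LfunB le11 Tb1 (T1_mem t0 (cst1 0))).
  - by apply: filterS (T1_cst 0 t0) => x /(_ I) h _ /=; rewrite h subr0.
have pTf : T1 t f \in Lfun mu p%:E.
  apply/(Lfun_powRP _ p1); split; first exact: Lfun_measurable Tf1.
  by apply: le_lt_trans le_int _; have /(Lfun_powRP _ p1)[] := pf.
by split => //; exact: Lpnorm_le.
Qed.


Let T1_memp t f p : 0 <= t -> 1 <= p -> f \in Lfun mu p%:E -> T1 t f \in Lfun mu p%:E.
Proof. by move=> t0 p1 pf; exact: (T1_Lp_contr t0 p1 pf).1. Qed.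

Let Lp_L1 f p : 1 <= p -> f \in Lfun mu p%:E -> f \in L1.
Proof. by move=> p1; exact: Lfun_le. Qed.

Lemma T1_Lp_semigroup p : 1 <= p -> Lp_contraction_semigroup mu p T1.
Proof.
move=> p1; split.
- move=> t t0; split.
  + by move=> f; exact: T1_memp.
  + by move=> f g /(Lp_L1 p1) f1 /(Lp_L1 p1) g1; exact: T1_ae.
  + by move=> a f g /(Lp_L1 p1) f1 /(Lp_L1 p1) g1; exact: T1_linear.
- by move=> f /(Lp_L1 p1); exact: T1_0.
- by move=> s t f s0 t0 /(Lp_L1 p1); exact: T1_D.
- move=> t f t0 pf; have [pTf] := T1_Lp_contr t0 p1 pf.
  by rewrite !Lpnorm_EFin// lee_fin.
Qed.

Lemma T1_Lp_dist t f g p : 0 <= t -> 1 <= p -> f \in Lfun mu p%:E ->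
  g \in Lfun mu p%:E -> Lpnorm mu p (T1 t f \- T1 t g) <= Lpnorm mu p (f \- g).
Proof. by move=> t0 p1; exact: (Lp_semigroup_dist p1 (T1_Lp_semigroup p1)). Qed.

(** Positivity applied to [M + f] and [M - f], together with the invariance of constants. *)
Lemma T1_bounded t f M : 0 <= t -> measurable_fun setT f ->
  (forall x, `|f x| <= M) -> {ae mu, forall x, `|T1 t f x| <= M}.
Proof.
move=> t0 mf fM; have f1 : f \in L1 by exact: boundedL fM.
have pos (a : R) : `|a| = 1 -> {ae mu, forall x, 0 <= a * T1 t f x + M}.
  move=> a1.
  have h1 : (fun x => a * f x + cst M x) \in L1.
    exact: LfunD (LfunZ le11 a f1) (cst1 M).
  have h0 : {ae mu, forall x, 0 <= a * f x + cst M x}.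
    apply: aeW => x; have := ler_norm (- (a * f x)).
    by rewrite normrN normrM a1 mul1r /=; have := fM x; lra.
  apply: filterS3 (T1_ge0 t0 h1 h0) (T1_linear a t0 f1 (cst1 M)) (T1_cst M t0).
  by move=> x /[swap] /(_ I) /= -> /[swap] /(_ I) ->.
have := pos _ (normr1 R); have := pos (-1) (etrans (normrN 1) (normr1 R)).
by apply: filterS2 => x h1 h2; rewrite ler_norml; apply/andP; split; lra.
Qed.

(** For bounded [g] the orbit stays bounded, so its Lp continuity follows from L1 continuity, and
    this from L2 continuity since [mu] is finite. Contractivity and density of bounded functions
    give the rest. *)
Lemma T1_strongly_continuous p : 1 <= p -> Lp_strongly_continuous mu p T1.
Proof.
move=> p1 f t0 pf t00; have p0 : 0 < p by exact: lt_le_trans p1.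
have dist_mem g t : 0 <= t -> g \in Lfun mu p%:E ->
    T1 t g \- T1 t0 g \in Lfun mu p%:E.
  by move=> t_ge0 pg; apply: LfunB => //; exact: T1_memp.
have near_ge0 : \forall t \near within [set t | 0 <= t] (nbhs t0), 0 <= t.
  by apply: withinT.
apply/(Lpnorm_cvg0P p1).
  by apply: filterS near_ge0 => t t_ge0; exact: dist_mem.
move=> e e0; have e3 : 0 < e / 3 by rewrite divr_gt0.
have [g [M [mg gM fg _]]] := Lp_bounded_dense p1 e3 pf.
have pg : g \in Lfun mu p%:E by exact: boundedL gM.
have g2 : g \in L2 by exact: boundedL gM.
have [C C0 CP] := Lpnorm1_le mu_fin le12.
have Tg_cont := T2_cont g2 t00.
have dist2_mem t : 0 <= t -> T2 t g \- T2 t0 g \in L2.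
  by move=> t_ge0; apply: LfunB => //; exact: T2_mem.
have {}Tg_cont : forall e', 0 < e' -> \forall t \near within [set t | 0 <= t] (nbhs t0),
    Lpnorm mu 2 (T2 t g \- T2 t0 g) <= e'.
  apply/(Lpnorm_cvg0P le12) => //.
  by apply: filterS near_ge0 => t t_ge0; exact: dist2_mem.
(* For a difference [w] of two values bounded by [M], [|w|^p <= K * |w|]; the added 1 makes [K]
   positive. [e'] solves [K * C * e' = (e / 3)^p]. *)
pose K := (2 * `|M|) `^ (p - 1) + 1.
have K0 : 0 < K by rewrite ltr_wpDl ?powR_ge0.
pose e' := (e / 3) `^ p / (K * C).
have e'0 : 0 < e' by rewrite divr_gt0 ?powR_gt0// mulr_gt0.
apply: filterS2 near_ge0 (Tg_cont e' e'0) => t t_ge0 Tge'.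
have pTt := T1_memp t_ge0 p1; have pTt0 := T1_memp t00 p1.
have := T1_Lp_dist t_ge0 p1 pf pg; have := T1_Lp_dist t00 p1 pf pg.
have := Lpnorm_dist p1 (pTt _ pf) (pTt _ pg) (pTt0 _ pf).
have := Lpnorm_dist p1 (pTt _ pg) (pTt0 _ pg) (pTt0 _ pf).
rewrite (LpnormBC mu p (T1 t0 g)).
suff : Lpnorm mu p (T1 t g \- T1 t0 g) <= e / 3 by lra.
have pd := dist_mem g t t_ge0 pg; have d1 := Lp_L1 p1 pd.
apply: Lpnorm_le_cst => //; first exact: ltW.
apply: (@le_trans _ _ (\int[mu]_x (K%:E * `|T1 t g x - T1 t0 g x|%:E))%E).
  apply: ae_ge0_le_integral => //.
  - exact: measurable_abs_powR (Lfun_measurable d1).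
  - by move=> x _; rewrite -EFinM lee_fin mulr_ge0// ltW.
  - under eq_fun do rewrite -EFinM.
    apply/measurable_EFinP/measurable_funM => //.
    by apply: measurableT_comp => //; exact: Lfun_measurable d1.
  - apply: filterS2 (T1_bounded t_ge0 mg gM) (T1_bounded t00 mg gM) => x h1 h2 _.
    rewrite -EFinM lee_fin /=; set w := T1 t g x - _.
    have wM : `|w| <= 2 * `|M|.
      have := ler_normB (T1 t g x) (T1 t0 g x); rewrite -/w; have := ler_norm M; lra.
    have [->|w0] := eqVneq w 0; first by rewrite normr0 mulr0 powR0// gt_eqF.
    have -> : `|w| `^ p = `|w| `^ (p - 1) * `|w|.
      rewrite -[X in _ * X](powRr1 (normr_ge0 w)) -powRD ?subrK//.
      by apply/implyP => _; rewrite normr_eq0.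
    rewrite ler_wpM2r//; apply: (@le_trans _ _ ((2 * `|M|) `^ (p - 1))).
      by rewrite ge0_ler_powR ?nnegrE ?subr_ge0// mulr_ge0.
    by rewrite lerDl.
rewrite ge0_integralZl//; last 2 first.
- by apply/measurable_EFinP/measurableT_comp => //; exact: Lfun_measurable d1.
- by rewrite lee_fin ltW.
rewrite -(Lpnorm1_EFin d1) -EFinM lee_fin.
have dE : dist1 (T1 t g) (T1 t0 g) <= dist1 (T2 t g) (T2 t0 g).
  apply: (Lfun_ae_dominated le11 (Lfun_measurable d1) (L21 (dist2_mem t t_ge0)) _).2.
  by apply: filterS2 (T1_T2 t_ge0 g2) (T1_T2 t00 g2) => x /(_ I) /= -> /(_ I) ->.
have := CP _ (dist2_mem t t_ge0) => CP'.
have : dist1 (T1 t g) (T1 t0 g) <= C * e'.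
  by apply: le_trans dE _; apply: le_trans CP' _; rewrite ler_pM2l.
rewrite -(ler_pM2l K0) => /le_trans; apply; rewrite le_eqVlt; apply/orP; left; apply/eqP.
by rewrite /e'; field; rewrite !gt_eqF.
Qed.

(** Bounded functions lie in both L2 and Lp, where both extensions equal [T2], and they are dense in
    Lp. *)
Lemma T1_unique p (T' : R -> (T -> R) -> T -> R) : 1 <= p ->
  Lp_extends mu p T2 T' -> Lp_contraction_semigroup mu p T' ->
  forall t f, 0 <= t -> f \in Lfun mu p%:E -> T' t f = T1 t f %[ae mu].
Proof.
move=> p1 T'_ext T'_semi t f t0 pf.
have T'_op := Lp_semigroup_op T'_semi t0.
have pT' g : g \in Lfun mu p%:E -> T' t g \in Lfun mu p%:E.
  exact: (Lp_operator_mem T'_op).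
apply: (Lpnorm_eq0_dist p1) => //; [exact: pT'|exact: T1_memp|].
apply/eqP; rewrite eq_le Lpnorm_ge0 andbT.
apply: (@le_addgt0_mul _ _ 2) => e e0; rewrite add0r.
have [g [M [mg gM fg _]]] := Lp_bounded_dense p1 e0 pf.
have pg : g \in Lfun mu p%:E by exact: boundedL gM.
have g2 : g \in L2 by exact: boundedL gM.
have T'g : Lpnorm mu p (T' t g \- T1 t g) = 0.
  apply: (ae_eq_Lpnorm_dist p1); [exact: pT'|exact: T1_memp|].
  by apply: filterS2 (T'_ext _ _ t0 g2 pg) (T1_T2 t0 g2) => x h1 h2 xT; rewrite h1// h2.
have T'fg := Lp_semigroup_dist p1 T'_semi t0 pf pg.
have := T1_Lp_dist t0 p1 pg pf; rewrite (LpnormBC mu p g).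
have := Lpnorm_dist p1 (pT' _ pf) (pT' _ pg) (T1_memp t0 p1 pf).
have := Lpnorm_dist p1 (pT' _ pg) (T1_memp t0 p1 pg) (T1_memp t0 p1 pf).
by rewrite T'g; lra.
Qed.

End semigroup_extension.

(** [T1] is quantified before [p]: a single family acts on all Lp spaces, which makes the semigroups
    consistent at once. *)
Theorem L2_semigroup_extension {R : realType} d (T : measurableType d)
    (mu : {measure set T -> \bar R}) (T2 : R -> (T -> R) -> T -> R) :
  (mu setT < +oo)%E ->
  Lp_contraction_semigroup mu 2 T2 -> Lp_strongly_continuous mu 2 T2 ->
  (forall (f : T -> R) (t c : R), f \in Lfun mu 2%:E -> 0 <= t ->
    Lpnorm mu 1 (fun x => T2 t f x - c) <= Lpnorm mu 1 (fun x => f x - c)) ->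
  exists T1 : R -> (T -> R) -> T -> R, forall p : R, 1 <= p ->
    [/\ Lp_extends mu p T2 T1, Lp_contraction_semigroup mu p T1,
        Lp_positive mu p T1, Lp_strongly_continuous mu p T1 &
        forall T' : R -> (T -> R) -> T -> R, Lp_extends mu p T2 T' ->
          Lp_contraction_semigroup mu p T' ->
          forall (t : R) (f : T -> R), 0 <= t -> f \in Lfun mu p%:E ->
            T' t f = T1 t f %[ae mu]].
Proof.
move=> mu_fin T2_semi T2_cont T2_contr.
have /choice[T1' T1'P] : forall tf : R * (T -> R), exists l,
    0 <= tf.1 -> tf.2 \in Lfun mu 1%:E -> l \in Lfun mu 1%:E /\
    forall g, g \in Lfun mu 2%:E ->
      Lpnorm mu 1 (l \- T2 tf.1 g) <= Lpnorm mu 1 (tf.2 \- g).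
  move=> [t f] /=; have [t0|t0] := boolP (0 <= t); last by exists f.
  have [f1|f1] := boolP (f \in Lfun mu 1%:E); last by exists f.
  by have [l lP] := L1_extension_exists mu_fin T2_semi T2_contr t0 f1; exists l.
pose T1 t f := T1' (t, f).
have T1_mem t f : 0 <= t -> f \in Lfun mu 1%:E -> T1 t f \in Lfun mu 1%:E.
  by move=> t0 f1; exact: (T1'P (t, f) t0 f1).1.
have T1_T2_dist t f g : 0 <= t -> f \in Lfun mu 1%:E -> g \in Lfun mu 2%:E ->
    Lpnorm mu 1 (T1 t f \- T2 t g) <= Lpnorm mu 1 (f \- g).
  by move=> t0 f1; exact: (T1'P (t, f) t0 f1).2.
exists T1 => p p1; split.
- by move=> t f t0 f2 pf; exact: (T1_T2 mu_fin T2_semi T1_mem T1_T2_dist).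
- exact: (T1_Lp_semigroup mu_fin T2_semi T2_contr T1_mem T1_T2_dist).
- move=> t f t0 pf; apply: (T1_ge0 mu_fin T2_semi T2_contr T1_mem T1_T2_dist) => //.
  exact: Lfun_le pf.
- exact: (T1_strongly_continuous mu_fin T2_semi T2_cont T2_contr T1_mem T1_T2_dist).
- by move=> T' T'_ext T'_semi t f t0 pf;
    exact: (T1_unique mu_fin T2_semi T2_contr T1_mem T1_T2_dist p1 T'_ext T'_semi).
Qed.

(** * Smooth approximation of the sign and the L1 contraction property *)

Section smooth_abs.
Context {R : realType} (e c : R).
Hypothesis e0 : 0 < e.
Implicit Types a b : R.

Definition smooth_abs a := Num.sqrt ((a - c) ^+ 2 + e ^+ 2).

Definition smooth_sgn a := (a - c) / smooth_abs a.

(* The difference quotient of [smooth_sgn] between [a] and [b], written without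
   division by [b - a], so that it also makes sense on the diagonal. *)
Definition smooth_sgn_slope b a :=
  (smooth_abs b - (b - c) * ((a - c) + (b - c)) / (smooth_abs a + smooth_abs b)) /
  (smooth_abs a * smooth_abs b).

Local Notation S := smooth_abs.

Lemma sqr_smooth_abs a : S a ^+ 2 = (a - c) ^+ 2 + e ^+ 2.
Proof. by rewrite sqr_sqrtr// addr_ge0 ?sqr_ge0. Qed.

Lemma smooth_abs_gt0 a : 0 < S a.
Proof. by rewrite sqrtr_gt0 ltr_wpDl ?sqr_ge0// exprn_gt0. Qed.

Lemma smooth_abs_ge a : `|a - c| <= S a.
Proof. by rewrite -sqrtr_sqr ler_sqrt ?addr_ge0 ?sqr_ge0// lerDl sqr_ge0. Qed.

Lemma smooth_abs_ge_eps a : e <= S a.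
Proof.
rewrite -(@ler_pXn2r _ 2)// ?nnegrE ?(ltW (smooth_abs_gt0 _)) ?(ltW e0)//.
by rewrite sqr_smooth_abs lerDr sqr_ge0.
Qed.

Lemma smooth_abs_le a : S a <= `|a - c| + e.
Proof.
rewrite -(@ler_pXn2r _ 2)// ?nnegrE ?addr_ge0 ?(ltW (smooth_abs_gt0 _)) ?(ltW e0)//.
rewrite sqr_smooth_abs -(real_normK (num_real (a - c))).
by rewrite sqrrD lerD2r lerDl mulrn_wge0// mulr_ge0// ltW.
Qed.

Lemma smooth_sgn_slopeE b a :
  smooth_sgn b - smooth_sgn a = smooth_sgn_slope b a * (b - a).
Proof.
rewrite /smooth_sgn /smooth_sgn_slope.
have := sqr_smooth_abs a; have := sqr_smooth_abs b.
have := smooth_abs_gt0 a; have := smooth_abs_gt0 b.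
move: (S a) (S b) => u v v0 u0 v2 u2.
have uv0 : 0 < u + v by rewrite addr_gt0.
have E : (u - v) * (u + v) = (a - b) * ((a - c) + (b - c)).
  by rewrite -subr_sqr u2 v2; ring.
set q := _ / (u + v).
have qE : q * (b - a) = (b - c) * (v - u).
  apply: (mulIf (lt0r_neq0 uv0)); rewrite mulrAC divfK ?gt_eqF//.
  have -> : (b - c) * (v - u) * (u + v) = - (b - c) * ((u - v) * (u + v)) by ring.
  by rewrite E; ring.
have -> : (v - q) / (u * v) * (b - a) = (v * (b - a) - q * (b - a)) / (u * v) by ring.
by rewrite qE; field; rewrite !gt_eqF.
Qed.

(** On the diagonal the slope is the derivative of [smooth_sgn], namely [e^2 / smooth_abs a ^ 3].
    Its sign preserves the dissipativity of [B] when the gradient of [smooth_sgn (f x)] is inserted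
    in the form. *)
Lemma smooth_sgn_slope_diag_ge0 a : 0 <= smooth_sgn_slope a a.
Proof.
have S0 := smooth_abs_gt0 a.
rewrite /smooth_sgn_slope divr_ge0 ?mulr_ge0 ?(ltW S0)// subr_ge0.
rewrite ler_pdivrMr ?addr_gt0//.
have := sqr_smooth_abs a; have := sqr_ge0 e; nra.
Qed.

Lemma smooth_sgn_slope_le b a : `|smooth_sgn_slope b a| <= 2 / e.
Proof.
have Sa := smooth_abs_gt0 a; have Sb := smooth_abs_gt0 b.
rewrite /smooth_sgn_slope normrM normfV.
rewrite (gtr0_norm (mulr_gt0 Sa Sb)) ler_pdivrMr ?mulr_gt0//.
apply: (@le_trans _ _ (2 * S b)).
  apply: le_trans (ler_normB _ _) _; rewrite (gtr0_norm Sb).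
  have -> : 2 * S b = S b + S b by ring.
  rewrite lerD2l.
  rewrite normrM normfV (gtr0_norm (addr_gt0 Sa Sb)) ler_pdivrMr ?addr_gt0//.
  rewrite normrM ler_pM ?smooth_abs_ge//.
  by rewrite (le_trans (ler_normD _ _))// lerD// smooth_abs_ge.
have -> : 2 / e * (S a * S b) = 2 * S b * (S a / e) by ring.
by rewrite ler_peMr ?mulr_ge0 ?(ltW Sb)// ler_pdivlMr// mul1r smooth_abs_ge_eps.
Qed.

Lemma smooth_sgn_le1 a : `|smooth_sgn a| <= 1.
Proof.
have Sa := smooth_abs_gt0 a.
by rewrite normrM normfV (gtr0_norm Sa) ler_pdivrMr// mul1r smooth_abs_ge.
Qed.

(** After multiplication by [S b] this is the Cauchy-Schwarz inequality for the plane vectors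
    [(a - c, e)] and [(b - c, e)], whose lengths are [S a] and [S b]. *)
Lemma smooth_abs_subgradient a b : S b - S a <= smooth_sgn b * (b - a).
Proof.
have Sa := smooth_abs_gt0 a; have Sb := smooth_abs_gt0 b.
rewrite /smooth_sgn mulrAC ler_pdivlMr//.
have Sa2 := sqr_smooth_abs a; have Sb2 := sqr_smooth_abs b.
suff : (a - c) * (b - c) + e ^+ 2 <= S a * S b by nra.
apply: le_trans (ler_norm _) _.
rewrite -(@ler_pXn2r _ 2)// ?nnegrE ?mulr_ge0 ?(ltW Sa) ?(ltW Sb)//.
rewrite real_normK ?num_real// exprMn Sa2 Sb2 -subr_ge0.
have -> : ((a - c) ^+ 2 + e ^+ 2) * ((b - c) ^+ 2 + e ^+ 2) -
  ((a - c) * (b - c) + e ^+ 2) ^+ 2 = (e * (a - b)) ^+ 2 by ring.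
exact: sqr_ge0.
Qed.

Lemma smooth_abs_lipschitz a b : S b - S a <= `|b - a|.
Proof.
apply: le_trans (smooth_abs_subgradient a b) _.
apply: le_trans (ler_norm _) _; rewrite normrM.
by rewrite -[leRHS]mul1r ler_wpM2r// smooth_sgn_le1.
Qed.

Lemma smooth_abs_continuous : continuous smooth_abs.
Proof.
move=> a; apply: continuous_comp; last exact: sqrt_continuous.
have ac : x - c @[x --> a] --> a - c by apply: cvgB; [exact: cvg_id|exact: cvg_cst].
by apply: cvgD; [exact: (cvgM ac ac)|exact: cvg_cst].
Qed.

Lemma smooth_sgn_slope_cvg (I : Type) (F : set_system I) (FF : Filter F)
    (f g : I -> R) a b : f @ F --> a -> g @ F --> b ->
  smooth_sgn_slope (f x) (g x) @[x --> F] --> smooth_sgn_slope a b.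
Proof.
move=> fa gb.
have Sf : S (f x) @[x --> F] --> S a.
  by apply: continuous_cvg fa; exact: smooth_abs_continuous.
have Sg : S (g x) @[x --> F] --> S b.
  by apply: continuous_cvg gb; exact: smooth_abs_continuous.
have fc : f x - c @[x --> F] --> a - c by apply: cvgB => //; exact: cvg_cst.
have gc : g x - c @[x --> F] --> b - c by apply: cvgB => //; exact: cvg_cst.
apply: cvgM; last first.
  by apply: cvgV; [rewrite gt_eqF// mulr_gt0// smooth_abs_gt0|exact: cvgM].
apply: cvgB => //; apply: cvgM; first by apply: cvgM => //; exact: cvgD.
by apply: cvgV; [rewrite gt_eqF// addr_gt0// smooth_abs_gt0|exact: cvgD].
Qed.

Lemma smooth_sgn_continuous : continuous smooth_sgn.
Proof.
move=> a; apply: cvgM; first by apply: cvgB; [exact: cvg_id|exact: cvg_cst].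
by apply: cvgV; [rewrite gt_eqF// smooth_abs_gt0|exact: smooth_abs_continuous].
Qed.

End smooth_abs.

(** * Cylindrical functions and their gradients *)

Section cylindrical_composition.
Context {R : realType} {X H : completeNormedModType R} (istar : dual X -> H).
Variables (e c : R).
Hypothesis e0 : 0 < e.

(** [smooth_sgn_slope] factors the difference quotient exactly, which gives the chain rule; its
    bound [2 / e] keeps the partial derivatives bounded. *)
Lemma Cb1_smooth_sgn n (phi : 'rV[R]_n -> R^o) : Cb1 phi ->
  Cb1 (fun z => smooth_sgn e c (phi z) : R^o) /\
  forall z j, 'D_(delta_mx ord0 j) (fun z => smooth_sgn e c (phi z) : R^o) z =
    smooth_sgn_slope e c (phi z) (phi z) * 'D_(delta_mx ord0 j) phi z.
Proof.
move=> [phi_cont _ phi_D].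
have D z j : h^-1 *: ((smooth_sgn e c \o phi : _ -> R^o) (h *: delta_mx ord0 j + z) -
      smooth_sgn e c (phi z)) @[h --> 0^'] -->
    (smooth_sgn_slope e c (phi z) (phi z) * 'D_(delta_mx ord0 j) phi z : R^o).
  have [phi_deriv _ _] := phi_D j.
  have -> : (fun h : R => h^-1 *: ((smooth_sgn e c \o phi : _ -> R^o) (h *: delta_mx ord0 j + z) -
      smooth_sgn e c (phi z))) =
    (fun h => smooth_sgn_slope e c (phi (h *: delta_mx ord0 j + z)) (phi z) *
        (h^-1 *: (phi (h *: delta_mx ord0 j + z) - phi z)) : R^o).
    apply/funext => h /=; rewrite (smooth_sgn_slopeE _ e0).
    by rewrite scalerAr.
  apply: cvgM; last exact: phi_deriv.
  apply: smooth_sgn_slope_cvg => //; last exact: cvg_cst.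
  have -> : phi z = phi (0 *: delta_mx ord0 j + z) by rewrite scale0r add0r.
  apply: cvg_within_filter.
  apply: (@continuous_cvg _ _ _ _ _ (fun h : R => h *: delta_mx ord0 j + z)); first exact: phi_cont.
  apply: cvgD; last exact: cvg_cst.
  by apply: cvgZr_tmp; exact: cvg_id.
have DE z j : 'D_(delta_mx ord0 j) (fun z => smooth_sgn e c (phi z) : R^o) z =
    smooth_sgn_slope e c (phi z) (phi z) * 'D_(delta_mx ord0 j) phi z.
  by apply: cvg_lim => //; exact: D.
split=> //; split.
- move=> z; apply: continuous_comp; first exact: phi_cont.
  exact: smooth_sgn_continuous.
- by exists 1 => z; exact: smooth_sgn_le1.
- move=> j; have [phi_deriv phi'_cont [M phi'M]] := phi_D j; split.
  + by move=> z; apply/cvg_ex; eexists; exact: D.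
  + under eq_fun do rewrite DE.
    move=> z.
    have sz := smooth_sgn_slope_cvg (c := c) e0 (nbhs_filter z) (phi_cont z) (phi_cont z).
    exact: (cvgM sz (phi'_cont z)).
  + exists (2 / e * M) => z; rewrite DE normrM.
    by apply: ler_pM => //; exact: smooth_sgn_slope_le.
Qed.

Lemma FCb1_smooth_sgn f g : FCb1_grad istar f g ->
  FCb1_grad istar (fun x => smooth_sgn e c (f x))
    (fun x => smooth_sgn_slope e c (f x) (f x) *: g x).
Proof.
move=> [n [phi [xs [phi_Cb1 fE gE]]]]; have [psi_Cb1 psi_D] := Cb1_smooth_sgn phi_Cb1.
exists n, (fun z => smooth_sgn e c (phi z) : R^o), xs; split => //.
  by move=> x; rewrite fE.
move=> x; rewrite gE fE scaler_sumr; apply: eq_bigr => j _.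
by rewrite psi_D scalerA.
Qed.

End cylindrical_composition.

Section cylindrical_measurability.
Context {R : realType} {X H : completeNormedModType R} (istar : dual X -> H).

Lemma row_continuous (U : topologicalType) n (f : 'I_n -> U -> R) :
  (forall j, continuous (f j)) -> continuous (fun x => \row_j f j x : 'rV[R]_n).
Proof.
move=> f_cont x A [P nP PA].
have : \forall y \near x, forall j, P ord0 j (f j y).
  apply: filter_forall => j; apply: f_cont.
  by have := nP ord0 j; rewrite mxE.
apply: filterS => y yP; apply: PA => i j.
by rewrite (ord1 i) mxE.
Qed.

Lemma FCb1_continuous f g : FCb1_grad istar f g -> continuous f.
Proof.
move=> [n [phi [xs [[phi_cont _ _] fE _]]]] x; rewrite (funext fE).
apply: (@continuous_comp _ _ _ (fun y => \row_j xs j y) phi); last exact: phi_cont.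
by apply: row_continuous => j; exact: bop_continuous.
Qed.

(* The gradient of a cylindrical function takes values in a fixed
   finite-dimensional space, with continuous coordinates. *)
Lemma FCb1_gradient f g : FCb1_grad istar f g ->
  exists n (a : 'I_n -> X -> R) (h : 'I_n -> H),
    (forall j, continuous (a j)) /\ forall x, g x = \sum_(j < n) a j x *: h j.
Proof.
move=> [n [phi [xs [[_ _ phi_D] _ gE]]]].
exists n, (fun j x => 'D_(delta_mx ord0 j) phi (\row_k xs k x)), (istar \o xs).
split=> // j x; have [_ phi'_cont _] := phi_D j.
apply: (@continuous_comp _ _ _ (fun y => \row_j xs j y) ('D_(delta_mx ord0 j) phi));
  last exact: phi'_cont.
by apply: row_continuous => k; exact: bop_continuous.
Qed.

Lemma borel_measurable_comp (g : X -> H) (F : H -> R) :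
  (forall W : set H, open W -> measurable (g @^-1` W : set (borel X))) ->
  continuous F -> measurable_fun setT ((F \o g) : borel X -> R).
Proof.
move=> mg cF; apply: (measurability _ (RGenOpens.measurableE R)).
move=> _ [_ [a [b ->] <-]]; rewrite setTI comp_preimage.
by apply: mg; exact: open_comp.
Qed.

Context (ip : H -> H -> R) (ip_hilbert : hilbert_inner_product ip).

Lemma ip_continuous h : continuous (ip h).
Proof.
move=> k; apply/cvgrPdist_le => e e0; have h0 : 0 < `|h| + 1 by rewrite ltr_wpDl.
near=> l; rewrite -(ipBr ip_hilbert).
apply: le_trans (cauchy_schwarz ip_hilbert _ _) _.
apply: (@le_trans _ _ ((`|h| + 1) * `|k - l|)); first by rewrite ler_wpM2r// lerDl.
rewrite mulrC -ler_pdivlMr//; near: l.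
by apply: cvgr_dist_le => //; rewrite divr_gt0.
Unshelve. all: by end_near. Qed.

(** Measurability of a difference of [H]-valued functions is not immediate from preimages of open
    sets. The squared norm is expanded instead: [df] is a finite combination of fixed vectors, so
    each inner product is a finite sum of measurable real functions. *)
Lemma FCb1_gradient_dist_measurable f df g : FCb1_grad istar f df ->
  (forall W : set H, open W -> measurable (g @^-1` W : set (borel X))) ->
  measurable_fun setT ((fun x => `|df x - g x|) : borel X -> R).
Proof.
move=> /FCb1_gradient[n [a [h [a_cont dfE]]]] mg.
have ma j : measurable_fun setT (a j : borel X -> R) by exact: continuous_measurable_borel.
have mdf : measurable_fun setT ((fun x => ip (df x) (df x)) : borel X -> R).
  have -> : (fun x => ip (df x) (df x)) =
      (fun x => \sum_j \sum_k a j x * (a k x * ip (h j) (h k))).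
    apply/funext => x; rewrite !dfE (ip_sumr ip_hilbert); apply: eq_bigr => j _.
    rewrite (ipC ip_hilbert) (ipZl ip_hilbert) (ip_sumr ip_hilbert) mulr_sumr.
    by apply: eq_bigr => k _; rewrite (ipZr ip_hilbert).
  by apply: measurable_sum => j; apply: measurable_sum => k; do 2 apply: measurable_funM => //.
have mdfg : measurable_fun setT ((fun x => ip (df x) (g x)) : borel X -> R).
  have -> : (fun x => ip (df x) (g x)) = (fun x => \sum_j a j x * ip (h j) (g x)).
    apply/funext => x; rewrite dfE (ipC ip_hilbert) (ip_sumr ip_hilbert).
    by apply: eq_bigr => j _; rewrite (ipC ip_hilbert) (ipZl ip_hilbert).
  apply: measurable_sum => j; apply: measurable_funM => //.
  by apply: borel_measurable_comp => //; exact: ip_continuous.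
have mgg : measurable_fun setT ((fun x => `|g x| ^+ 2) : borel X -> R).
  apply: measurable_funX; apply: (borel_measurable_comp mg).
  exact: norm_continuous.
have -> : (fun x => `|df x - g x|) =
    (fun x => Num.sqrt (ip (df x) (df x) - 2 * ip (df x) (g x) + `|g x| ^+ 2)).
  apply/funext => x; rewrite -[LHS]ger0_norm// -sqrtr_sqr (sqr_normB ip_hilbert).
  congr Num.sqrt; rewrite !(ip_norm ip_hilbert); ring.
apply: (@measurableT_comp _ _ _ _ _ _ (@Num.sqrt R)) => //.
  by apply: measurable_realfun.continuous_measurable_fun; exact: sqrt_continuous.
by apply: measurable_funD => //; apply: measurable_funB => //; exact: measurable_funM.
Qed.

End cylindrical_measurability.

Section integral_bounds.
Context {R : realType} d (T : measurableType d).
Variable mu : {measure set T -> \bar R}.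
Implicit Types f g : T -> R.
Local Notation L1 := (Lfun mu 1%:E).
Local Notation L2 := (Lfun mu 2%:E).

Lemma Lpnorm1M f g : f \in L2 -> g \in L2 -> f \* g \in L1 /\
  Lpnorm mu 1 (f \* g) <= Lpnorm mu 2 f * Lpnorm mu 2 g.
Proof.
move=> f2 g2; have fg1 : f \* g \in L1 by exact: Lfun2_mul_Lfun1.
split => //; have le12 : 1 <= 2 :> R by rewrite ler1n.
rewrite -lee_fin EFinM -(Lpnorm_EFin (lexx 1) fg1) -!(Lpnorm_EFin le12)//.
apply: hoelder => //; [exact: Lfun_measurable f2|exact: Lfun_measurable g2|].
by field.
Qed.

Lemma Rintegral_le_Lpnorm1 f : f \in L1 -> \int[mu]_x f x <= Lpnorm mu 1 f.
Proof.
move=> f1; apply: le_trans (ler_norm _) _.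
have f1i : mu.-integrable setT (EFin \o f) by exact/Lfun1_integrable.
apply: le_trans (le_normr_Rintegral measurableT f1i) _.
by rewrite -lee_fin (Lpnorm1_EFin f1) /Rintegral fineK// -Lpnorm1_EFin.
Qed.

(** Measurability of [f] is not assumed, so its positive part is compared with [g] by monotonicity
    alone; an infinite integral of [f] counts as 0, which the bound covers. *)
Lemma Rintegral_le_dominated f g : g \in L1 -> (forall x, 0 <= g x) ->
  (forall x, f x <= g x) -> \int[mu]_x f x <= Lpnorm mu 1 g.
Proof.
move=> g1 g0 fg.
have : (\int[mu]_x (f x)%:E <= (Lpnorm mu 1 g)%:E)%E.
  rewrite integralE; apply: (@le_trans _ _ (\int[mu]_x (EFin \o f)^\+ x)%E).
    by rewrite geeDl// oppe_le0 integral_ge0.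
  rewrite (Lpnorm1_EFin g1); apply: ge0_le_integral_nomeas => // x _.
  rewrite funeposE ge_max; apply/andP; split; rewrite lee_fin //.
  by rewrite (le_trans (fg x))// ler_norm.
rewrite /Rintegral; case: (\int[mu]_x _)%E => [a||] //=.
by move=> _; exact: Lpnorm_ge0.
Qed.

Lemma Lpnorm_cvg0_near (p : R) (w : nat -> T -> R) (e : R) : 1 <= p -> 0 < e ->
  (forall n, measurable_fun setT (w n)) ->
  'N[mu]_p%:E[EFin \o w n]%E @[n --> \oo] --> 0%E ->
  \forall n \near \oo, w n \in Lfun mu p%:E /\ Lpnorm mu p (w n) <= e.
Proof.
move=> p1 e0 mw /fine_cvgP[w_fin /cvgr0Pnorm_le/(_ _ e0) w_le].
apply: filterS2 w_fin w_le => n; rewrite fin_numElt => /andP[_ wn] wn_le; split.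
  by rewrite inE; apply/andP; split; rewrite inE//=.
exact: le_trans (ler_norm _) wn_le.
Qed.

End integral_bounds.

(** * Contraction in L1 of the perturbed Ornstein-Uhlenbeck semigroup *)

Section OU_L1_contraction.
Context {R : realType} {X H : completeNormedModType R} (istar : dual X -> H).
Context (ip : H -> H -> R) (ip_hilbert : hilbert_inner_product ip) (B : bop H H).
Hypothesis B_dissipative : forall h, ip (B h) h <= 0.
Variable nu : {measure set (borel X) -> \bar R}.
Hypothesis nu_fin : (nu setT < +oo)%E.
Local Notation L1 := (Lfun nu 1%:E).
Local Notation L2 := (Lfun nu 2%:E).

Let le11 : 1 <= 1 :> R. Proof. exact: lexx. Qed.
Let le12 : 1 <= 2 :> R. Proof. by rewrite ler1n. Qed.
Let L21 f : f \in L2 -> f \in L1.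
Proof. exact: Lfun_le. Qed.

Section smooth_abs_functional.
Variables (e c : R).
Hypothesis e0 : 0 < e.
Local Notation sgn := (smooth_sgn e c).

Let sgn2 (u : borel X -> R) : measurable_fun setT u -> (fun x => sgn (u x)) \in L2.
Proof.
move=> mu; apply: (@Lfun_bounded _ _ _ _ nu_fin _ _ 1) => //.
  apply: measurableT_comp => //; apply: continuous_measurable_fun.
  exact: smooth_sgn_continuous.
by move=> x; exact: smooth_sgn_le1.
Qed.

(* [sgn u] need not be cylindrical: the form is tested against [sgn (f n)] for
   cylindrical [f n] converging to [u], and [ip (B gu) (df n)] differs from
   [ip (B gu) gu <= 0] by at most [|B gu| |df n - gu|]. *)
Lemma L2_graph_sgn_le0 u l : L2_graph ip istar B nu u l ->
  \int[nu]_x (l x * sgn (u x)) <= 0.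
Proof.
move=> [l2 [gu [u2 [mgu gu_fin] [f [df [f_FCb1 f_cvg df_cvg]]]] l_form]].
have [b b0 B_le] := bop_bounded B.
have K0 : 0 <= 2 / e by rewrite divr_ge0// ltW.
have kb0 : 0 <= 2 / e * b by rewrite mulr_ge0// ltW.
pose agu (x : borel X) := `|gu x|.
have agu2 : agu \in L2.
  rewrite inE; apply/andP; split; rewrite inE//=.
  by apply: (borel_measurable_comp mgu); exact: norm_continuous.
(* The first term is the cost of [df n] in place of [gu] in the form, the second that of [sgn (f n)]
   in place of [sgn u]; [2 / e] bounds the slopes of [sgn]. *)
pose C := 2 / e * b * Lpnorm nu 2 agu + 2 / e * Lpnorm nu 2 l.
apply: (@le_addgt0_mul _ _ _ C) => r r0; rewrite add0r.
have mf n : measurable_fun setT (f n : borel X -> R).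
  apply: continuous_measurable_borel; exact: FCb1_continuous (f_FCb1 n).
have mu := Lfun_measurable u2.
pose dgs n (x : borel X) := `|df n x - gu x|.
near \oo => n.
have [fu2 fu_le] : (fun x => f n x - u x) \in L2 /\
    Lpnorm nu 2 (fun x => f n x - u x) <= r.
  by near: n; apply: Lpnorm_cvg0_near => // n; exact: measurable_funB.
have [] : dgs n \in L2 /\ Lpnorm nu 2 (dgs n) <= r.
  near: n; apply: Lpnorm_cvg0_near => // n.
  exact: (FCb1_gradient_dist_measurable ip_hilbert (f_FCb1 n) mgu).
move=> dg2 dg_le; pose dg := dgs n.
have dg0 x : 0 <= dg x by exact: normr_ge0.
have agu0 x : 0 <= agu x by exact: normr_ge0.
have form_le : \int[nu]_x (l x * sgn (f n x)) <= 2 / e * b * Lpnorm nu 2 agu * r.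
  have := l_form _ _ (FCb1_smooth_sgn c e0 (f_FCb1 n)).
  rewrite /dirichlet_form => /oppr_inj <-.
  have [k1 k_le] := Lpnorm1M agu2 dg2.
  apply: (@le_trans _ _ (Lpnorm nu 1 (fun x => 2 / e * b * (agu \* dg) x))).
    apply: Rintegral_le_dominated; first exact: LfunZ k1.
      by move=> x; exact: (mulr_ge0 kb0 (mulr_ge0 (agu0 x) (dg0 x))).
    move=> x; rewrite (ipZr ip_hilbert).
    have s0 := smooth_sgn_slope_diag_ge0 c e0 (f n x).
    have := smooth_sgn_slope_le c e0 (f n x) (f n x); rewrite ger0_norm//.
    move: (smooth_sgn_slope _ _ _ _) s0 => s s0 sK.
    have ip_le : ip (B (gu x)) (df n x) <= b * (agu x * dg x).
      rewrite -[df n x](subrK (gu x)) (ipDr ip_hilbert).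
      apply: le_trans (lerD (lexx _) (B_dissipative _)) _; rewrite addr0.
      apply: le_trans (ler_norm _) _; apply: le_trans (cauchy_schwarz ip_hilbert _ _) _.
      by rewrite mulrA ler_wpM2r// B_le.
    apply: (@le_trans _ _ (s * (b * (agu x * dg x)))); first by rewrite ler_wpM2l.
    by rewrite -mulrA ler_wpM2r// (mulr_ge0 (ltW b0) (mulr_ge0 (agu0 x) (dg0 x))).
  rewrite LpnormZ// (ger0_norm kb0) -[leRHS]mulrA ler_wpM2l//.
  by apply: le_trans k_le _; rewrite ler_wpM2l// Lpnorm_ge0.
have [lu1 _] := Lpnorm1M l2 (sgn2 mu); have [lf1 _] := Lpnorm1M l2 (sgn2 (mf n)).
have sgn_le : \int[nu]_x (l x * sgn (u x)) - \int[nu]_x (l x * sgn (f n x)) <=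
    2 / e * Lpnorm nu 2 l * r.
  have iu : nu.-integrable setT (EFin \o (fun x => l x * sgn (u x))).
    exact/Lfun1_integrable.
  have ifn : nu.-integrable setT (EFin \o (fun x => l x * sgn (f n x))).
    exact/Lfun1_integrable.
  rewrite -RintegralB//.
  have [k1 k_le] := Lpnorm1M l2 fu2.
  have kd x : `|l x * sgn (u x) - l x * sgn (f n x)| <=
      `|2 / e * (l \* (fun x => f n x - u x)) x|.
    rewrite -mulrBr (smooth_sgn_slopeE c e0) [leRHS]normrM (ger0_norm K0) /= !normrM.
    rewrite [leRHS]mulrCA ler_wpM2l// (distrC (f n x)) ler_wpM2r//.
    by rewrite -normrM; exact: smooth_sgn_slope_le.
  have [] := Lfun_dominated le11 (Lfun_measurable (LfunB le11 lu1 lf1))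
    (LfunZ le11 (2 / e) k1) kd.
  move=> d1 d_le; apply: le_trans (Rintegral_le_Lpnorm1 d1) _.
  apply: le_trans d_le _; rewrite LpnormZ// (ger0_norm K0) -[leRHS]mulrA ler_wpM2l//.
  by apply: le_trans k_le _; rewrite ler_wpM2l// Lpnorm_ge0.
rewrite /C mulrDl; lra.
Unshelve. all: by end_near. Qed.

Definition smooth_L1 (u : borel X -> R) := \int[nu]_x smooth_abs e c (u x).

Let smooth_abs_L1 u : u \in L1 -> (fun x => smooth_abs e c (u x)) \in L1.
Proof.
move=> u1; have mu := Lfun_measurable u1.
have mS : measurable_fun setT (fun x => smooth_abs e c (u x)).
  apply: measurableT_comp => //; apply: continuous_measurable_fun.
  exact: smooth_abs_continuous.
have cst1 a : cst a \in L1 by exact: Lfun_cst_fin.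
have g1 := LfunD le11 (Lfun_abs le11 (LfunB le11 u1 (cst1 c))) (cst1 e).
apply: (Lfun_dominated le11 mS g1 _).1 => x.
rewrite (gtr0_norm (smooth_abs_gt0 c e0 _)) /=.
by rewrite (le_trans (smooth_abs_le c e0 _))// ler_norm.
Qed.

Let integrable_L1 u : u \in L1 -> nu.-integrable setT (EFin \o u).
Proof. by move/Lfun1_integrable. Qed.

Lemma smooth_L1_lipschitz u v : u \in L1 -> v \in L1 ->
  smooth_L1 u - smooth_L1 v <= Lpnorm nu 1 (u \- v).
Proof.
move=> u1 v1; have Su := smooth_abs_L1 u1; have Sv := smooth_abs_L1 v1.
rewrite -RintegralB//; [|exact: integrable_L1 Su|exact: integrable_L1 Sv].
rewrite -(Lpnorm_abs nu 1 (u \- v)).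
apply: le_trans (Rintegral_le_Lpnorm1 (Lfun_abs le11 (LfunB le11 u1 v1))).
apply: le_Rintegral => //; first exact: integrable_L1 (LfunB le11 Su Sv).
  exact: integrable_L1 (Lfun_abs le11 (LfunB le11 u1 v1)).
by move=> x _; exact: smooth_abs_lipschitz.
Qed.

(** Integrate the subgradient inequality [S u - S v <= sgn u * (u - v)] and split [u - v] into
    [u - v - s * l] and [s * l]: the first part is bounded by [|sgn| <= 1], and the second has
    nonpositive integral. *)
Lemma smooth_L1_resolvent u l v (s : R) : L2_graph ip istar B nu u l ->
  v \in L2 -> 0 <= s ->
  smooth_L1 u - smooth_L1 v <= Lpnorm nu 1 (fun x => u x - v x - s * l x).
Proof.
move=> ul v2 s0; have := L2_graph_sgn_le0 ul; case: ul => l2 [gu [u2 _ _] _].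
have u1 := L21 u2; have v1 := L21 v2; have sl2 := LfunZ le12 s l2.
have Su := smooth_abs_L1 u1; have Sv := smooth_abs_L1 v1.
have uv2 := LfunB le12 u2 v2; have w2 := LfunB le12 uv2 sl2.
have sgnu2 := sgn2 (Lfun_measurable u2).
have [uv1 _] := Lpnorm1M sgnu2 uv2; have [w1 _] := Lpnorm1M sgnu2 w2.
have [ls1 _] := Lpnorm1M l2 sgnu2.
move=> ls_le; rewrite -RintegralB//; [|exact: integrable_L1 Su|exact: integrable_L1 Sv].
apply: (@le_trans _ _ (\int[nu]_x (sgn (u x) * (u x - v x)))).
  apply: le_Rintegral => //; first exact: integrable_L1 (LfunB le11 Su Sv).
    exact: integrable_L1 uv1.
  by move=> x _; exact: smooth_abs_subgradient.
have -> : \int[nu]_x (sgn (u x) * (u x - v x)) =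
    \int[nu]_x (sgn (u x) * (u x - v x - s * l x)) + s * \int[nu]_x (l x * sgn (u x)).
  rewrite -RintegralZl//; last exact: integrable_L1 ls1.
  rewrite -RintegralD//; [|exact: integrable_L1 w1|exact: integrable_L1 (LfunZ le11 s ls1)].
  by apply: eq_Rintegral => x _; ring.
rewrite -[leRHS]addr0 lerD//; last by rewrite mulr_ge0_le0.
apply: le_trans (Rintegral_le_Lpnorm1 w1) _.
apply: (Lfun_dominated le11 (Lfun_measurable w1) (L21 w2) _).2 => x.
by rewrite /= normrM -[leRHS]mul1r ler_wpM2r// smooth_sgn_le1.
Qed.

Lemma Lpnorm1_smooth_L1 u : u \in L1 ->
  Lpnorm nu 1 (fun x => u x - c) <= smooth_L1 u /\
  smooth_L1 u <= Lpnorm nu 1 (fun x => u x - c) + e * fine (nu setT).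
Proof.
move=> u1; have Su := smooth_abs_L1 u1.
have cst1 a : cst a \in L1 by exact: Lfun_cst_fin.
have uc1 := LfunB le11 u1 (cst1 c); have auc1 := Lfun_abs le11 uc1.
have -> : Lpnorm nu 1 (fun x => u x - c) = \int[nu]_x `|u x - c|.
  by apply: EFin_inj; rewrite (Lpnorm1_EFin uc1) /Rintegral fineK// -(Lpnorm1_EFin uc1).
split.
  apply: le_Rintegral => //; [exact: integrable_L1 auc1|exact: integrable_L1 Su|].
  by move=> x _; exact: smooth_abs_ge.
rewrite -(Rintegral_cst _ measurableT) -RintegralD//; last 2 first.
- exact: integrable_L1 auc1.
- exact: integrable_L1 (cst1 e).
apply: le_Rintegral => //; first exact: integrable_L1 Su.
  exact: integrable_L1 (LfunD le11 auc1 (cst1 e)).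
by move=> x _; exact: smooth_abs_le.
Qed.

End smooth_abs_functional.

Variable T2 : R -> (X -> R) -> X -> R.
Hypothesis T2_OU : perturbed_OU_semigroup ip istar B nu T2.

Let V := LfunType nu (lee1n 2).

Let T2_mem t (v : V) : 0 <= t -> T2 t v \in L2.
Proof.
move=> t0; apply: (Lp_operator_mem (Lp_semigroup_op (OU_contr T2_OU) t0)).
exact: LfunP.
Qed.

(** For negative times, where [T2] may leave L2, the value [v] is a default. *)
Let TV (t : R) (v : V) : V :=
  if pselect (0 <= t) is left t0 then Lfun_Sub (lee1n 2) (T2_mem v t0) else v.

Let TV_T2 t v : 0 <= t -> TV t v = T2 t v :> (_ -> _).
Proof. by move=> t0; rewrite /TV; case: pselect => // t0'; rewrite Lfun_valP. Qed.

Let N (v : V) : R := Lpnorm nu 2 v.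

Let N_complete (u : nat -> V) :
  (forall e, 0 < e -> exists n0, forall m n, (n0 <= m)%N -> (n0 <= n)%N ->
    N (u m - u n) <= e) ->
  exists l, forall e, 0 < e -> exists n0, forall n, (n0 <= n)%N -> N (u n - l) <= e.
Proof.
move=> u_cauchy.
have [|l l2 lP] := Lp_complete nu_fin le12 (fun n => LfunP (u n)); first exact: u_cauchy.
by exists (Lfun_Sub (lee1n 2) l2).
Qed.

Let T2_semi := OU_contr T2_OU.

Let N_contr t x y : 0 <= t -> N (TV t x - TV t y) <= N (x - y).
Proof.
move=> t0; have := Lp_semigroup_dist le12 T2_semi t0 (LfunP x) (LfunP y).
by rewrite -!TV_T2.
Qed.

Let N_lin t (a : R) x y : 0 <= t -> N (TV t (a *: x + y) - (a *: TV t x + TV t y)) = 0.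
Proof.
move=> t0.
have := Lp_operator_linear (Lp_semigroup_op T2_semi t0) a (LfunP x) (LfunP y).
move=> /(ae_eq_Lpnorm_dist le12 (T2_mem (a *: x + y) t0)).
rewrite -!TV_T2//; apply.
exact: (LfunP (a *: TV t x + TV t y)).
Qed.

Let N_add s t x : 0 <= s -> 0 <= t -> N (TV (s + t) x - TV s (TV t x)) = 0.
Proof.
move=> s0 t0; have st0 := addr_ge0 s0 t0.
have := Lp_semigroupD T2_semi s0 t0 (LfunP x).
rewrite -(TV_T2 x st0) -(TV_T2 x t0) -(TV_T2 (TV t x) s0).
exact: (ae_eq_Lpnorm_dist le12 (LfunP _) (LfunP _)).
Qed.

Let N_cont x e : 0 < e -> exists2 d, 0 < d & forall t, 0 <= t < d -> N (TV t x - x) <= e.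
Proof.
move=> e0; have dist_mem t : 0 <= t -> T2 t x \- T2 0 x \in L2.
  by move=> t0; apply: LfunB => //; exact: T2_mem.
have near_ge0 : \forall t \near within [set t : R | 0 <= t] (nbhs 0), 0 <= t.
  exact: withinT.
have /(Lpnorm_cvg0P le12) := OU_cont T2_OU (LfunP x) (lexx 0).
have near_mem : \forall t \near within [set t : R | 0 <= t] (nbhs 0),
    T2 t x \- T2 0 x \in L2.
  by apply: filterS near_ge0 => t; exact: dist_mem.
move=> /(_ near_mem e e0)/nbhs_ballP[d /= d0 dP].
exists d => // t /andP[t0 td].
have T20 : Lpnorm nu 2 (T2 0 x \- x) = 0.
  apply: (ae_eq_Lpnorm_dist le12 (T2_mem x (lexx 0)) (LfunP x)).
  exact: (Lp_semigroup0 T2_semi (LfunP x)).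
have := Lpnorm_dist le12 (T2_mem x t0) (T2_mem x (lexx 0)) (LfunP x).
rewrite T20 addr0 -(TV_T2 x t0) => /le_trans; apply.
rewrite (TV_T2 x t0); apply: dP => //.
by rewrite -ball_normE /= sub0r normrN ger0_norm.
Qed.

Let N_generator (w y : V) : generator_at N TV w y -> L2_graph ip istar B nu w y.
Proof.
move=> wy; apply/(OU_generator T2_OU); split; [exact: LfunP..|].
have quotE t : 0 < t -> (fun x => t^-1 * (T2 t w x - w x) - y x) =
    (t^-1 *: (TV t w - w - t *: y) : V).
  move=> t0; apply/funext => x; rewrite -(TV_T2 w (ltW t0)) /=.
  by rewrite -[RHS]/(t^-1 * (TV t w x - w x - t * y x)); field; rewrite gt_eqF.
have near_gt0 : \forall t \near 0^'+, 0 < t :> R by exact: nbhs_right_gt.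
apply/(Lpnorm_cvg0P le12).
  by apply: filterS near_gt0 => t t0; rewrite (quotE t t0); exact: LfunP.
move=> e e0; have [d d0 dP] := wy e e0.
near=> t; have t0 : 0 < t by near: t.
have := dP t; rewrite t0 => /(_ _)/=.
rewrite (quotE t t0) => h.
have -> : Lpnorm nu 2 (t^-1 *: (TV t w - w - t *: y) : V) =
    t^-1 * N (TV t w - w - t *: y).
  have := LpnormZ le12 t^-1 (LfunP (TV t w - w - t *: y)).
  by rewrite ger0_norm// invr_ge0 ltW.
rewrite mulrC ler_pdivrMr// mulrC; apply: h.
by near: t; exact: nbhs_right_lt.
Unshelve. all: by end_near. Qed.

(** [smooth_L1 e c] is 1-Lipschitz for the L1 norm, hence [C]-Lipschitz for the L2 norm of the
    semigroup, with [C] from Hölder's inequality. It exceeds the L1 distance to [c] by at most [e]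
    times the total mass. *)
Lemma OU_L1_contraction f (t c : R) : f \in L2 -> 0 <= t ->
  Lpnorm nu 1 (fun x => T2 t f x - c) <= Lpnorm nu 1 (fun x => f x - c).
Proof.
move=> f2 t0; apply: (@le_addgt0_mul _ _ _ (fine (nu setT))) => e e0.
pose v : V := Lfun_Sub (lee1n 2) f2.
have v1 (u : V) : (u : _ -> _) \in L1 by exact/L21/LfunP.
have [C C0 CP] := Lpnorm1_le nu_fin le12.
have : smooth_L1 e c (TV t v) <= smooth_L1 e c v.
  apply: (@semigroup_decreasing R V N _ _ _ N_complete TV N_contr N_lin N_add N_cont
    (fun u : V => smooth_L1 e c u) C (ltW C0)) => //.
  - by move=> x; exact: Lpnorm_ge0.
  - by move=> x y; apply: LpnormD => //; exact: LfunP.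
  - by move=> a x; apply: LpnormZ => //; exact: LfunP.
  - move=> x y; apply: le_trans (smooth_L1_lipschitz c e0 (v1 x) (v1 y)) _.
    by apply: CP; exact: (LfunP (x - y)).
  - move=> w y s x /N_generator wy s0.
    apply: le_trans (smooth_L1_resolvent c e0 wy (LfunP x) s0) _.
    by apply: CP; exact: (LfunP (w - x - s *: y)).
have [_ v_le] := Lpnorm1_smooth_L1 c e0 (v1 v).
have [Tv_ge _] := Lpnorm1_smooth_L1 c e0 (v1 (TV t v)).
rewrite -[T2 t f](TV_T2 v t0) mulrC => h.
by apply: le_trans Tv_ge _; apply: le_trans h _.
Qed.

End OU_L1_contraction.

Theorem proposition3p7 (R : realType) (X : completeNormedModType R)
  (X_separable : separable X)
  (Q : {linear dual X -> X})
  (Q_bounded : exists C : R, forall xs : dual X, `|Q xs| <= C * opnorm xs)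
  (Q_sym : forall xs ys : dual X, ys (Q xs) = xs (Q ys))
  (Q_ge0 : forall xs : dual X, 0 <= (xs (Q xs) : R))
  (DA : set X) (A : X -> X) (S : R -> bop X X)
  (S_semigroup : C0_contraction_semigroup S)
  (A_generates : generates DA A S)
  (Qt : R -> dual X -> X)
  (Qt_def : forall (t : R) (xs : dual X), 0 < t ->
     bochner_integral (@lebesgue_measure R) `[0, t]
       (fun s => S s (Q (bcomp xs (S s)))) (Qt t xs))
  (Qt_gaussian : forall t : R, 0 < t ->
     exists2 mu_t : probability (borel X) R,
       centred_gaussian mu_t & covariance_operator mu_t (Qt t))
  (Qinf : dual X -> X)
  (Qinf_def : forall xs ys : dual X,
     (ys (Qt t xs) : R) @[t --> +oo] --> (ys (Qinf xs) : R))
  (mu_inf : probability (borel X) R)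
  (mu_inf_gaussian : centred_gaussian mu_inf)
  (mu_inf_cov : covariance_operator mu_inf Qinf)
  (mu_inf_nondeg : nondegenerate_measure mu_inf)
  (H : completeNormedModType R) (ip : H -> H -> R)
  (i : bop H X) (istar : dual X -> H)
  (H_RKHS : is_RKHS Q ip i istar)
  (QinfA_in_H : forall xs ys : dual X, adjoint_graph DA A xs ys ->
     exists h : H, i h = Qinf ys)
  (QinfA_bound : exists2 c : R, 0 < c &
     forall (xs ys : dual X) (h : H), adjoint_graph DA A xs ys ->
       i h = Qinf ys -> `|h| <= c * `|istar xs|)
  (U : X -> \bar R)
  (U_proper : proper_fun U) (U_lsc : lower_semicontinuous U)
  (U_convex : econvex U)
  (U_sobolev : forall p : R, 1 <= p ->
     exists (u : X -> R) (gu : X -> H), W1H istar mu_inf p u gu /\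
       {ae mu_inf, forall x : X, U x = (u x)%:E})
  (nu_inf : {measure set (borel X) -> \bar R})
  (nu_inf_def : forall E : set (borel X), measurable E ->
     nu_inf E = (\int[mu_inf]_(x in E) expeR (- U x))%E)
  (B : bop H H)
  (B_def : forall xs ys : dual X, adjoint_graph DA A xs ys ->
     i (B (istar xs)) = Qinf ys)
  (T2 : R -> (X -> R) -> X -> R)
  (T2_OU : perturbed_OU_semigroup ip istar B nu_inf T2) :
  exists T : R -> R -> (X -> R) -> X -> R,
    (forall p : R, 1 <= p ->
       [/\ Lp_extends nu_inf p T2 (T p),
           Lp_contraction_semigroup nu_inf p (T p),
           Lp_positive nu_inf p (T p),
           Lp_strongly_continuous nu_inf p (T p) &
           forall T' : R -> (X -> R) -> X -> R,
             Lp_extends nu_inf p T2 T' ->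
             Lp_contraction_semigroup nu_inf p T' ->
             Lp_positive nu_inf p T' ->
             forall (t : R) (f : X -> R), 0 <= t -> f \in Lfun nu_inf p%:E ->
               T' t f = T p t f %[ae nu_inf]]) /\
    (forall p q : R, 1 <= p -> p <= q ->
       forall f : X -> R, f \in Lfun nu_inf q%:E ->
         f \in Lfun nu_inf p%:E /\
         forall t : R, 0 <= t -> T p t f = T q t f %[ae nu_inf]).
Proof.
have nu_fin := gaussian_convex_finite mu_inf_gaussian U_proper U_lsc U_convex nu_inf_def.
have B_dissipative := RKHS_operator_dissipative Q_sym Q_ge0 S_semigroup
  A_generates Qt_def Qinf_def mu_inf_cov H_RKHS B_def.
have T2_L1 f t c := OU_L1_contraction (rkhs_hilbert H_RKHS) B_dissipative nu_fin
  T2_OU (f := f) (t := t) c.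
have [T TP] := L2_semigroup_extension nu_fin (OU_contr T2_OU) (OU_cont T2_OU) T2_L1.
exists (fun _ => T); split=> [p p1|p q p1 pq f qf].
  by have [T_ext T_semi T_pos T_cont T_uniq] := TP p p1; split => // T' *; exact: T_uniq.
by split=> [|t _]; [exact: Lfun_le qf|exact: aeW].
Qed.
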